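(* Let $f\in C^2(0,\infty)$ with $f'>0$ and $f''>0$. Let $u_l,u_r\in\mathbb{R}$ and $\rho_l,\rho_r>0$ be arbitrary, and for $\epsilon>0$ sufficiently small let $(u^\epsilon,\rho^\epsilon)$ be the admissible solution of the system $$u_t+\Big(\frac{u^2}{2}+\epsilon f(\rho)\Big)_x=0,\qquad \rho_t+(u\rho-\epsilon\rho)_x=0,\qquad x\in\mathbb{R},\ t>0,$$ with Riemann initial data $(u,\rho)(x,0)=(u_l,\rho_l)$ for $x<0$ and $(u,\rho)(x,0)=(u_r,\rho_r)$ for $x>0$. Then, as $\epsilon\to0$, $(u^\epsilon,\rho^\epsilon)$ converges in the sense of distributions on $\mathbb{R}\times(0,\infty)$ to a solution $(u,\rho)$ of the non-strictly hyperbolic system $$u_t+\Big(\frac{u^2}{2}\Big)_x=0,\qquad \rho_t+(\rho u)_x=0,\qquad x\in\mathbb{R},\ t>0,$$ with the same Riemann initial data.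
   Context: Admissible solution: for $\epsilon>0$ the scaled system has characteristic speeds $\lambda_{1}(u,\rho)=u-\frac{\epsilon}{2}-\frac12\sqrt{4\epsilon\rho f'(\rho)+\epsilon^2}$ and $\lambda_{2}(u,\rho)=u-\frac{\epsilon}{2}+\frac12\sqrt{4\epsilon\rho f'(\rho)+\epsilon^2}$, with right eigenvectors $X_{1}=\Big(\frac{\epsilon-\sqrt{4\epsilon\rho f'(\rho)+\epsilon^2}}{2\rho},1\Big)$ and $X_{2}=\Big(\frac{\epsilon+\sqrt{4\epsilon\rho f'(\rho)+\epsilon^2}}{2\rho},1\Big)$. The admissible solution of the Riemann problem is the self-similar solution (a function of $x/t$) composed of constant states separated by a 1-wave followed by a 2-wave. Each wave is either a rarefaction wave of the corresponding family (a continuous self-similar solution moving along the integral curve of $X_i$ with $\lambda_i=x/t$) or a shock satisfying the Rankine-Hugoniot conditions and the Lax entropy inequalities. A shock of speed $s$ with left state $(\bar u,\bar\rho)$ and right state $(u,\rho)$ satisfies the Rankine-Hugoniot conditions $$(u-\bar u)s=\tfrac12(u^2-\bar u^2)+\epsilon(f(\rho)-f(\bar\rho)),\qquad (\rho-\bar\rho)s=(\rho u-\bar\rho\bar u)-\epsilon(\rho-\bar\rho).$$ The Lax inequalities are $s<\lambda_1(\bar u,\bar\rho)$ and $\lambda_1(u,\rho)<s<\lambda_2(u,\rho)$ for a 1-shock, and $s>\lambda_2(u,\rho)$ and $\lambda_1(\bar u,\bar\rho)<s<\lambda_2(\bar u,\bar\rho)$ for a 2-shock. When $u_l<u_r$,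 a vacuum region ($\rho=0$) is allowed between the two rarefaction waves, in which $u=x/t$. Solution of the limit system: let $u$ be a Borel measurable function and $\rho=d\nu$ a Radon measure on $\mathbb{R}\times[0,\infty)$. Then $(u,\rho=d\nu)$ is a solution of the limit system with initial data $(u_0,\rho_0)$ if $$\int_{\mathbb{R}\times[0,\infty)}\Big(u\,\phi_t+\frac{u^2}{2}\phi_x\Big)\,dx\,dt+\int_{\mathbb{R}}u_0(x)\phi(x,0)\,dx=0,$$ $$\int_{\mathbb{R}\times[0,\infty)}(\phi_t+u\,\phi_x)\,d\nu+\int_{\mathbb{R}}\rho_0(x)\phi(x,0)\,dx=0$$ for every test function $\phi\in C_c^\infty(\mathbb{R}\times[0,\infty))$. *)

(* Defs.v *)
From HB Require Import structures.
From mathcomp Require Import all_boot all_order all_algebra.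
From mathcomp Require Import all_classical all_reals all_analysis.

Set Implicit Arguments.
Unset Strict Implicit.
Unset Printing Implicit Defensive.

Import Order.TTheory GRing.Theory Num.Theory.
Import numFieldNormedType.Exports.

Local Open Scope ring_scope.
Local Open Scope classical_set_scope.

Section scaled_system.
Variable R : realType.

(* States are pairs (u, rho), space-time points are pairs (x, t). *)

Definition C2_pos (f : R -> R) :=
  forall r : R, 0 < r ->
    [/\ derivable f r 1, derivable (derive1 f) r 1 &
        {for r, continuous (derive1 (derive1 f))}].

Variables (f : R -> R) (eps : R).

(* At rho = 0 the radicand is eps ^+ 2 whatever the value of derive1 f 0, which is
   also its limit as rho tends to 0 when f' is bounded near 0. *)
Definition radical (rho : R) : R :=
  Num.sqrt (4 * eps * rho * derive1 f rho + eps ^+ 2).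

Definition lambda1 (v : R * R) : R := v.1 - eps / 2 - radical v.2 / 2.
Definition lambda2 (v : R * R) : R := v.1 - eps / 2 + radical v.2 / 2.

Definition X1 (v : R * R) : R * R := ((eps - radical v.2) / (2 * v.2), 1).
Definition X2 (v : R * R) : R * R := ((eps + radical v.2) / (2 * v.2), 1).

(* A self-similar state V, function of xi = x / t, is a rarefaction wave of the
   family (lam, X) on [a, b].  The case a = b is the trivial wave l = r. *)
Definition rarefaction (lam : R * R -> R) (X : R * R -> R * R)
    (a b : R) (V : R -> R * R) (l r : R * R) :=
  [/\ a <= b,
      {within `[a, b], continuous V},
      V a = l /\ V b = r,
      forall xi, a <= xi <= b -> lam (V xi) = xi &
      forall xi, a < xi < b ->
        0 < (V xi).2 /\
        exists c : R, is_derive xi 1 (fst \o V) (c * (X (V xi)).1) /\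
                      is_derive xi 1 (snd \o V) (c * (X (V xi)).2)].

Definition rankine_hugoniot (s : R) (l r : R * R) :=
  (r.1 - l.1) * s = (r.1 ^+ 2 - l.1 ^+ 2) / 2 + eps * (f r.2 - f l.2) /\
  (r.2 - l.2) * s = (r.2 * r.1 - l.2 * l.1) - eps * (r.2 - l.2).

Definition shock1 (s : R) (l r : R * R) :=
  [/\ rankine_hugoniot s l r, s < lambda1 l & lambda1 r < s < lambda2 r].

Definition shock2 (s : R) (l r : R * R) :=
  [/\ rankine_hugoniot s l r, lambda2 r < s & lambda1 l < s < lambda2 l].

(* A shock occupies the single value a = b = s of xi = x / t; the value of V
   there is irrelevant. *)
Definition wave1 (a b : R) (V : R -> R * R) (l r : R * R) :=
  rarefaction lambda1 X1 a b V l r \/ (a = b /\ shock1 a l r).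

Definition wave2 (a b : R) (V : R -> R * R) (l r : R * R) :=
  rarefaction lambda2 X2 a b V l r \/ (a = b /\ shock2 a l r).

Definition two_wave_fan (l r : R * R) (V : R -> R * R) :=
  exists a1 b1 a2 b2 : R, exists m : R * R,
  [/\ 0 < m.2 /\ b1 < a2,
      wave1 a1 b1 V l m /\ wave2 a2 b2 V m r,
      forall xi, xi < a1 -> V xi = l,
      forall xi, b1 < xi < a2 -> V xi = m &
      forall xi, b2 < xi -> V xi = r].

Definition vacuum_fan (l r : R * R) (V : R -> R * R) :=
  exists a1 b1 a2 b2 : R, exists m1 m2 : R * R,
  [/\ [/\ l.1 < r.1, m1.2 = 0, m2.2 = 0 & b1 < a2],
      rarefaction lambda1 X1 a1 b1 V l m1 /\
      rarefaction lambda2 X2 a2 b2 V m2 r,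
      forall xi, xi < a1 -> V xi = l,
      forall xi, b1 < xi < a2 -> V xi = (xi, 0) &
      forall xi, b2 < xi -> V xi = r].

Definition admissible_solution (l r : R * R) (u rho : R * R -> R) :=
  exists V : R -> R * R,
    (two_wave_fan l r V \/ vacuum_fan l r V) /\
    forall x t : R, 0 < t ->
      u (x, t) = (V (x / t)).1 /\ rho (x, t) = (V (x / t)).2.

End scaled_system.

Section distributions.
Variable R : realType.

Definition riemann_data (l r : R) (x : R) : R := if x < 0 then l else r.

(* R x [0, oo[ and R x ]0, oo[ *)
Definition closed_half_plane : set (R * R) := [set z | 0 <= z.2].
Definition open_half_plane : set (R * R) := [set z | 0 < z.2].

Definition leb2 := (@lebesgue_measure R \x @lebesgue_measure R)%E.

Definition dx (phi : R * R -> R) (z : R * R) : R := 'D_((1, 0) : R * R) phi z.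
Definition dt (phi : R * R -> R) (z : R * R) : R := 'D_((0, 1) : R * R) phi z.

(* s lists the variables of differentiation: true for x, false for t. *)
Fixpoint partial (s : seq bool) (phi : R * R -> R) : R * R -> R :=
  if s is b :: s' then (if b then dx else dt) (partial s' phi) else phi.

Definition smooth (phi : R * R -> R) :=
  forall s : seq bool,
    continuous (partial s phi) /\
    forall z : R * R, derivable (partial s phi) z (1, 0) /\
                      derivable (partial s phi) z (0, 1).

Definition supp (phi : R * R -> R) : set (R * R) :=
  closure [set z | phi z != 0].

(* C_c^oo (R x [0, oo[): functions smooth up to the boundary t = 0, on which
   they need not vanish, given as restrictions of functions of
   C_c^oo (R x R).  Only the values for t >= 0 are ever used. *)
Definition test_closed (phi : R * R -> R) := smooth phi /\ compact (supp phi).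

(* C_c^oo (R x ]0, oo[), extended by 0. *)
Definition test_open (phi : R * R -> R) :=
  [/\ smooth phi, compact (supp phi) & supp phi `<=` open_half_plane].

(* Radon measure on R x [0, oo[: a Borel measure that is finite on compact
   sets.  It is carried by R * R, but only its restriction to the closed half
   plane is ever used. *)
Definition radon
    (nu : {measure set (measurableTypeR R * measurableTypeR R) -> \bar R}) :=
  forall K : set (R * R), compact K -> K `<=` closed_half_plane ->
    (nu K < +oo)%E.

(* Since (+oo - oo = -oo)%E, these equations force every integral in them to be
   finite, hence the integrands to be integrable. *)
Definition limit_solution (u0 rho0 : R -> R) (u : R * R -> R)
    (nu : {measure set (measurableTypeR R * measurableTypeR R) -> \bar R}) :=
  [/\ measurable_fun (closed_half_plane :
        set (measurableTypeR R * measurableTypeR R)) u,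
      radon nu,
      forall phi, test_closed phi ->
        (\int[leb2]_(z in closed_half_plane)
            (u z * dt phi z + u z ^+ 2 / 2 * dx phi z)%:E +
         \int[lebesgue_measure]_x (u0 x * phi (x, 0))%:E = 0)%E &
      forall phi, test_closed phi ->
        (\int[nu]_(z in closed_half_plane)
            (dt phi z + u z * dx phi z)%:E +
         \int[lebesgue_measure]_x (rho0 x * phi (x, 0%R))%:E = 0)%E].

Definition locally_integrable2 (w : R * R -> R) :=
  forall K : set (R * R), compact K -> K `<=` open_half_plane ->
    leb2.-integrable K (EFin \o w).

Definition distr_of_fun (w phi : R * R -> R) : \bar R :=
  (\int[leb2]_(z in open_half_plane) (w z * phi z)%:E)%E.

Definition distr_of_measure
    (nu : {measure set (measurableTypeR R * measurableTypeR R) -> \bar R})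
    (phi : R * R -> R) : \bar R :=
  (\int[nu]_(z in open_half_plane) (phi z)%:E)%E.

(* Convergence of w_ eps in D'(R x ]0, oo[) as eps tends to 0 from above. *)
Definition distr_cvg (w_ : R -> R * R -> R) (T : (R * R -> R) -> \bar R) :=
  (\forall eps \near 0^'+, locally_integrable2 (w_ eps)) /\
  forall phi, test_open phi ->
    distr_of_fun (w_ eps) phi @[eps --> 0^'+] --> T phi.

End distributions.

(* Main.v *)
(* For fixed data and small [eps], the wave speeds and the slopes of the wave curves are
   within [sqrt eps] of those of transport by [u], as long as the density stays below a
   fixed bound [M].  If [ul <= ur] the density stays below [max rhol rhor], and the fan is
   uniformly close to the constant states outside [ul, ur] and to [(xi, 0)] inside.  If
   [ul > ur] both waves are shocks, the intermediate density blows up, and the two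
   Rankine-Hugoniot mass conditions force the speeds to [(ul + ur) / 2] and the mass
   between the shocks, per unit time, to [(ul - ur) / 2 * (rhol + rhor)]: the limit carries
   a delta shock.  Convergence in the sense of distributions then follows from bounds on the
   fan that are uniform off two rays, and small off thin strips.

   That the limit solves the limit system rests on one identity, the fundamental theorem of
   calculus along rays: for a weight [h (x - c t)], the integral of
   [h (x - c t) * (dt phi + c * dx phi)] over [t > 0] is minus that of [h x * phi (x, 0)].
   A shock or a contact is a combination of two such weights, a centered rarefaction the
   integral over its speeds [c] of the weights [1_(x < c t)], and the delta shock is handled
   by the same identity on a single ray, weighted by [t].

   Fans exist by the intermediate value theorem, applied to the difference of the velocities
   on the two wave curves as functions of the intermediate density. *)
Require Import Defs.
From HB Require Import structures.
From mathcomp Require Import all_boot all_order all_algebra.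
From mathcomp Require Import all_classical all_reals all_analysis.
From mathcomp Require Import measurable_realfun ring lra.
Import Order.TTheory GRing.Theory Num.Theory.
Import numFieldNormedType.Exports.
Set Implicit Arguments.
Unset Strict Implicit.
Unset Printing Implicit Defensive.
Local Open Scope ring_scope.
Local Open Scope classical_set_scope.

(** * Wave speeds and wave curves *)

(** Convergence is claimed for every family of admissible solutions, so each estimate is proved for
    an arbitrary fan, from its wave structure alone. Three facts shape the estimates. The slope of
    the second wave curve, [(eps + rad) / (2 * rho)], exceeds [eps / rho], so the velocity on it
    falls at least logarithmically as the density tends to 0: no vacuum occurs for [eps > 0], and
    the vacuum of the limit is the trace of a 2-rarefaction whose density is exponentially small in
    [1 / eps]. The square of [rad] and the squared velocity drop of a shock are of order [eps] at
    bounded density, hence the shape [eps * C <= eta ^+ 2] of all smallness conditions. In the delta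
    case no bound on the density is uniform in [eps]; the plateau between the shocks is split off
    and controlled through its mass, which stays bounded. Quantifiers: [C] depends on the test
    function, then comes the tolerance [delta], then [eta], and [eps] is chosen last. *)

Section flux.
Context {R : realType}.
Variable f : R -> R.
Hypothesis hf : C2_pos f.
Hypothesis hf' : forall r : R, 0 < r -> 0 < derive1 f r.
Hypothesis hf'' : forall r : R, 0 < r -> 0 < derive1 (derive1 f) r.

Lemma flux_is_derive (r : R) : 0 < r -> is_derive r 1 f (derive1 f r).
Proof. by move=> /hf[df _ _]; rewrite derive1E; apply: DeriveDef. Qed.

Lemma slope_is_derive (r : R) : 0 < r ->
  is_derive r 1 (derive1 f) (derive1 (derive1 f) r).
Proof.
by move=> /hf[_ df _]; rewrite [derive1 (derive1 f) r]derive1E; apply: DeriveDef.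
Qed.

Lemma slope_lt (a b : R) : 0 < a -> a < b -> derive1 f a < derive1 f b.
Proof.
move=> a0 ab.
have p x : x \in `[a, b]%R -> 0 < x.
  by rewrite in_itv /= => /andP[/(lt_le_trans a0)].
have cf : {within `[a, b], continuous (derive1 f)}.
  apply: derivable_within_continuous => x xab.
  by case: (slope_is_derive (p x xab)).
have [|c cab E] := @MVT R (derive1 f) (derive1 (derive1 f)) a b ab _ cf.
  by move=> x xab; apply/slope_is_derive/p/subset_itv_oo_cc.
rewrite -subr_gt0 E mulr_gt0 ?subr_gt0// hf''//.
exact/p/subset_itv_oo_cc.
Qed.

(** Mean value theorem together with [slope_lt]. The lower bound makes flux differences positive;
    both bounds together become the Lax inequalities in [shock1_exists] and [shock2_exists]. *)
Lemma chord_slope (a b : R) : 0 < a -> a < b ->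
  derive1 f a * (b - a) < f b - f a < derive1 f b * (b - a).
Proof.
move=> a0 ab.
have p x : x \in `[a, b]%R -> 0 < x.
  by rewrite in_itv /= => /andP[/(lt_le_trans a0)].
have cf : {within `[a, b], continuous f}.
  apply: derivable_within_continuous => x xab.
  by case: (flux_is_derive (p x xab)).
have [|c cab E] := @MVT R f (derive1 f) a b ab _ cf.
  by move=> x xab; apply/flux_is_derive/p/subset_itv_oo_cc.
move: (cab); rewrite in_itv /= => /andP[ac cb].
rewrite E !ltr_pM2r ?subr_gt0// !slope_lt//.
exact: lt_trans ac.
Qed.

Section radical.
Variable eps : R.
Hypothesis eps0 : 0 < eps.
Local Notation rad := (radical f eps).

Lemma radicand_ge (r : R) : 0 <= r ->
  eps ^+ 2 <= 4 * eps * r * derive1 f r + eps ^+ 2.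
Proof.
rewrite le_eqVlt => /predU1P[<-|r0]; first by rewrite mulr0 mul0r add0r.
by rewrite lerDr !mulr_ge0 ?hf'// ltW// hf'.
Qed.

Lemma sqr_radical (r : R) : 0 <= r ->
  rad r ^+ 2 = 4 * eps * r * derive1 f r + eps ^+ 2.
Proof.
by move=> r0; rewrite sqr_sqrtr// (le_trans _ (radicand_ge r0))// sqr_ge0.
Qed.

Lemma radical_ge (r : R) : 0 <= r -> eps <= rad r.
Proof.
move=> r0; rewrite -[leLHS]gtr0_norm// -sqrtr_sqr ler_wsqrtr//.
exact: radicand_ge.
Qed.

Lemma radical_gt (r : R) : 0 < r -> eps < rad r.
Proof.
move=> r0; rewrite -(ltr_pXn2r (n:=2)) ?nnegrE ?sqrtr_ge0 ?ltW//.
rewrite sqr_radical; last exact: ltW.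
by rewrite ltrDr !mulr_gt0// hf'//.
Qed.

Lemma radical_lt (a b : R) : 0 < a -> a < b -> rad a < rad b.
Proof.
move=> a0 ab; have b0 := lt_trans a0 ab.
rewrite -(ltr_pXn2r (n:=2)) ?nnegrE ?sqrtr_ge0//.
rewrite !sqr_radical ?ltW// ltrD2r -!mulrA !ltr_pM2l//.
by rewrite ltr_pM// ?ltW ?hf'// slope_lt.
Qed.

Lemma radical_le (a b : R) : 0 <= a -> a <= b -> 0 < b -> rad a <= rad b.
Proof.
move=> a0 ab b0.
move: a0; rewrite le_eqVlt => /predU1P[<-|a0].
  have -> : rad 0 = eps by rewrite /radical mulr0 mul0r add0r sqrtr_sqr gtr0_norm.
  exact/radical_ge/ltW.
by move: ab; rewrite le_eqVlt => /predU1P[->//|ab]; exact/ltW/radical_lt.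
Qed.

(** The derivative of [rad], read off from its square: twice [rad] times its derivative is
    [4 * eps * (f' + r * f'')]. *)
Definition dradical (r : R) : R :=
  2 * eps * (derive1 f r + r * derive1 (derive1 f) r) / rad r.

Lemma radical_is_derive (r : R) : 0 < r -> is_derive r 1 rad (dradical r).
Proof.
move=> r0.
have D1 := slope_is_derive r0.
pose g (s : R) := 4 * eps * s * derive1 f s + eps ^+ 2.
have gr0 : 0 < g r.
  by rewrite (lt_le_trans _ (radicand_ge (ltW r0)))// exprn_gt0.
have D2 := is_derive1_sqrt gr0.
have D3 : is_derive r 1 g (4 * eps * (derive1 f r + r * derive1 (derive1 f) r)).
  have -> : g = (4 * eps) \*: (id * derive1 f : R -> R) + cst (eps ^+ 2).
    by apply/funext => s; rewrite /g !fctE /=; set a := 4 * eps; rewrite /GRing.scale /= mulrA.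
  apply: is_derive_eq.
  by rewrite addr0 /GRing.scale /= mulr1 addrC.
have := @is_derive1_comp R _ g r _ _ D2 D3.
move=> h; apply: (@is_derive_eq _ _ _ _ _ _ _ _ h).
rewrite /dradical /radical -/(g r).
have := sqrtr_gt0 (g r); rewrite gr0 => /lt0r_neq0 ?.
by field.
Qed.

Lemma dradical_gt0 (r : R) : 0 < r -> 0 < dradical r.
Proof.
move=> r0; rewrite divr_gt0 ?mulr_gt0// ?addr_gt0 ?mulr_gt0 ?hf'// ?hf''//.
exact/(lt_trans eps0)/radical_gt.
Qed.

(* [(rad - eps) / (2 r) = 2 eps f' / (rad + eps)] is at most [2 eps f' / rad]. *)
Lemma dradical_ge (r : R) : 0 < r -> (rad r - eps) / (2 * r) <= dradical r.
Proof.
move=> r0; have rg := radical_gt r0; have R0 := lt_trans eps0 rg.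
have E := sqr_radical (ltW r0).
rewrite ler_pdivrMr ?mulr_gt0// /dradical mulrAC ler_pdivlMr//.
have f2 := hf'' r0.
have : 0 < r * derive1 (derive1 f) r by rewrite mulr_gt0.
have : 0 < eps * r * (r * derive1 (derive1 f) r) by rewrite !mulr_gt0.
have : 0 < eps * (rad r - eps) by rewrite mulr_gt0// subr_gt0.
move: E; rewrite !expr2; lra.
Qed.

End radical.
End flux.

Lemma nondecreasing_of_derive (R : realType) (g : R -> R) (a b : R) :
  {within `[a, b], continuous g} ->
  (forall x, a < x < b -> exists2 d, is_derive x 1 g d & 0 <= d) ->
  forall x y, a <= x -> x <= y -> y <= b -> g x <= g y.
Proof.
move=> cg dg x y ax xy yb.
apply: (@ger0_derive1_le_cc R g a b) => //.
- by move=> z /dg[d [] ].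
- by move=> z /dg[d []]; rewrite derive1E => _ ->.
- by rewrite in_itv /= ax (le_trans xy).
- by rewrite in_itv /= (le_trans ax).
Qed.

(** * Rarefaction waves *)

Section rarefactions.
Context {R : realType}.
Variable f : R -> R.
Hypothesis hf : C2_pos f.
Hypothesis hf' : forall r : R, 0 < r -> 0 < derive1 f r.
Hypothesis hf'' : forall r : R, 0 < r -> 0 < derive1 (derive1 f) r.
Variable eps : R.
Hypothesis eps0 : 0 < eps.
Local Notation rad := (radical f eps).

Lemma rarefaction_fst lam X a b V l r :
  rarefaction lam X a b V l r -> {within `[a, b], continuous (fst \o V : R -> R)}.
Proof.
move=> [_ cV _ _ _]; apply: (@within_continuous_comp _ _ _ _ V fst _ cV) => x _.
exact: cvg_fst.
Qed.

Lemma rarefaction_snd lam X a b V l r :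
  rarefaction lam X a b V l r -> {within `[a, b], continuous (snd \o V : R -> R)}.
Proof.
move=> [_ cV _ _ _]; apply: (@within_continuous_comp _ _ _ _ V snd _ cV) => x _.
exact: cvg_snd.
Qed.

Lemma radical_continuous (r : R) : 0 < r -> {for r, continuous rad}.
Proof.
move=> r0; have [D _] := radical_is_derive hf hf' eps0 r0.
exact/differentiable_continuous/derivable1_diffP.
Qed.

(** Genuine nonlinearity: differentiating [lambda1 (V xi) = xi] gives [1 = c * k], where [k] is the
    derivative of [lambda1] in the direction [X1]. Both terms of [k] are negative, hence [c < 0]:
    the density falls along a 1-rarefaction. *)
Lemma rarefaction1_rate a b V l r xi :
  rarefaction (lambda1 f eps) (X1 f eps) a b V l r -> a < xi < b ->
  exists c, [/\ c < 0, 0 < (V xi).2,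
    is_derive xi 1 (fst \o V) (c * ((eps - rad (V xi).2) / (2 * (V xi).2))) &
    is_derive xi 1 (snd \o V) c].
Proof.
move=> [ab cV _ lV dV] xiab; have [r0 [c [D1]]] := dV _ xiab.
rewrite /= mulr1 => D2; exists c; split => //.
have D3 := @is_derive1_comp R rad (snd \o V) xi _ _
  (radical_is_derive hf hf' eps0 r0) D2.
have D4 : is_derive xi 1 (fun x => (V x).1 - eps / 2 - rad (V x).2 / 2)
   (c * ((eps - rad (V xi).2) / (2 * (V xi).2)) - dradical f eps (V xi).2 * c / 2).
  have -> : (fun x => (V x).1 - eps / 2 - rad (V x).2 / 2) =
     (fst \o V) - cst (eps / 2) - (2^-1 \*: (rad \o (snd \o V)) : R -> R).
    by apply/funext => x /=; rewrite !fctE /= /GRing.scale /= (mulrC 2^-1).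
  apply: is_derive_eq; rewrite subr0 /GRing.scale /=; ring.
(* The relation [lambda1 (V x) = x] is known on [[a, b]] only; a neighbourhood of the interior point
   [xi] suffices for the derivative. *)
have D5 : is_derive xi 1 (fun x => (V x).1 - eps / 2 - rad (V x).2 / 2) 1.
  apply: (@near_eq_is_derive _ _ _ (fun x : R => x)) => //.
  have [axi xib] := andP xiab.
  near=> x; suff /lV : a <= x <= b by rewrite /lambda1 => ->.
  by apply/andP; split; apply/ltW; near: x; [exact: lt_nbhsr|exact: lt_nbhsl].
have [_ E1] := D4; have [_ E2] := D5; rewrite E1 in E2.
have rg := radical_gt hf' eps0 r0.
have dg := dradical_gt0 hf' hf'' eps0 r0.
rewrite ltNge; apply/negP => c0; move: E2; apply/eqP; rewrite lt_eqF//.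
rewrite (@le_lt_trans _ _ 0)// subr_le0 (@le_trans _ _ 0)//.
  by rewrite mulr_ge0_le0// mulr_le0_ge0// ?invr_ge0 ?mulr_ge0// ?ltW// subr_lt0.
by rewrite divr_ge0// mulr_ge0// ltW.
Unshelve. all: by end_near. Qed.

(** As for the first family, except that both terms of the derivative of [lambda2] in the direction
    [X2] are positive. *)
Lemma rarefaction2_rate a b V l r xi :
  rarefaction (lambda2 f eps) (X2 f eps) a b V l r -> a < xi < b ->
  exists c, [/\ 0 < c, 0 < (V xi).2,
    is_derive xi 1 (fst \o V) (c * ((eps + rad (V xi).2) / (2 * (V xi).2))) &
    is_derive xi 1 (snd \o V) c].
Proof.
move=> [ab cV _ lV dV] xiab; have [r0 [c [D1]]] := dV _ xiab.
rewrite /= mulr1 => D2; exists c; split => //.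
have D3 := @is_derive1_comp R rad (snd \o V) xi _ _
  (radical_is_derive hf hf' eps0 r0) D2.
have D4 : is_derive xi 1 (fun x => (V x).1 - eps / 2 + rad (V x).2 / 2)
   (c * ((eps + rad (V xi).2) / (2 * (V xi).2)) + dradical f eps (V xi).2 * c / 2).
  have -> : (fun x => (V x).1 - eps / 2 + rad (V x).2 / 2) =
     (fst \o V) - cst (eps / 2) + (2^-1 \*: (rad \o (snd \o V)) : R -> R).
    by apply/funext => x /=; rewrite !fctE /= /GRing.scale /= (mulrC 2^-1).
  apply: is_derive_eq; rewrite subr0 /GRing.scale /=; ring.
have D5 : is_derive xi 1 (fun x => (V x).1 - eps / 2 + rad (V x).2 / 2) 1.
  apply: (@near_eq_is_derive _ _ _ (fun x : R => x)) => //.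
  have [axi xib] := andP xiab.
  near=> x; suff /lV : a <= x <= b by rewrite /lambda2 => ->.
  by apply/andP; split; apply/ltW; near: x; [exact: lt_nbhsr|exact: lt_nbhsl].
have [_ E1] := D4; have [_ E2] := D5; rewrite E1 in E2.
have rg := radical_gt hf' eps0 r0.
have dg := dradical_gt0 hf' hf'' eps0 r0.
rewrite ltNge; apply/negP => c0; move: E2; apply/eqP; rewrite lt_eqF//.
rewrite (@le_lt_trans _ _ 0)// -[leRHS]addr0 lerD//.
  rewrite mulr_le0_ge0// ltW// divr_gt0// ?mulr_gt0 ?addr_gt0//.
  exact: lt_trans rg.
by rewrite mulr_le0_ge0// mulr_ge0_le0// ltW.
Unshelve. all: by end_near. Qed.

(* [rho * exp (- u / eps)] decreases along a 2-rarefaction, so that the density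
   vanishes nowhere. *)
Lemma rarefaction2_no_vacuum a b V l r :
  rarefaction (lambda2 f eps) (X2 f eps) a b V l r -> 0 < r.2 -> 0 < l.2.
Proof.
move=> rV r0; have [ab _ [Va Vb] _ _] := rV.
pose g x := - ((V x).2 * expR (- ((V x).1 / eps))).
have : g a <= g b.
  apply: (@nondecreasing_of_derive R g a b) => //.
  - apply/subspace_continuousP => y yab; apply: cvgN; apply: cvgM.
      exact: (subspace_continuousP _ _).1 (rarefaction_snd rV) _ yab.
    apply: (@continuous_cvg _ _ _ _ _ (fun x => - ((V x).1 / eps)) expR).
      exact: continuous_expR.
    apply: cvgN; apply: cvgMl.
    exact: (subspace_continuousP _ _).1 (rarefaction_fst rV) _ yab.
  - move=> x xab; have [c [c0 x0 D1 D2]] := rarefaction2_rate rV xab.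
    have D3 : is_derive x 1 (- (eps^-1 \*: (fst \o V)) : R -> R)
        (- (eps^-1 * (c * ((eps + rad (V x).2) / (2 * (V x).2))))).
      exact: is_derive_eq.
    have D4 := @is_derive1_comp R expR _ x _ _ (is_derive_expR _) D3.
    exists (c * ((rad (V x).2 - eps) / (2 * eps)) *
            expR (- (eps^-1 * (V x).1))).
      have -> : g = - ((snd \o V) * (expR \o (- (eps^-1 \*: (fst \o V)))) : R -> R).
        by apply/funext => y; rewrite /g !fctE /= /GRing.scale /= (mulrC eps^-1).
      apply: is_derive_eq; rewrite /GRing.scale /= !fctE /= /GRing.scale /=.
      field; rewrite !gt_eqF//.
    rewrite mulr_ge0 ?expR_ge0// ltW// mulr_gt0// divr_gt0 ?mulr_gt0//.
    by rewrite subr_gt0 (radical_gt hf').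
rewrite /g lerN2 Va Vb => h.
rewrite -(pmulr_lgt0 _ (expR_gt0 (- (l.1 / eps)))) (lt_le_trans _ h)//.
by rewrite mulr_gt0 ?expR_gt0.
Qed.

Lemma rarefaction2_mono a b V l r :
  rarefaction (lambda2 f eps) (X2 f eps) a b V l r ->
  forall x y, a <= x -> x <= y -> y <= b -> (V x).2 <= (V y).2.
Proof.
move=> rV x y ax xy yb.
apply: (@nondecreasing_of_derive R (snd \o V) a b) => //.
  exact: rarefaction_snd rV.
move=> z zab; have [c [c0 z0 D1 D2]] := rarefaction2_rate rV zab.
by exists c => //; exact: ltW.
Qed.

Lemma rarefaction2_mono_fst a b V l r :
  rarefaction (lambda2 f eps) (X2 f eps) a b V l r ->
  forall x y, a <= x -> x <= y -> y <= b -> (V x).1 <= (V y).1.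
Proof.
move=> rV x y ax xy yb.
apply: (@nondecreasing_of_derive R (fst \o V) a b) => //.
  exact: rarefaction_fst rV.
move=> z zab; have [c [c0 z0 D1 D2]] := rarefaction2_rate rV zab.
exists (c * ((eps + rad (V z).2) / (2 * (V z).2))) => //.
rewrite ltW// mulr_gt0// divr_gt0 ?mulr_gt0// addr_gt0//.
by rewrite (lt_trans eps0)// (radical_gt hf').
Qed.

(** [ln rho - (u - rad) / eps] has derivative [c / eps * (dradical - (rad - eps) / (2 * rho))],
    nonnegative by [dradical_ge]. Hence, where [u - rad] lies below its value at [r] by a fixed
    amount, the density is exponentially small in [1 / eps]. *)
Lemma rarefaction2_decay a b V l r :
  rarefaction (lambda2 f eps) (X2 f eps) a b V l r -> 0 < r.2 ->
  forall x, a <= x <= b -> (V x).2 <=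
    r.2 * expR (((V x).1 - rad (V x).2 - r.1 + rad r.2) / eps).
Proof.
move=> rV r0 x /andP[ax xb]; have [ab _ [Va Vb] _ _] := rV.
have l0 := rarefaction2_no_vacuum rV r0.
pose g x := (V x).2 * expR (- (((V x).1 - rad (V x).2) / eps)).
have : g x <= g b.
  apply: (@nondecreasing_of_derive R g a b) => //.
  - apply/subspace_continuousP => y yab; apply: cvgM.
      exact: (subspace_continuousP _ _).1 (rarefaction_snd rV) _ yab.
    apply: (@continuous_cvg _ _ _ _ _ (fun x => - (((V x).1 - rad (V x).2) / eps)) expR).
      exact: continuous_expR.
    apply: cvgN; apply: cvgMl; apply: cvgB.
      exact: (subspace_continuousP _ _).1 (rarefaction_fst rV) _ yab.
    apply: (@continuous_cvg _ _ _ _ _ (fun x => (V x).2) rad).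
      apply: radical_continuous; move: yab; rewrite /= in_itv /= => /andP[ay yb].
      by rewrite (lt_le_trans l0)// -Va (rarefaction2_mono rV).
    exact: (subspace_continuousP _ _).1 (rarefaction_snd rV) _ yab.
  - move=> y yab; have [c [c0 y0 D1 D2]] := rarefaction2_rate rV yab.
    have D0 := @is_derive1_comp R rad (snd \o V) y _ _
      (radical_is_derive hf hf' eps0 y0) D2.
    have D3 : is_derive y 1 (- (eps^-1 \*: ((fst \o V) - (rad \o (snd \o V)))) : R -> R)
        (- (eps^-1 * (c * ((eps + rad (V y).2) / (2 * (V y).2)) -
            dradical f eps (V y).2 * c))).
      exact: is_derive_eq.
    have D4 := @is_derive1_comp R expR _ y _ _ (is_derive_expR _) D3.
    exists (c / eps * ((V y).2 * (dradical f eps (V y).2 -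
                             (rad (V y).2 - eps) / (2 * (V y).2))) *
            expR (- (eps^-1 * ((V y).1 - rad (V y).2)))).
      have -> : g = (snd \o V) * (expR \o (- (eps^-1 \*: ((fst \o V) - (rad \o (snd \o V)))))) :> (R -> R).
        by apply/funext => z; rewrite /g !fctE /= /GRing.scale /= (mulrC eps^-1).
      apply: is_derive_eq; rewrite /GRing.scale /= !fctE /= /GRing.scale /=.
      by field; rewrite !gt_eqF.
    rewrite mulr_ge0 ?expR_ge0// mulr_ge0 ?divr_ge0 ?(ltW c0) ?(ltW eps0)//.
    by rewrite mulr_ge0 ?(ltW y0)// subr_ge0 (dradical_ge hf').
rewrite /g Vb => h.
rewrite -(ler_pM2r (expR_gt0 (- (((V x).1 - rad (V x).2) / eps)))).
apply: (le_trans h); rewrite -mulrA -expRD le_eqVlt; apply/orP; left.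
by apply/eqP; congr (_ * expR _); ring.
Qed.

Lemma rarefaction1_mono a b V l r :
  rarefaction (lambda1 f eps) (X1 f eps) a b V l r ->
  forall x y, a <= x -> x <= y -> y <= b -> (V y).2 <= (V x).2.
Proof.
move=> rV x y ax xy yb; rewrite -lerN2.
apply: (@nondecreasing_of_derive R (- (snd \o V)) a b) => //.
  by move=> z; apply: cvgN; exact: (rarefaction_snd rV).
move=> z zab; have [c [c0 z0 D1 D2]] := rarefaction1_rate rV zab.
by exists (- c); [exact: is_derive_eq|rewrite oppr_ge0 ltW].
Qed.

Lemma rarefaction1_mono_fst a b V l r :
  rarefaction (lambda1 f eps) (X1 f eps) a b V l r ->
  forall x y, a <= x -> x <= y -> y <= b -> (V x).1 <= (V y).1.
Proof.
move=> rV x y ax xy yb.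
apply: (@nondecreasing_of_derive R (fst \o V) a b) => //.
  exact: rarefaction_fst rV.
move=> z zab; have [c [c0 z0 D1 D2]] := rarefaction1_rate rV zab.
exists (c * ((eps - rad (V z).2) / (2 * (V z).2))) => //.
rewrite mulr_le0 ?(ltW c0)// mulr_le0_ge0// ?invr_ge0 ?mulr_ge0 ?ltW// subr_lt0.
by rewrite (radical_gt hf').
Qed.

(** By [dradical_ge], [rad] falls along the wave at least as fast as [u] rises. So the velocity
    gains at most [rad l.2], however much the density drops: a 1-rarefaction cannot carry a
    rarefaction of the limit. *)
Lemma rarefaction1_growth a b V l r :
  rarefaction (lambda1 f eps) (X1 f eps) a b V l r -> 0 < r.2 ->
  r.1 + rad r.2 <= l.1 + rad l.2.
Proof.
move=> rV r0; have [ab _ [Va Vb] _ _] := rV; rewrite -lerN2.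
pose g x := - ((V x).1 + rad (V x).2).
have : g a <= g b; last by rewrite /g Va Vb.
apply: (@nondecreasing_of_derive R g a b) => //.
- apply/subspace_continuousP => y yab; apply: cvgN; apply: cvgD.
    exact: (subspace_continuousP _ _).1 (rarefaction_fst rV) _ yab.
  apply: (@continuous_cvg _ _ _ _ _ (fun x => (V x).2) rad).
    apply: radical_continuous; move: yab; rewrite /= in_itv /= => /andP[ay yb].
    by rewrite (lt_le_trans r0)// -Vb (rarefaction1_mono rV).
  exact: (subspace_continuousP _ _).1 (rarefaction_snd rV) _ yab.
- move=> y yab; have [c [c0 y0 D1 D2]] := rarefaction1_rate rV yab.
  have D0 := @is_derive1_comp R rad (snd \o V) y _ _
      (radical_is_derive hf hf' eps0 y0) D2.
  exists (- c * (dradical f eps (V y).2 - (rad (V y).2 - eps) / (2 * (V y).2))).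
    have -> : g = - ((fst \o V) + (rad \o (snd \o V))) :> (R -> R) by [].
    by apply: is_derive_eq; ring.
  rewrite mulr_ge0 ?oppr_ge0 ?(ltW c0)// subr_ge0.
  exact: (dradical_ge hf').
Qed.

End rarefactions.

Lemma dist_half_difference (R : realType) (x u e r eta : R) :
  u - e / 2 + r / 2 = x -> e < r -> r <= eta -> 0 < e -> `|u - x| <= eta.
Proof.
by move=> <- er reta e0; rewrite ler_norml; apply/andP; split; lra.
Qed.

(** * Shock waves and the size of their jumps *)

Section shocks.
Context {R : realType}.
Variable f : R -> R.
Hypothesis hf : C2_pos f.
Hypothesis hf' : forall r : R, 0 < r -> 0 < derive1 f r.
Hypothesis hf'' : forall r : R, 0 < r -> 0 < derive1 (derive1 f) r.

Lemma flux_le (a b : R) : 0 < a -> a <= b -> f a <= f b.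
Proof.
move=> a0; rewrite le_eqVlt => /predU1P[->//|ab].
have /andP[h _] := chord_slope hf hf'' a0 ab.
by rewrite -subr_ge0 (le_trans _ (ltW h))// ltW// mulr_gt0 ?subr_gt0 ?hf'.
Qed.

Variable eps : R.
Hypothesis eps0 : 0 < eps.
Local Notation rad := (radical f eps).

(** The signs come from the Lax inequalities, the third formula is the mass condition, and the last
    one is the momentum condition after elimination of [s] by the third. *)
Lemma shock1P s l m : 0 < l.2 -> 0 < m.2 -> shock1 f eps s l m ->
  [/\ 0 < m.2 - l.2, 0 < l.1 - m.1,
      (s + eps - m.1) * (m.2 - l.2) = - l.2 * (l.1 - m.1) &
      (l.1 - m.1) ^+ 2 * (m.2 + l.2) + 2 * eps * (l.1 - m.1) * (m.2 - l.2) =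
      2 * eps * (f m.2 - f l.2) * (m.2 - l.2)].
Proof.
have e0 := eps0; move: l m => [ul rl] [um rm] /= l0 m0 [[/= RH1 RH2]].
rewrite /lambda1 /lambda2 /= => L1 /andP[L2 L3].
have gl := radical_gt hf' eps0 l0; have gm := radical_gt hf' eps0 m0.
have E1 : (s + eps - um) * (rm - rl) = - rl * (ul - um) by lra.
have E2 : (rm - rl) * (ul - s - eps) = rm * (ul - um) by lra.
have P0 : 0 < rm - rl.
  (* The Lax inequalities give [s + eps < ul]. If the density fell, [E2] would make the velocity
     rise, whereas [lambda1 m < s < lambda1 l] with a smaller [rad] at [m] makes it fall. If the
     density were unchanged, [E2] would equate the two states, and no [s] lies strictly between
     equal speeds. *)
  case: (ltgtP rl rm) => [|lt|eq]; first by rewrite subr_gt0.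
    have rr := radical_lt hf hf' hf'' eps0 m0 lt.
    have : 0 < (rl - rm) * (ul - s - eps) by rewrite mulr_gt0; lra.
    have : 0 < rm * (um - ul) -> 0 < um - ul by rewrite pmulr_rgt0.
    by lra.
  move: E2; rewrite eq subrr mul0r => /esym/eqP.
  by rewrite mulf_eq0 (gt_eqF m0) /= => /eqP; move: L1 L2; rewrite eq; lra.
have D0 : 0 < ul - um by rewrite -(pmulr_rgt0 _ m0) -E2 mulr_gt0//; lra.
split => //.
have E3 : (ul - um) * ((ul + um) / 2 - s) = eps * (f rm - f rl) by lra.
have -> : 2 * eps * (f rm - f rl) * (rm - rl) =
          2 * (rm - rl) * ((ul - um) * ((ul + um) / 2 - s)) by rewrite E3; ring.
have E4 : 2 * (ul - um) * ((s + eps - um) * (rm - rl)) =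
    2 * (ul - um) * (- rl * (ul - um)) by rewrite E1.
by move: E4; rewrite !expr2; lra.
Qed.

(** Mirror image of [shock1P] with one asymmetry: the term [- eps * rho] of the mass flux does not
    change sign with the family, so the term linear in the velocity drop has the opposite sign. *)
Lemma shock2P s m r : 0 < m.2 -> 0 < r.2 -> shock2 f eps s m r ->
  [/\ 0 < m.2 - r.2, 0 < m.1 - r.1,
      (s + eps - m.1) * (m.2 - r.2) = r.2 * (m.1 - r.1) &
      (m.1 - r.1) ^+ 2 * (m.2 + r.2) - 2 * eps * (m.1 - r.1) * (m.2 - r.2) =
      2 * eps * (f m.2 - f r.2) * (m.2 - r.2)].
Proof.
have e0 := eps0; move: m r => [um rm] [ur rr] /= m0 r0 [[/= RH1 RH2]].
rewrite /lambda1 /lambda2 /= => L1 /andP[L2 L3].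
have gr := radical_gt hf' eps0 r0; have gm := radical_gt hf' eps0 m0.
have E1 : (s + eps - um) * (rm - rr) = rr * (um - ur) by lra.
have E2 : (rm - rr) * (s + eps - ur) = rm * (um - ur) by lra.
have P0 : 0 < rm - rr.
  case: (ltgtP rr rm) => [|lt|eq]; first by rewrite subr_gt0.
    have rl := radical_lt hf hf' hf'' eps0 m0 lt.
    have : 0 < (rr - rm) * (s + eps - ur) by rewrite mulr_gt0; lra.
    have : 0 < rm * (ur - um) -> 0 < ur - um by rewrite pmulr_rgt0.
    by lra.
  move: E2; rewrite eq subrr mul0r => /esym/eqP.
  by rewrite mulf_eq0 (gt_eqF m0) /= => /eqP; move: L1 L3; rewrite eq; lra.
have D0 : 0 < um - ur by rewrite -(pmulr_rgt0 _ m0) -E2 mulr_gt0//; lra.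
split => //.
have E3 : (um - ur) * (s - (um + ur) / 2) = eps * (f rm - f rr) by lra.
have -> : 2 * eps * (f rm - f rr) * (rm - rr) =
          2 * (rm - rr) * ((um - ur) * (s - (um + ur) / 2)) by rewrite E3; ring.
have E4 : 2 * (um - ur) * ((s + eps - um) * (rm - rr)) =
    2 * (um - ur) * (rr * (um - ur)) by rewrite E1.
by move: E4; rewrite !expr2; lra.
Qed.

Section small.
(** [mu] and [M] are bounds for the densities, independent of [eps], and [eta] is the tolerance. The
    conditions carry [eta ^+ 2] because they bound squares: that of [rad], and those of the velocity
    drops. *)
Variables M mu eta : R.
Hypothesis mu0 : 0 < mu.
Hypothesis muM : mu <= M.
Hypothesis eta1 : eta <= 1.
Hypothesis epseta : eps <= eta.
Hypothesis small_radical : eps * (4 * M * derive1 f M + 1) <= eta ^+ 2.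
Hypothesis small_flux : 2 * eps * (f M - f mu) <= eta ^+ 2.
Hypothesis small_density : eps * M <= eta ^+ 2.

Let eta0 : 0 < eta. Proof. exact: lt_le_trans epseta. Qed.

Lemma radical_small r : 0 <= r -> r <= M -> rad r <= eta.
Proof.
move=> r0 rM; have M0 := lt_le_trans mu0 muM.
apply: (le_trans (radical_le hf hf' hf'' eps0 r0 rM M0)).
rewrite -(ler_pXn2r (n:=2)) ?nnegrE ?sqrtr_ge0 ?(ltW eta0)//.
rewrite (sqr_radical hf' eps0 (ltW M0)).
(* The summand [1] in [small_radical] absorbs the term [eps ^+ 2] of the radicand. *)
have : eps * eps <= eps * 1 by rewrite ler_pM2l// (le_trans epseta).
by move: small_radical; rewrite !expr2; lra.
Qed.

Lemma shock1_small s l m : 0 < m.2 -> mu <= l.2 -> m.2 <= M ->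
  shock1 f eps s l m -> l.1 - m.1 <= eta.
Proof.
have e0 := eps0; have et0 := eta0; move=> m0 mul mM sh; have l0 := lt_le_trans mu0 mul.
have [P0 D0 _ E] := shock1P l0 m0 sh.
have F1 : f m.2 - f l.2 <= f M - f mu.
  by apply: lerB; apply: flux_le.
have FP : 2 * eps * (f m.2 - f l.2) * (m.2 - l.2) <= eta ^+ 2 * (m.2 - l.2).
  rewrite ler_pM2r//; apply: le_trans small_flux.
  by rewrite ler_pM2l// mulr_gt0.
rewrite -(ler_pXn2r (n:=2)) ?nnegrE ?(ltW D0) ?(ltW eta0)//.
have S0 : 0 < m.2 + l.2 by rewrite addr_gt0.
rewrite -(ler_pM2r S0).
have h1 : 0 < 2 * eps * (l.1 - m.1) * (m.2 - l.2) by rewrite !mulr_gt0.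
have h2 : eta ^+ 2 * (m.2 - l.2) <= eta ^+ 2 * (m.2 + l.2).
  by rewrite ler_pM2l ?exprn_gt0//; lra.
by lra.
Qed.

(** Here the linear term has the wrong sign: the drop [D] satisfies only
    [D ^+ 2 <= 2 * eta * D + eta ^+ 2], whose positive solutions are at most [1 + sqrt 2] times
    [eta]. *)
Lemma shock2_small s m r : 0 < m.2 -> mu <= r.2 -> m.2 <= M ->
  shock2 f eps s m r -> m.1 - r.1 < 3 * eta.
Proof.
have e0 := eps0; have et0 := eta0; move=> m0 mur mM sh; have r0 := lt_le_trans mu0 mur.
have [P0 D0 _ E] := shock2P m0 r0 sh.
have F1 : f m.2 - f r.2 <= f M - f mu.
  by apply: lerB; apply: flux_le.
have FP : 2 * eps * (f m.2 - f r.2) * (m.2 - r.2) <= eta ^+ 2 * (m.2 - r.2).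
  rewrite ler_pM2r//; apply: le_trans small_flux.
  by rewrite ler_pM2l// mulr_gt0.
have S0 : 0 < m.2 + r.2 by rewrite addr_gt0.
have h2 : eta ^+ 2 * (m.2 - r.2) <= eta ^+ 2 * (m.2 + r.2).
  by rewrite ler_pM2l ?exprn_gt0//; lra.
have h3 : 2 * eps * (m.1 - r.1) * (m.2 - r.2) <=
          2 * eta * (m.1 - r.1) * (m.2 + r.2).
  apply: ler_pM; rewrite ?mulr_ge0 ?(ltW eps0) ?(ltW D0) ?(ltW P0)//; last by lra.
  by rewrite ler_pM2r// ler_pM2l.
have h4 : (m.1 - r.1) ^+ 2 <= 2 * eta * (m.1 - r.1) + eta ^+ 2.
  by rewrite -(ler_pM2r S0); lra.
rewrite ltNge; apply/negP => h5.
have : 0 <= (m.1 - r.1 - 3 * eta) * (m.1 - r.1).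
  by rewrite mulr_ge0 ?(ltW D0)// subr_ge0.
have := mulr_gt0 eta0 eta0.
have : 0 <= eta * (m.1 - r.1 - 3 * eta) by rewrite mulr_ge0 ?(ltW eta0)// subr_ge0.
by move: h4; rewrite !expr2; lra.
Qed.

(** From [y <= expR y] at [y = eta / eps], the exponential is at most [eps / eta]; [small_density]
    does the rest. *)
Lemma decay_small r x : 0 < r -> r <= M -> x <= - eta -> r * expR (x / eps) <= eta.
Proof.
move=> r0 rM xeta; apply: (@le_trans _ _ (M * (eps / eta))); last first.
  by rewrite mulrA ler_pdivrMr// -expr2 (mulrC M).
apply: ler_pM => //; rewrite ?expR_ge0 ?(ltW r0)//.
rewrite (@le_trans _ _ (expR (- (eta / eps))))//.
  by rewrite ler_expR -mulNr ler_pM2r// invr_gt0.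
have h : 0 < eta / eps by rewrite divr_gt0.
rewrite expRN -[leRHS]invrK invf_div lef_pV2 ?posrE ?expR_gt0//.
by apply: (le_trans _ (expR_ge1Dx _)); rewrite lerDr.
Qed.

(** A vacuum fan would contain a 2-rarefaction that starts at density 0, against
    [rarefaction2_no_vacuum]. *)
Lemma two_wave_cases l r V : mu <= l.2 -> mu <= r.2 ->
  two_wave_fan f eps l r V \/ vacuum_fan f eps l r V -> two_wave_fan f eps l r V.
Proof.
move=> l0 r0 [//|[a1 [b1 [a2 [b2 [m1 [m2 [[_ _ m20 _] [_ rV] _ _ _]]]]]]]].
have := rarefaction2_no_vacuum hf hf' hf'' eps0 rV (lt_le_trans mu0 r0).
by rewrite m20 ltxx.
Qed.

End small.
End shocks.

(** * Fans for a small parameter *)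

(* [lra] is slow in the presence of the other hypotheses. *)
Ltac scalar_lra := repeat match goal with
  | H : rarefaction _ _ _ _ _ _ _ |- _ => clear H
  | H : shock1 _ _ _ _ _ |- _ => clear H
  | H : shock2 _ _ _ _ _ |- _ => clear H
  | H : @eq (_ * _) _ _ |- _ => clear H
  | H : C2_pos _ |- _ => clear H
  | H : forall _, _ |- _ => clear H
  end; lra.

(** A plain disjunction, so that a case split leaves the boolean comparisons of the goal as they
    are, unlike [ltP]. *)
Lemma lt_or_le (R : realType) (x y : R) : x < y \/ y <= x.
Proof. by case: (ltP x y); [left|right]. Qed.

Definition in_box (R : realType) (a b c d : R) (v : R * R) :=
  a <= v.1 <= b /\ c <= v.2 <= d.

(** Both components are monotone along a rarefaction, so its end states confine it. For a shock
    [a = b], and no [xi] satisfies [a < xi <= b]: this is how the arbitrary value at the shock is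
    left out. *)
Lemma wave1_box (R : realType) (f : R -> R) (hf : C2_pos f)
    (hf' : forall r : R, 0 < r -> 0 < derive1 f r)
    (hf'' : forall r : R, 0 < r -> 0 < derive1 (derive1 f) r)
    (eps a b : R) (V : R -> R * R) (l m : R * R) (x0 x1 y0 y1 xi : R) :
  0 < eps -> wave1 f eps a b V l m ->
  in_box x0 x1 y0 y1 l -> in_box x0 x1 y0 y1 m ->
  a < xi -> xi <= b -> in_box x0 x1 y0 y1 (V xi).
Proof.
move=> eps0 [rV|[-> _ _ _]]; last by move=> /lt_le_trans /[apply]; rewrite ltxx.
have [ab _ [Va Vb] _ _] := rV => -[/andP[l1 l2] /andP[l3 l4]].
move=> [/andP[m1 m2] /andP[m3 m4]] /ltW axi xib; rewrite -Va -Vb in l1 l2 l3 l4 m1 m2 m3 m4.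
have h1 := rarefaction1_mono hf hf' hf'' eps0 rV.
have h2 := rarefaction1_mono_fst hf hf' hf'' eps0 rV.
split; apply/andP; split.
- by apply: (le_trans l1); apply: h2.
- by apply: le_trans m2; apply: h2.
- by apply: (le_trans m3); apply: h1.
- by apply: le_trans l4; apply: h1.
Qed.

Lemma wave2_box (R : realType) (f : R -> R) (hf : C2_pos f)
    (hf' : forall r : R, 0 < r -> 0 < derive1 f r)
    (hf'' : forall r : R, 0 < r -> 0 < derive1 (derive1 f) r)
    (eps a b : R) (V : R -> R * R) (m r : R * R) (x0 x1 y0 y1 xi : R) :
  0 < eps -> wave2 f eps a b V m r ->
  in_box x0 x1 y0 y1 m -> in_box x0 x1 y0 y1 r ->
  a < xi -> xi <= b -> in_box x0 x1 y0 y1 (V xi).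
Proof.
move=> eps0 [rV|[-> _ _ _]]; last by move=> /lt_le_trans /[apply]; rewrite ltxx.
have [ab _ [Va Vb] _ _] := rV => -[/andP[l1 l2] /andP[l3 l4]].
move=> [/andP[m1 m2] /andP[m3 m4]] /ltW axi xib; rewrite -Va -Vb in l1 l2 l3 l4 m1 m2 m3 m4.
have h1 := rarefaction2_mono hf hf' hf'' eps0 rV.
have h2 := rarefaction2_mono_fst hf hf' hf'' eps0 rV.
split; apply/andP; split.
- by apply: (le_trans l1); apply: h2.
- by apply: le_trans m2; apply: h2.
- by apply: (le_trans l3); apply: h1.
- by apply: le_trans m4; apply: h1.
Qed.

(* The value of a fan at a shock is arbitrary. *)
Lemma fan_box (R : realType) (f : R -> R) (hf : C2_pos f)
    (hf' : forall r : R, 0 < r -> 0 < derive1 f r)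
    (hf'' : forall r : R, 0 < r -> 0 < derive1 (derive1 f) r)
    (eps a1 b1 a2 b2 : R) (V : R -> R * R) (l m r : R * R) (x0 x1 y0 y1 : R) :
  0 < eps -> wave1 f eps a1 b1 V l m -> wave2 f eps a2 b2 V m r ->
  (forall xi, xi < a1 -> V xi = l) ->
  (forall xi, b1 < xi < a2 -> V xi = m) ->
  (forall xi, b2 < xi -> V xi = r) ->
  in_box x0 x1 y0 y1 l -> in_box x0 x1 y0 y1 m -> in_box x0 x1 y0 y1 r ->
  forall xi, xi != a1 -> xi != a2 -> in_box x0 x1 y0 y1 (V xi).
Proof.
move=> eps0 W1 W2 Vl Vm Vr Bl Bm Br xi xa1 xa2.
have [h1|h1] := lt_or_le xi a1; first by rewrite Vl.
have {xa1}h1 : a1 < xi by rewrite lt_neqAle eq_sym xa1.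
have [h2|h2] := lt_or_le b1 xi; last exact: (wave1_box hf hf' hf'' eps0 W1).
have [h3|h3] := lt_or_le xi a2; first by rewrite Vm// h2.
have {xa2}h3 : a2 < xi by rewrite lt_neqAle eq_sym xa2.
have [h4|h4] := lt_or_le b2 xi; first by rewrite Vr.
exact: (wave2_box hf hf' hf'' eps0 W2).
Qed.

(** Two rarefactions are the essential case: the first one changes the velocity by at most [eta], so
    the second one covers the whole interior. With exactly one shock the velocity rises by less than
    [2 * eta] in all, so the interior is empty; two shocks would lower the velocity. *)
Lemma fan_nondecreasing (R : realType) (f : R -> R) (hf : C2_pos f)
    (hf' : forall r : R, 0 < r -> 0 < derive1 f r)
    (hf'' : forall r : R, 0 < r -> 0 < derive1 (derive1 f) r)
    (eps M mu eta : R) (l r : R * R) (V : R -> R * R) :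
  0 < eps -> 0 < mu -> mu <= M -> eta <= 1 -> eps <= eta ->
  eps * (4 * M * derive1 f M + 1) <= eta ^+ 2 ->
  2 * eps * (f M - f mu) <= eta ^+ 2 -> eps * M <= eta ^+ 2 ->
  l.1 <= r.1 ->
  mu <= l.2 -> l.2 <= M -> mu <= r.2 -> r.2 <= M -> eta <= mu ->
  two_wave_fan f eps l r V ->
  [/\ forall xi, xi < l.1 - 2 * eta -> V xi = l,
      forall xi, r.1 + 2 * eta < xi -> V xi = r,
      forall xi, l.1 + 3 * eta < xi < r.1 - 3 * eta ->
        `|(V xi).1 - xi| <= eta /\ 0 <= (V xi).2 <= eta &
      exists a b, forall xi, xi != a -> xi != b ->
        in_box (l.1 - 1) (r.1 + 1) 0 M (V xi)].
Proof.
move=> eps0 mu0 muM eta1 epseta s1 s2 s3 lr l0 lM r0 rM.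
have eta0 := lt_le_trans eps0 epseta.
have small := radical_small hf hf' hf'' eps0 mu0 muM eta1 epseta s1.
have radgt := radical_gt hf' eps0.
have drop1 := shock1_small hf hf' hf'' eps0 mu0 epseta s2.
have drop2 := shock2_small hf hf' hf'' eps0 mu0 epseta s2.
have decay := decay_small eps0 epseta s3.
have growth := rarefaction1_growth hf hf' hf'' eps0.
have decay2 := rarefaction2_decay hf hf' hf'' eps0.
clear s1 s2 s3; have [rad radE] : exists rad, rad = radical f eps by eexists.
rewrite -radE in small radgt growth decay2.
have l0' := lt_le_trans mu0 l0; have r0' := lt_le_trans mu0 r0.
have rl := small _ (ltW l0') lM; have rr := small _ (ltW r0') rM.
have rl0 := radgt _ l0'; have rr0 := radgt _ r0'.
move=> etamu [a1 [b1 [a2 [b2 [m [[m0 ba] [W1 W2] Vl Vm Vr]]]]]].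
have rm0 := radgt _ m0.
have Bl : in_box (l.1 - 1) (r.1 + 1) 0 M l by split; apply/andP; split; scalar_lra.
have Br : in_box (l.1 - 1) (r.1 + 1) 0 M r by split; apply/andP; split; scalar_lra.
suff [H1 H2 H3 Bm] : [/\ l.1 - 2 * eta <= a1, b2 <= r.1 + 2 * eta,
    forall xi, l.1 + 3 * eta < xi < r.1 - 3 * eta ->
        `|(V xi).1 - xi| <= eta /\ 0 <= (V xi).2 <= eta &
    in_box (l.1 - 1) (r.1 + 1) 0 M m].
  split => //.
  - by move=> xi /lt_le_trans/(_ H1); exact: Vl.
  - by move=> xi /(le_lt_trans H2); exact: Vr.
  - by exists a1, a2; exact: (fan_box hf hf' hf'' eps0 W1 W2).
case: (W1) (W2) => [R1|[ab1 S1]] [R2|[ab2 S2]].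
- have [ab1 _ [Va1 Vb1] la1 _] := R1; have [ab2 _ [Va2 Vb2] la2 _] := R2.
  have ml : m.2 <= l.2 by rewrite -Va1 -Vb1 (rarefaction1_mono hf hf' hf'' eps0 R1).
  have ul : l.1 <= m.1 by rewrite -Va1 -Vb1 (rarefaction1_mono_fst hf hf' hf'' eps0 R1).
  have ur : m.1 <= r.1 by rewrite -Va2 -Vb2 (rarefaction2_mono_fst hf hf' hf'' eps0 R2).
  have rm := small _ (ltW m0) (le_trans ml lM).
  have gr := growth _ _ _ _ _ R1 m0.
  have := la1 a1; rewrite lexx ab1 Va1 /lambda1 -radE => /(_ isT) Ea1.
  have := la1 b1; rewrite lexx ab1 Vb1 /lambda1 -radE => /(_ isT) Eb1.
  have := la2 a2; rewrite lexx ab2 Va2 /lambda2 -radE => /(_ isT) Ea2.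
  have := la2 b2; rewrite lexx ab2 Vb2 /lambda2 -radE => /(_ isT) Eb2.
  split; [scalar_lra|scalar_lra| |by split; apply/andP; split; scalar_lra].
  move=> xi /andP[h1 h2].
  (* By [gr], [a2] exceeds [l.1] by at most [eta], and [rr0] gives [r.1 < b2]. *)
  have xiab : a2 <= xi <= b2 by apply/andP; split; scalar_lra.
  have [axi xib] := andP xiab.
  have p1 : 0 < (V xi).2.
    by rewrite (lt_le_trans m0)// -Va2 (rarefaction2_mono hf hf' hf'' eps0 R2).
  have p2 : (V xi).2 <= r.2.
    by rewrite -Vb2 (rarefaction2_mono hf hf' hf'' eps0 R2).
  have r1 := small _ (ltW p1) (le_trans p2 rM).
  have r2 := radgt _ p1.
  have := la2 _ xiab; rewrite /lambda2 -radE => E.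
  split; first exact: dist_half_difference E r2 r1 eps0.
  rewrite ltW//= (le_trans (decay2 _ _ _ _ _ R2 r0' _ xiab))//.
  (* As [(V xi).1 <= xi + eps / 2] and [xi < r.1 - 3 * eta], the numerator of the exponent is at
     most [- eta]. *)
  by apply: decay => //; scalar_lra.
- have [ab1 _ [Va1 Vb1] la1 _] := R1.
  have ml : m.2 <= l.2 by rewrite -Va1 -Vb1 (rarefaction1_mono hf hf' hf'' eps0 R1).
  have ul : l.1 <= m.1 by rewrite -Va1 -Vb1 (rarefaction1_mono_fst hf hf' hf'' eps0 R1).
  have rm := small _ (ltW m0) (le_trans ml lM).
  have gr := growth _ _ _ _ _ R1 m0.
  have [P0 D0 _ _] := shock2P hf hf' hf'' eps0 m0 r0' S2.
  have [_ L1 /andP[L2 L3]] := S2; rewrite /lambda1 /lambda2 -radE in L1 L2 L3.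
  have := la1 a1; rewrite lexx ab1 Va1 /lambda1 -radE => /(_ isT) Ea1.
  split; [scalar_lra|rewrite -ab2; scalar_lra| |by split; apply/andP; split; scalar_lra].
  by move=> xi /andP[h1 h2]; exfalso; scalar_lra.
- have [ab2 _ [Va2 Vb2] la2 _] := R2.
  have mr : m.2 <= r.2 by rewrite -Va2 -Vb2 (rarefaction2_mono hf hf' hf'' eps0 R2).
  have ur : m.1 <= r.1 by rewrite -Va2 -Vb2 (rarefaction2_mono_fst hf hf' hf'' eps0 R2).
  have rm := small _ (ltW m0) (le_trans mr rM).
  have [P0 D0 _ _] := shock1P hf hf' hf'' eps0 l0' m0 S1.
  have D1 := drop1 _ _ _ m0 l0 (le_trans mr rM) S1.
  have [_ L1 /andP[L2 L3]] := S1; rewrite /lambda1 /lambda2 -radE in L1 L2 L3.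
  have := la2 b2; rewrite lexx ab2 Vb2 /lambda2 -radE => /(_ isT) Eb2.
  (* A rise of [2 * eta] in the 2-rarefaction would force [m.2 <= eta <= mu <= l.2], but a 1-shock
     raises the density. *)
  have G : r.1 - m.1 < 2 * eta.
    rewrite ltNge; apply/negP => h.
    have := decay2 _ _ _ _ _ R2 r0' a2.
    rewrite lexx ab2 => /(_ isT); rewrite Va2 => h2.
    have : m.2 <= eta by apply: (le_trans h2); apply: decay => //; scalar_lra.
    by scalar_lra.
  split; [scalar_lra|scalar_lra| |by split; apply/andP; split; scalar_lra].
  by move=> xi /andP[h1 h2]; exfalso; scalar_lra.
- have [_ D1 _ _] := shock1P hf hf' hf'' eps0 l0' m0 S1.
  by have [_ D2 _ _] := shock2P hf hf' hf'' eps0 m0 r0' S2; exfalso; scalar_lra.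
Qed.

(* When [u] drops by more than the small parameter allows to an intermediate density
   below [M], both waves are shocks and the intermediate density exceeds [M]. *)
Lemma fan_decreasing (R : realType) (f : R -> R) (hf : C2_pos f)
    (hf' : forall r : R, 0 < r -> 0 < derive1 f r)
    (hf'' : forall r : R, 0 < r -> 0 < derive1 (derive1 f) r)
    (eps M mu eta : R) (l r : R * R) (V : R -> R * R) :
  0 < eps -> 0 < mu -> mu <= M -> eta <= 1 -> eps <= eta ->
  eps * (4 * M * derive1 f M + 1) <= eta ^+ 2 ->
  2 * eps * (f M - f mu) <= eta ^+ 2 -> eps * M <= eta ^+ 2 ->
  4 * eta < l.1 - r.1 ->
  mu <= l.2 -> l.2 <= M -> mu <= r.2 -> r.2 <= M ->
  two_wave_fan f eps l r V ->
  exists s1 s2 m, [/\ [/\ s1 < s2, M < m.2, shock1 f eps s1 l m & shock2 f eps s2 m r],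
    forall xi, xi < s1 -> V xi = l,
    forall xi, s1 < xi < s2 -> V xi = m &
    forall xi, s2 < xi -> V xi = r].
Proof.
move=> eps0 mu0 muM eta1 epseta s1 s2 s3 lr l0 lM r0 rM.
have eta0 := lt_le_trans eps0 epseta.
have small := radical_small hf hf' hf'' eps0 mu0 muM eta1 epseta s1.
have radgt := radical_gt hf' eps0.
have drop1 := shock1_small hf hf' hf'' eps0 mu0 epseta s2.
have drop2 := shock2_small hf hf' hf'' eps0 mu0 epseta s2.
have decay := decay_small eps0 epseta s3.
have growth := rarefaction1_growth hf hf' hf'' eps0.
have decay2 := rarefaction2_decay hf hf' hf'' eps0.
clear s1 s2 s3; have [rad radE] : exists rad, rad = radical f eps by eexists.
rewrite -radE in small radgt growth decay2.
have l0' := lt_le_trans mu0 l0; have r0' := lt_le_trans mu0 r0.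
have rl := small _ (ltW l0') lM; have rr := small _ (ltW r0') rM.
have rl0 := radgt _ l0'; have rr0 := radgt _ r0'.
move=> [a1 [b1 [a2 [b2 [m [[m0 ba] [W1 W2] Vl Vm Vr]]]]]].
(* Below density [M] the first shock lowers the velocity by at most [eta] and the second one by less
   than [3 * eta], whence the threshold [4 * eta]. Next to a rarefaction the intermediate density is
   automatically below [M]. *)
case: W1 W2 => [R1|[ab1 S1]] [R2|[ab2 S2]].
- have [ab1 _ [Va1 Vb1] la1 _] := R1; have [ab2 _ [Va2 Vb2] la2 _] := R2.
  have ul : l.1 <= m.1 by rewrite -Va1 -Vb1 (rarefaction1_mono_fst hf hf' hf'' eps0 R1).
  have ur : m.1 <= r.1 by rewrite -Va2 -Vb2 (rarefaction2_mono_fst hf hf' hf'' eps0 R2).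
  by exfalso; scalar_lra.
- have [ab1 _ [Va1 Vb1] la1 _] := R1.
  have ml : m.2 <= l.2 by rewrite -Va1 -Vb1 (rarefaction1_mono hf hf' hf'' eps0 R1).
  have ul : l.1 <= m.1 by rewrite -Va1 -Vb1 (rarefaction1_mono_fst hf hf' hf'' eps0 R1).
  have h := drop2 _ _ _ m0 r0 (le_trans ml lM) S2.
  by exfalso; scalar_lra.
- have [ab2 _ [Va2 Vb2] la2 _] := R2.
  have mr : m.2 <= r.2 by rewrite -Va2 -Vb2 (rarefaction2_mono hf hf' hf'' eps0 R2).
  have ur : m.1 <= r.1 by rewrite -Va2 -Vb2 (rarefaction2_mono_fst hf hf' hf'' eps0 R2).
  have h := drop1 _ _ _ m0 l0 (le_trans mr rM) S1.
  by exfalso; scalar_lra.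
- exists a1, a2, m; rewrite -ab1 in ba Vm; rewrite -ab2 in Vr.
  split => //; split => //; rewrite ltNge; apply/negP => mM.
  have h1 := drop1 _ _ _ m0 l0 mM S1; have h2 := drop2 _ _ _ m0 r0 mM S2.
  by scalar_lra.
Qed.

Lemma small_near (R : realType) (C eta : R) : 0 < eta ->
  \forall eps \near (0 : R)^'+, [/\ 0 < eps, eps <= eta & eps * C <= eta ^+ 2].
Proof.
move=> eta0; near=> eps.
have eps0 : 0 < eps by near: eps; exact: nbhs_right_gt.
have C0 : 0 < `|C| + 1 by rewrite ltr_pwDr.
split => //; first by near: eps; exact: nbhs_right_le.
apply: (@le_trans _ _ (eps * (`|C| + 1))).
  by rewrite ler_pM2l// (le_trans (ler_norm _))// lerDl.
rewrite -ler_pdivlMr//; near: eps; apply: nbhs_right_le.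
by rewrite divr_gt0// exprn_gt0.
Unshelve. all: by end_near. Qed.

(** The mass condition says that the speed differs from [u - e] by [r * D / P], which is small once
    the density jump [P] is large compared with the velocity drop. *)
Lemma shock_speed_lower (R : realType) (s e u P r D M d eta : R) :
  0 < P -> 0 < r -> 0 < D -> r <= M -> D <= d -> M * d <= eta * P ->
  (s + e - u) * P = - r * D -> u - e - eta <= s <= u - e.
Proof.
move=> P0 r0 D0 rM Dd h E.
have rD : r * D <= M * d by apply: ler_pM => //; exact: ltW.
have rD0 : 0 < r * D by rewrite mulr_gt0.
have h1 : - eta <= s + e - u by rewrite -(ler_pM2r P0) E; lra.
have h2 : s + e - u <= 0 by rewrite -(ler_pM2r P0) E; lra.
by apply/andP; split; lra.
Qed.

Lemma shock_speed_upper (R : realType) (s e u P r D M d eta : R) :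
  0 < P -> 0 < r -> 0 < D -> r <= M -> D <= d -> M * d <= eta * P ->
  (s + e - u) * P = r * D -> u - e <= s <= u - e + eta.
Proof.
move=> P0 r0 D0 rM Dd h E.
have rD : r * D <= M * d by apply: ler_pM => //; exact: ltW.
have rD0 : 0 < r * D by rewrite mulr_gt0.
have h1 : s + e - u <= eta by rewrite -(ler_pM2r P0) E; lra.
have h2 : 0 <= s + e - u by rewrite -(ler_pM2r P0) E; lra.
by apply/andP; split; lra.
Qed.

(* Adding the two momentum conditions eliminates the intermediate state up to the
   distances of the shock speeds to [um]. *)
Lemma intermediate_velocity (R : realType) (ul um ur s1 s2 k eta : R) :
  um <= ul -> ur <= um -> eta <= ul - ur -> ur < ul ->
  um - 2 * eta <= s1 <= um + 2 * eta -> um - 2 * eta <= s2 <= um + 2 * eta ->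
  `|k| <= eta ^+ 2 ->
  (um - ul) * s1 + (ur - um) * s2 = (ur ^+ 2 - ul ^+ 2) / 2 + k ->
  `|um - (ul + ur) / 2| <= 3 * eta.
Proof.
move=> uml urm etad lr /andP[h1 h2] /andP[h3 h4] /ler_normlP[k1 k2] E.
have d0 : 0 < ul - ur by rewrite subr_gt0.
have eta0 : 0 <= eta by lra.
have E' : (ul - ur) * (um - (ul + ur) / 2) =
    - ((ul - um) * (s1 - um)) - (um - ur) * (s2 - um) - k.
  by move: E; rewrite !expr2; lra.
have a1 : (ul - um) * (s1 - um) <= (ul - um) * (2 * eta).
  by apply: ler_wpM2l; lra.
have a2 : (ul - um) * (- (2 * eta)) <= (ul - um) * (s1 - um).
  by apply: ler_wpM2l; lra.
have a3 : (um - ur) * (s2 - um) <= (um - ur) * (2 * eta).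
  by apply: ler_wpM2l; lra.
have a4 : (um - ur) * (- (2 * eta)) <= (um - ur) * (s2 - um).
  by apply: ler_wpM2l; lra.
have a5 : eta ^+ 2 <= (ul - ur) * eta by rewrite expr2 ler_wpM2r.
rewrite ler_norml; apply/andP; split; rewrite -(ler_pM2l d0) E'.
  by lra.
by lra.
Qed.

Lemma delta_shock_bounds (R : realType)
    (ul um ur rl rm rr fl fm fr s1 s2 eps eta M : R) :
  0 < eps -> eps <= eta -> 0 < rl -> 0 < rr -> rl <= M -> rr <= M ->
  0 < rm - rl -> 0 < rm - rr -> 0 < ul - um -> 0 < um - ur ->
  5 * eta <= ul - ur ->
  M * (ul - ur) <= eta * (rm - rl) -> M * (ul - ur) <= eta * (rm - rr) ->
  (s1 + eps - um) * (rm - rl) = - rl * (ul - um) ->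
  (s2 + eps - um) * (rm - rr) = rr * (um - ur) ->
  (um - ul) * s1 = (um ^+ 2 - ul ^+ 2) / 2 + eps * (fm - fl) ->
  (rm - rl) * s1 = (rm * um - rl * ul) - eps * (rm - rl) ->
  (ur - um) * s2 = (ur ^+ 2 - um ^+ 2) / 2 + eps * (fr - fm) ->
  (rr - rm) * s2 = (rr * ur - rm * um) - eps * (rr - rm) ->
  `|eps * (fr - fl)| <= eta ^+ 2 ->
  [/\ `|s1 - (ul + ur) / 2| <= 5 * eta, `|s2 - (ul + ur) / 2| <= 5 * eta &
      `|rm * (s2 - s1) - (ul - ur) / 2 * (rl + rr)| <= 11 * (eta * M)].
Proof.
move=> e0 ee rl0 rr0 rlM rrM P1 P2 D1 D2 etad M1 M2 E1 E2 A1 B1 A2 B2 k.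
have /andP[a1 a2] : um - eps - eta <= s1 <= um - eps.
  by apply: shock_speed_lower P1 rl0 D1 rlM _ M1 E1; lra.
have /andP[b1 b2] : um - eps <= s2 <= um - eps + eta.
  by apply: shock_speed_upper P2 rr0 D2 rrM _ M2 E2; lra.
have /ler_normlP[c1 c2] : `|um - (ul + ur) / 2| <= 3 * eta.
  apply: (@intermediate_velocity R ul um ur s1 s2 _ eta _ _ _ _ _ _ k).
  1-4: by clear -e0 ee D1 D2 etad; lra.
  1-2: by clear -e0 ee a1 a2 b1 b2; apply/andP; split; lra.
  by clear -A1 A2; lra.
have h1 : `|s1 - (ul + ur) / 2| <= 5 * eta.
  by clear -e0 ee a1 a2 c1 c2; rewrite ler_norml; apply/andP; split; lra.
have h2 : `|s2 - (ul + ur) / 2| <= 5 * eta.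
  by clear -e0 ee b1 b2 c1 c2; rewrite ler_norml; apply/andP; split; lra.
split => //.
(* In the sum of the two mass conditions the flux [rm * um] cancels, so the large density survives
   only in [rm * (s2 - s1)]. The constant [11] is [5 + 5 + 1], from [g1], [g2] and [g3]. *)
have -> : rm * (s2 - s1) - (ul - ur) / 2 * (rl + rr) =
   rr * (s2 - (ul + ur) / 2) - rl * (s1 - (ul + ur) / 2) + eps * (rr - rl).
  by clear -B1 B2; lra.
have g1 : `|rr * (s2 - (ul + ur) / 2)| <= M * (5 * eta).
  by rewrite normrM (gtr0_norm rr0) ler_pM// ltW.
have g2 : `|rl * (s1 - (ul + ur) / 2)| <= M * (5 * eta).
  by rewrite normrM (gtr0_norm rl0) ler_pM// ltW.
have g3 : `|eps * (rr - rl)| <= eta * M.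
  rewrite normrM (gtr0_norm e0) ler_pM// ?(ltW e0)// ler_norml.
  by clear -rl0 rr0 rlM rrM; apply/andP; split; lra.
apply: le_trans (ler_normD _ _) _; apply: le_trans (lerD (ler_normB _ _) g3) _.
by clear -g1 g2; lra.
Qed.

Section asymptotics.
Context {R : realType}.
Variable f : R -> R.
Hypothesis hf : C2_pos f.
Hypothesis hf' : forall r : R, 0 < r -> 0 < derive1 f r.
Hypothesis hf'' : forall r : R, 0 < r -> 0 < derive1 (derive1 f) r.
Variables l r : R * R.
Hypothesis l0 : 0 < l.2.
Hypothesis r0 : 0 < r.2.

Lemma fan_near_nondecreasing (delta : R) : 0 < delta -> l.1 <= r.1 ->
  \forall eps \near (0 : R)^'+, forall V,
  two_wave_fan f eps l r V \/ vacuum_fan f eps l r V ->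
  [/\ forall xi, xi < l.1 - delta -> V xi = l,
      forall xi, r.1 + delta < xi -> V xi = r,
      forall xi, l.1 + delta < xi < r.1 - delta ->
        `|(V xi).1 - xi| <= delta /\ 0 <= (V xi).2 <= delta &
      exists a b, forall xi, xi != a -> xi != b ->
        in_box (l.1 - 1) (r.1 + 1) 0 (Num.max l.2 r.2) (V xi)].
Proof.
move=> delta0 lr.
pose mu := Num.min l.2 r.2; pose M := Num.max l.2 r.2.
have mu0 : 0 < mu by rewrite lt_min l0 r0.
have mul : mu <= l.2 by rewrite ge_min lexx.
have mur : mu <= r.2 by rewrite ge_min lexx orbT.
have lM : l.2 <= M by rewrite le_max lexx.
have rM : r.2 <= M by rewrite le_max lexx orbT.
have muM := le_trans mul lM.
clearbody mu.
(* The margins of [fan_nondecreasing] are at most [3 * eta], and [eta <= mu] is its condition for a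
   1-shock followed by a 2-rarefaction. *)
pose eta := Num.min (Num.min 1 mu) (delta / 3).
have eta0 : 0 < eta.
  by rewrite lt_min divr_gt0// andbT lt_min ltr01.
have eta1 : eta <= 1 by rewrite !ge_min lexx.
have etamu : eta <= mu by rewrite !ge_min lexx orbT.
have etad : 3 * eta <= delta by rewrite mulrC -ler_pdivlMr// !ge_min lexx !orbT.
near=> eps => V fan.
have [eps0 epseta s1] : [/\ 0 < eps, eps <= eta &
  eps * (4 * M * derive1 f M + 1) <= eta ^+ 2] by near: eps; exact: small_near.
have [_ _ s2] : [/\ 0 < eps, eps <= eta &
  eps * (2 * (f M - f mu)) <= eta ^+ 2] by near: eps; exact: small_near.
have [_ _ s3] : [/\ 0 < eps, eps <= eta &
  eps * M <= eta ^+ 2] by near: eps; exact: small_near.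
have {}fan := two_wave_cases hf hf' hf'' eps0 mu0 mul mur fan.
have s2' : 2 * eps * (f M - f mu) <= eta ^+ 2 by rewrite mulrAC mulrC.
have [H1 H2 H3 H4] := fan_nondecreasing hf hf' hf'' eps0 mu0 muM eta1 epseta
  s1 s2' s3 lr mul lM mur rM etamu fan.
split => //.
- by move=> xi h; apply: H1; lra.
- by move=> xi h; apply: H2; lra.
- move=> xi /andP[h1 h2].
  have [|h3 /andP[h4 h5]] := H3 xi; first by apply/andP; split; lra.
  by rewrite (le_trans h3) ?h4 ?(le_trans h5)//; lra.
Unshelve. all: by end_near. Qed.

Lemma fan_near_decreasing (delta : R) : 0 < delta -> r.1 < l.1 ->
  let sigma := (l.1 + r.1) / 2 in
  \forall eps \near (0 : R)^'+, forall V,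
  two_wave_fan f eps l r V \/ vacuum_fan f eps l r V ->
  exists s1 s2 m, [/\
    [/\ forall xi, xi < s1 -> V xi = l,
        forall xi, s1 < xi < s2 -> V xi = m &
        forall xi, s2 < xi -> V xi = r],
    s1 < s2 /\ 0 < m.2, r.1 <= m.1 <= l.1,
    `|s1 - sigma| <= delta /\ `|s2 - sigma| <= delta &
    `|m.2 * (s2 - s1) - (l.1 - r.1) / 2 * (l.2 + r.2)| <= delta].
Proof.
move=> delta0 rl sigma.
pose mu := Num.min l.2 r.2; pose M := Num.max l.2 r.2.
have mu0 : 0 < mu by rewrite lt_min l0 r0.
have mul : mu <= l.2 by rewrite ge_min lexx.
have mur : mu <= r.2 by rewrite ge_min lexx orbT.
have lM : l.2 <= M by rewrite le_max lexx.
have rM : r.2 <= M by rewrite le_max lexx orbT.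
have M0 := lt_le_trans l0 lM.
have d0 : 0 < l.1 - r.1 by rewrite subr_gt0.
(* One division by [K] makes both errors of [delta_shock_bounds], [5 * eta] and [11 * (eta * M)], at
   most [delta]. *)
pose K := 5 + 11 * M.
have K0 : 0 < K by rewrite /K; lra.
pose eta := Num.min (Num.min 1 (l.1 - r.1)) delta / K.
have eta0 : 0 < eta by rewrite divr_gt0// !lt_min ltr01 d0.
have etaK : eta * K = Num.min (Num.min 1 (l.1 - r.1)) delta.
  by rewrite divfK ?gt_eqF.
have h1 : eta * K <= 1 by rewrite etaK !ge_min lexx.
have h2 : eta * K <= l.1 - r.1 by rewrite etaK !ge_min lexx orbT.
have h3 : eta * K <= delta by rewrite etaK !ge_min lexx !orbT.
have etaM : 0 < eta * M by rewrite mulr_gt0.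
have eta1 : eta <= 1 by rewrite /K in h1; lra.
have etad : 5 * eta <= l.1 - r.1 by rewrite /K in h2; lra.
have etade : 5 * eta <= delta by rewrite /K in h3; lra.
have etaMde : 11 * (eta * M) <= delta by rewrite /K in h3; lra.
(* The density that the intermediate state must exceed: [eta * (L - M) = M * (l.1 - r.1)] is what
   [delta_shock_bounds] asks of the density jumps. [fan_decreasing] is applied with [L] as its upper
   bound. *)
pose L := M + M * (l.1 - r.1) / eta.
have ML : M <= L by rewrite lerDl ltW// divr_gt0// mulr_gt0.
have muL := le_trans (le_trans mul lM) ML.
clear h1 h2 h3 etaK K0; clearbody eta.
near=> eps => V fan.
have [eps0 epseta s1] : [/\ 0 < eps, eps <= eta &
  eps * (4 * L * derive1 f L + 1) <= eta ^+ 2] by near: eps; exact: small_near.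
have [_ _ s2] : [/\ 0 < eps, eps <= eta &
  eps * (2 * (f L - f mu)) <= eta ^+ 2] by near: eps; exact: small_near.
have [_ _ s3] : [/\ 0 < eps, eps <= eta &
  eps * L <= eta ^+ 2] by near: eps; exact: small_near.
have {}fan := two_wave_cases hf hf' hf'' eps0 mu0 mul mur fan.
have s2' : 2 * eps * (f L - f mu) <= eta ^+ 2 by rewrite mulrAC mulrC.
have etad4 : 4 * eta < l.1 - r.1 by lra.
have [p [q [m [[pq Lm S1 S2] Vl Vm Vr]]]] := fan_decreasing hf hf' hf'' eps0 mu0
  muL eta1 epseta s1 s2' s3 etad4 mul (le_trans lM ML) mur (le_trans rM ML) fan.
have m0 : 0 < m.2 by rewrite (lt_trans _ Lm)// (lt_le_trans M0).
have [P1 D1 E1 _] := shock1P hf hf' hf'' eps0 l0 m0 S1.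
have [P2 D2 E2 _] := shock2P hf hf' hf'' eps0 m0 r0 S2.
have [[A1 B1] _ _] := S1; have [[A2 B2] _ _] := S2.
have kb : `|eps * (f r.2 - f l.2)| <= eta ^+ 2.
  have F1 := flux_le hf hf' hf'' mu0 mul.
  have F2 := flux_le hf hf' hf'' l0 (le_trans lM ML).
  have F3 := flux_le hf hf' hf'' mu0 mur.
  have F4 := flux_le hf hf' hf'' r0 (le_trans rM ML).
  rewrite normrM gtr0_norm// (le_trans _ s2)// ler_pM2l//.
  by rewrite ler_norml; clear -F1 F2 F3 F4; apply/andP; split; lra.
have LE : eta * (L - M) = M * (l.1 - r.1).
  by rewrite /L addrAC subrr add0r mulrC divfK// gt_eqF.
have b1 : M * (l.1 - r.1) <= eta * (m.2 - l.2) by rewrite -LE ler_pM2l//; lra.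
have b2 : M * (l.1 - r.1) <= eta * (m.2 - r.2) by rewrite -LE ler_pM2l//; lra.
have [c1 c2 c3] := delta_shock_bounds eps0 epseta l0 r0 lM rM P1 P2 D1 D2 etad b1 b2
  E1 E2 A1 B1 A2 B2 kb.
exists p, q, m; split => //.
- by apply/andP; split; rewrite -subr_ge0 ltW.
- by split; [exact: le_trans c1 etade|exact: le_trans c2 etade].
- exact: le_trans c3 etaMde.
Unshelve. all: by end_near. Qed.

End asymptotics.

(** * Existence of fans *)

Lemma continuous_of_derive (R : realType) (g : R -> R) (x d : R) :
  is_derive x 1 g d -> {for x, continuous g}.
Proof. by case=> D _; exact/differentiable_continuous/derivable1_diffP. Qed.

Lemma within_continuous_pair (T U W : topologicalType) (A : set T)
    (g : T -> U) (h : T -> W) :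
  {within A, continuous g} -> {within A, continuous h} ->
  {within A, continuous (fun x => (g x, h x))}.
Proof.
move=> /subspace_continuousP cg /subspace_continuousP ch.
apply/subspace_continuousP => x Ax; exact: (cvg_pair (cg x Ax) (ch x Ax)).
Qed.

(** Freezing [g] to the left of [s0] gives an integrand continuous on the whole line, whatever [g]
    does near [a]; the lower limit [s0 - 1] keeps each [s > s0] in the interior of the interval. *)
Lemma primitive_right (R : realType) (g : R -> R) (a s0 : R) : a < s0 ->
  (forall s, a < s -> {for s, continuous g}) ->
  exists F : R -> R, forall s, s0 < s -> is_derive s 1 F (g s).
Proof.
move=> as0 cg; pose h (x : R) := g (Num.max x s0).
have hc : continuous h.
  move=> x; have m1 : {for x, continuous (fun y : R => Num.max y s0)}.
    by apply: (@continuous_max R R id (cst s0)); [exact: cvg_id|exact: cvg_cst].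
  apply: (@continuous_comp _ _ _ (fun y : R => Num.max y s0) g x m1).
  by apply: cg; rewrite lt_max as0 orbT.
exists (fun x => \int[lebesgue_measure]_(t in `[s0 - 1, x]) h t)%R => s s0s.
have [||||D E] := @continuous_FTC1_closed R h (s0 - 1) s (s + 1).
- by rewrite ltrDl.
- apply: continuous_compact_integrable; first exact: segment_compact.
  exact: continuous_subspaceT.
- by rewrite ltrBlDr (lt_trans s0s)// ltrDl.
- exact: hc.
apply: DeriveDef => //; rewrite -derive1E E /h max_l//; exact: ltW.
Qed.

(** Injectivity is Rolle's theorem and preimages come from the intermediate value theorem. Only
    [dL s != 0] is assumed, and the range is given by [Num.min] and [Num.max], to serve both
    families: as functions of the density along their curves, [lambda1] decreases and [lambda2]
    increases. *)
Lemma inverse_of_derive (R : realType) (L dL : R -> R) (s0 : R) :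
  (forall s, s0 < s -> is_derive s 1 L (dL s)) ->
  (forall s, s0 < s -> dL s != 0) ->
  exists g : R -> R, [/\ forall s, s0 < s -> g (L s) = s,
    forall s, s0 < s -> is_derive (L s) 1 g (dL s)^-1 &
    forall a b xi, s0 < a -> a <= b -> Num.min (L a) (L b) <= xi <= Num.max (L a) (L b) ->
      exists2 s, a <= s <= b & L s = xi].
Proof.
move=> DL dL0.
have cL a b : s0 < a -> {within `[a, b], continuous L}.
  move=> sa; apply: derivable_within_continuous => x.
  by rewrite in_itv /= => /andP[ax _]; case: (DL x (lt_le_trans sa ax)).
have inj x y : s0 < x -> x < y -> L x <> L y.
  move=> sx xy E; have [|c + [_ D0]] := @Rolle R L x y xy _ (cL x y sx) E.
    move=> z; rewrite in_itv /= => /andP[xz _].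
    by case: (DL z (lt_trans sx xz)).
  rewrite in_itv /= => /andP[xc _]; have sc := lt_trans sx xc.
  by have [_ D1] := DL c sc; move: (dL0 c sc); rewrite -D1 D0 eqxx.
have inj' x y : s0 < x -> s0 < y -> L x = L y -> x = y.
  move=> sx sy E; case: (ltgtP x y) => // h; exfalso.
    exact: inj sx h E.
  exact: inj sy h (esym E).
exists (fun xi => xget s0 [set s | s0 < s /\ L s = xi]).
set g := fun xi => _.
have gK s : s0 < s -> g (L s) = s.
  move=> s0s; rewrite /g; case: xgetP => [y _ [sy Ey]|/(_ s)[]//].
  exact: inj'.
split => //.
- move=> s s0s; apply: is_derive_inverse; last exact: dL0.
  + by near=> y; apply: gK; near: y; exact: lt_nbhsr.
  + near=> y; apply: (@continuous_of_derive R L y (dL y)); apply: DL.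
    by near: y; exact: lt_nbhsr.
  + exact: DL.
- move=> a b xi sa ab h.
  have [s sab Es] := IVT ab (cL a b sa) h.
  by exists s => //; move: sab; rewrite in_itv.
Unshelve. all: by end_near. Qed.

Lemma rarefaction_ext (R : realType) (lam : R * R -> R) (X : R * R -> R * R)
    (a b : R) (V W : R -> R * R) (l r : R * R) :
  (forall xi, a <= xi <= b -> V xi = W xi) ->
  rarefaction lam X a b V l r -> rarefaction lam X a b W l r.
Proof.
move=> VW [ab cV [Va Vb] lV dV]; split => //.
- apply: subspace_eq_continuous cV => x; rewrite inE /= in_itv /=.
  exact: VW.
- by rewrite -!VW ?lexx ?ab.
- by move=> xi xiab; rewrite -VW// lV.
- move=> xi xiab; have [axi xib] := andP xiab.
  have xiab' : a <= xi <= b by rewrite !ltW.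
  have [r0 [c [D1 D2]]] := dV _ xiab; rewrite -VW//; split => //.
  have N : \forall y \near xi, V y = W y.
    by near=> y; apply: VW; apply/andP; split; apply/ltW; near: y;
      [exact: lt_nbhsr|exact: lt_nbhsl].
  exists c; split.
    by apply: near_eq_is_derive D1; near=> y => /=; congr fst; near: y.
  by apply: near_eq_is_derive D2; near=> y => /=; congr snd; near: y.
Unshelve. all: by end_near. Qed.

(* A curve [s |-> (u s, s)] tangent to [X] along which [lam] is monotone is, once
   parametrized by [lam], a rarefaction wave. *)
Lemma rarefaction_of_curve (R : realType) (lam : R * R -> R) (X : R * R -> R * R)
    (u dL : R -> R) (s0 : R) :
  0 < s0 -> (forall v, (X v).2 = 1) ->
  (forall s, s0 < s -> is_derive s 1 u (X (u s, s)).1) ->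
  (forall s, s0 < s -> is_derive s 1 (fun s => lam (u s, s)) (dL s)) ->
  (forall s, s0 < s -> dL s != 0) ->
  exists V, forall p q, s0 < p -> s0 < q ->
    lam (u p, p) <= lam (u q, q) ->
    rarefaction lam X (lam (u p, p)) (lam (u q, q)) V (u p, p) (u q, q).
Proof.
move=> s00 X2 Du DL dL0; have [g [gK Dg Lg]] := inverse_of_derive DL dL0.
exists (fun xi => (u (g xi), g xi)) => p q sp sq pq.
have pre xi : lam (u p, p) <= xi <= lam (u q, q) ->
    exists2 s, s0 < s & lam (u s, s) = xi.
  move=> /andP[h1 h2]; have [pq'|/ltW qp'] := leP p q.
    have [|s /andP[ps _] E] := Lg p q xi sp pq'; last first.
      by exists s => //; exact: lt_le_trans ps.
    by rewrite ge_min h1 le_max h2 orbT.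
  have [|s /andP[ps _] E] := Lg q p xi sq qp'; last first.
    by exists s => //; exact: lt_le_trans ps.
  by rewrite ge_min h1 le_max h2 orbT.
have Dug s : s0 < s -> is_derive (lam (u s, s)) 1 (u \o g)
    ((X (u s, s)).1 * (dL s)^-1).
  move=> ss; apply: (@is_derive1_comp R u g); last exact: Dg.
  by rewrite gK//; exact: Du.
split => //.
- have c1 : {within `[lam (u p, p), lam (u q, q)], continuous (u \o g)}.
    apply: derivable_within_continuous => x; rewrite in_itv /= => /pre[s ss <-].
    by case: (Dug s ss).
  have c2 : {within `[lam (u p, p), lam (u q, q)], continuous g}.
    apply: derivable_within_continuous => x; rewrite in_itv /= => /pre[s ss <-].
    by case: (Dg s ss).
  exact: within_continuous_pair c1 c2.
- by rewrite !gK.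
- by move=> xi /pre[s ss <-]; rewrite gK.
- move=> xi /andP[/ltW h1 /ltW h2]; have [|s ss <-] := pre xi; first by rewrite h1.
  rewrite gK//=; split; first exact: lt_trans ss.
  exists (dL s)^-1; rewrite X2 mulr1 mulrC; split; [exact: Dug|exact: Dg].
Qed.

Section fan_existence.
Context {R : realType}.
Variable f : R -> R.
Hypothesis hf : C2_pos f.
Hypothesis hf' : forall r : R, 0 < r -> 0 < derive1 f r.
Hypothesis hf'' : forall r : R, 0 < r -> 0 < derive1 (derive1 f) r.
Variable eps : R.
Hypothesis eps0 : 0 < eps.
Local Notation rad := (radical f eps).

Lemma lt_radical (x rho : R) : 0 <= rho -> x ^+ 2 < rad rho ^+ 2 -> x < rad rho.
Proof.
move=> rho0 h; have [x0|x0] := lt_or_le x 0.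
  by rewrite (lt_le_trans x0)// sqrtr_ge0.
by move: h; rewrite ltr_pXn2r ?nnegrE ?sqrtr_ge0.
Qed.

Lemma radical_lt_of_sqr (x rho : R) : 0 <= x -> rad rho ^+ 2 < x ^+ 2 -> rad rho < x.
Proof. by move=> x0; rewrite ltr_pXn2r ?nnegrE ?sqrtr_ge0. Qed.

(** Converse of [shock1P]. With [y] the drop per unit of density, the mass condition gives
    [s = u - eps - rl * y], and the quadratic relation is then the momentum condition. *)
Lemma shock1_exists (u rl rm D : R) : 0 < rl -> rl < rm -> 0 < D ->
  D ^+ 2 * (rm + rl) + 2 * eps * D * (rm - rl) = 2 * eps * (f rm - f rl) * (rm - rl) ->
  exists2 s, s < u - eps & shock1 f eps s (u + D, rl) (u, rm).
Proof.
move=> rl0 rlm D0 E; have e0 := eps0; have rm0 := lt_trans rl0 rlm.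
have P0 : 0 < rm - rl by rewrite subr_gt0.
have [y y0 Dy] : exists2 y, 0 < y & D = y * (rm - rl).
  by exists (D / (rm - rl)); rewrite ?divr_gt0// divfK// gt_eqF.
rewrite {D D0}Dy in E *.
have Q : (y ^+ 2 * (rm + rl) + 2 * eps * y) * (rm - rl) = 2 * eps * (f rm - f rl).
  by apply: (mulIf (lt0r_neq0 P0)); rewrite -E; ring.
have /andP[c1 c2] := chord_slope hf hf'' rl0 rlm.
have q1 : 2 * eps * derive1 f rl < y ^+ 2 * (rm + rl) + 2 * eps * y.
  by rewrite -(ltr_pM2r P0) Q -[ltLHS]mulrA ltr_pM2l ?mulr_gt0.
have q2 : y ^+ 2 * (rm + rl) + 2 * eps * y < 2 * eps * derive1 f rm.
  by rewrite -(ltr_pM2r P0) Q -[ltRHS]mulrA ltr_pM2l ?mulr_gt0.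
have yP : 0 < y ^+ 2 * (rm - rl) by rewrite mulr_gt0// exprn_gt0.
have y2 : 0 < y ^+ 2 by rewrite exprn_gt0.
have f1 := hf' rl0; have f2 := hf' rm0.
have ylr : 0 < rl * y by rewrite mulr_gt0.
(* This is [s < lambda1 l], and [L2] is [lambda1 r < s]. After squaring they follow from the chord
   bounds [q1] and [q2], with [rm + rl] replaced by [2 * rm] and [2 * rl]. *)
have L1 : rad rl < 2 * rm * y + eps.
  apply: radical_lt_of_sqr; first by rewrite ltW// addr_gt0// !mulr_gt0.
  rewrite sqr_radical// ?ltW//.
  have : rl * (2 * eps * derive1 f rl) < rm * (2 * rm * y ^+ 2 + 2 * eps * y).
    by apply: ltr_pM => //; rewrite ?mulr_ge0 ?(ltW rl0) ?(ltW e0) ?(ltW f1)//; lra.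
  by rewrite !expr2; lra.
have L2 : 2 * rl * y + eps < rad rm.
  apply: lt_radical; rewrite ?(ltW rm0)// sqr_radical// ?(ltW rm0)//.
  have : rl * (2 * rl * y ^+ 2 + 2 * eps * y) < rm * (2 * eps * derive1 f rm).
    have z0 : 0 <= 2 * rl * y ^+ 2 + 2 * eps * y.
      by rewrite addr_ge0// ?mulr_ge0 ?(ltW rl0) ?(ltW y2) ?(ltW e0) ?(ltW y0).
    by apply: ltr_pM; rewrite ?(ltW rl0) ?z0//; lra.
  by rewrite !expr2; lra.
have gm := radical_gt hf' eps0 rm0.
exists (u - eps - rl * y); first by lra.
split; last 2 first.
- by rewrite /lambda1 /=; lra.
- by rewrite /lambda1 /lambda2 /=; apply/andP; split; lra.
rewrite /rankine_hugoniot /=; split; last by ring.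
by move: Q; rewrite !expr2; lra.
Qed.

Lemma shock2_exists (u rr rm D : R) : 0 < rr -> rr < rm -> 0 < D ->
  D ^+ 2 * (rm + rr) - 2 * eps * D * (rm - rr) = 2 * eps * (f rm - f rr) * (rm - rr) ->
  exists2 s, u - eps < s & shock2 f eps s (u, rm) (u - D, rr).
Proof.
move=> rl0 rlm D0 E; have e0 := eps0; have rm0 := lt_trans rl0 rlm.
have P0 : 0 < rm - rr by rewrite subr_gt0.
have [y y0 Dy] : exists2 y, 0 < y & D = y * (rm - rr).
  by exists (D / (rm - rr)); rewrite ?divr_gt0// divfK// gt_eqF.
rewrite {D D0}Dy in E *.
have Q : (y ^+ 2 * (rm + rr) - 2 * eps * y) * (rm - rr) = 2 * eps * (f rm - f rr).
  by apply: (mulIf (lt0r_neq0 P0)); rewrite -E; ring.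
have /andP[c1 c2] := chord_slope hf hf'' rl0 rlm.
have q1 : 2 * eps * derive1 f rr < y ^+ 2 * (rm + rr) - 2 * eps * y.
  by rewrite -(ltr_pM2r P0) Q -[ltLHS]mulrA ltr_pM2l ?mulr_gt0.
have q2 : y ^+ 2 * (rm + rr) - 2 * eps * y < 2 * eps * derive1 f rm.
  by rewrite -(ltr_pM2r P0) Q -[ltRHS]mulrA ltr_pM2l ?mulr_gt0.
have yP : 0 < y ^+ 2 * (rm - rr) by rewrite mulr_gt0// exprn_gt0.
have f1 := hf' rl0; have f2 := hf' rm0.
have ylr : 0 < rr * y by rewrite mulr_gt0.
have ef : 0 < 2 * eps * derive1 f rr by rewrite !mulr_gt0.
(* Makes [2 * rm * y - eps] nonnegative, as the squaring in [L1] requires; in the first family the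
   sign of [eps] gave this for free. *)
have ye : eps < rm * y.
  have : 0 < y * (y * (2 * rm) - 2 * eps) by move: q1 ef yP; rewrite !expr2; lra.
  by rewrite pmulr_rgt0//; lra.
have L1 : rad rr < 2 * rm * y - eps.
  apply: radical_lt_of_sqr; first by lra.
  rewrite sqr_radical// ?ltW//.
  have : rr * (2 * eps * derive1 f rr) < rm * (2 * rm * y ^+ 2 - 2 * eps * y).
    by apply: ltr_pM => //; rewrite ?(ltW rl0) ?(ltW ef)//; lra.
  by rewrite !expr2; lra.
have L2 : 2 * rr * y - eps < rad rm.
  apply: lt_radical; rewrite ?(ltW rm0)// sqr_radical// ?(ltW rm0)//.
  have h1 : rr * (2 * rr * y ^+ 2 - 2 * eps * y) < rr * (2 * eps * derive1 f rm).
    by rewrite ltr_pM2l//; lra.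
  have h2 : rr * (2 * eps * derive1 f rm) < rm * (2 * eps * derive1 f rm).
    by rewrite ltr_pM2r// !mulr_gt0.
  by move: h1 h2; rewrite !expr2; lra.
have gm := radical_gt hf' eps0 rm0.
exists (u - eps + rr * y); first by lra.
split; last 2 first.
- by rewrite /lambda2 /=; lra.
- by rewrite /lambda1 /lambda2 /=; apply/andP; split; lra.
rewrite /rankine_hugoniot /=; split; last by ring.
by move: Q; rewrite !expr2; lra.
Qed.

End fan_existence.

(** The positive root of [s * x ^+ 2 - 2 * k * x = q], in closed form so that it depends
    continuously on the coefficients. *)
Definition quadratic_root (R : realType) (k s q : R) : R :=
  (k + Num.sqrt (k ^+ 2 + s * q)) / s.

Lemma quadratic_rootP (R : realType) (k s q : R) : 0 < s -> 0 < q ->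
  0 < quadratic_root k s q /\
  quadratic_root k s q ^+ 2 * s - 2 * k * quadratic_root k s q = q.
Proof.
move=> s0 q0; have sq : 0 < s * q by rewrite mulr_gt0.
have k2 := sqr_ge0 k.
have rk : `|k| < Num.sqrt (k ^+ 2 + s * q).
  by rewrite -sqrtr_sqr ltr_sqrt; [rewrite ltrDl|rewrite ltr_wpDl].
have rE : Num.sqrt (k ^+ 2 + s * q) ^+ 2 = k ^+ 2 + s * q.
  by rewrite sqr_sqrtr// addr_ge0// ltW.
split.
  by rewrite divr_gt0// -ltrBlDl sub0r (le_lt_trans _ rk)// -normrN ler_norm.
rewrite /quadratic_root; move: rE; set t := Num.sqrt _ => rE.
apply: (mulIf (lt0r_neq0 s0)).
have -> : (((k + t) / s) ^+ 2 * s - 2 * k * ((k + t) / s)) * s = t ^+ 2 - k ^+ 2.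
  by field; rewrite gt_eqF.
by rewrite rE; ring.
Qed.

Lemma quadratic_root0 (R : realType) (s : R) : quadratic_root 0 s 0 = 0.
Proof. by rewrite /quadratic_root mulr0 expr0n addr0 sqrtr0 addr0 mul0r. Qed.

Lemma quadratic_root_continuous (R : realType) (k s q : R -> R) (x : R) :
  {for x, continuous k} -> {for x, continuous s} -> {for x, continuous q} ->
  s x != 0 -> {for x, continuous (fun y => quadratic_root (k y) (s y) (q y))}.
Proof.
move=> ck cs cq sx0; apply: cvgM; last exact: cvgV.
apply: cvgD => //.
apply: (@continuous_comp _ _ _ (fun y => k y ^+ 2 + s y * q y) Num.sqrt x).
  by apply: cvgD; [apply: cvgM|apply: cvgM].
exact: sqrt_continuous.
Qed.

Section fan_existence.
Context {R : realType}.
Variable f : R -> R.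
Hypothesis hf : C2_pos f.
Hypothesis hf' : forall r : R, 0 < r -> 0 < derive1 f r.
Hypothesis hf'' : forall r : R, 0 < r -> 0 < derive1 (derive1 f) r.
Variable eps : R.
Hypothesis eps0 : 0 < eps.
Local Notation rad := (radical f eps).

Variables (s0 : R) (F : R -> R).
Hypothesis s00 : 0 < s0.
Hypothesis DF : forall s, s0 < s -> is_derive s 1 F ((rad s - eps) / (2 * s)).

(** The drop solving the quadratic relation of [shock1P] for [k = -1] and of [shock2P] for
    [k = 1]. *)
Definition shock_drop (k r0 r : R) : R :=
  quadratic_root (k * (eps * (r - r0))) (r + r0) (2 * eps * (f r - f r0) * (r - r0)).

(* The velocity at density [r] on the first wave curve from, respectively the second
   wave curve to, the state [(u0, r0)]. *)
Definition curve1 (u0 r0 r : R) : R :=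
  u0 - (F (Num.min r r0) - F r0) - shock_drop (-1) r0 (Num.max r r0).
Definition curve2 (u0 r0 r : R) : R :=
  u0 + (F (Num.min r r0) - F r0) + eps * (ln (Num.min r r0) - ln r0) +
  shock_drop 1 r0 (Num.max r r0).

Lemma primitive_le x y : s0 < x -> x <= y -> F x <= F y.
Proof.
move=> sx xy; have cF : {within `[x, y], continuous F}.
  apply: derivable_within_continuous => z; rewrite in_itv /= => /andP[xz _].
  by case: (DF (lt_le_trans sx xz)).
apply: (nondecreasing_of_derive cF) => //.
move=> z /andP[xz _]; have sz := lt_trans sx xz; have z0 := lt_trans s00 sz.
exists ((rad z - eps) / (2 * z)); first exact: DF.
by rewrite divr_ge0 ?subr_ge0 ?mulr_ge0 ?(ltW z0)// ltW// (radical_gt hf').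
Qed.

Lemma shock_dropP k r0 r : 0 < r0 -> r0 < r ->
  0 < shock_drop k r0 r /\
  shock_drop k r0 r ^+ 2 * (r + r0) - 2 * (k * (eps * (r - r0))) * shock_drop k r0 r =
  2 * eps * (f r - f r0) * (r - r0).
Proof.
move=> r00 r0r; apply: quadratic_rootP; first by rewrite addr_gt0// (lt_trans r00).
have /andP[h _] := chord_slope hf hf'' r00 r0r.
rewrite !mulr_gt0 ?subr_gt0// -subr_gt0 (lt_trans _ h)// mulr_gt0 ?hf'//.
by rewrite subr_gt0.
Qed.

Lemma shock_drop0 k r0 : shock_drop k r0 r0 = 0.
Proof. by rewrite /shock_drop !subrr !mulr0 quadratic_root0. Qed.

Lemma shock_drop_continuous k r0 x : 0 < r0 -> r0 <= x ->
  {for x, continuous (shock_drop k r0)}.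
Proof.
move=> r00 r0x; have x0 := lt_le_trans r00 r0x.
have cf := continuous_of_derive (flux_is_derive hf x0).
have cd : {for x, continuous (fun y : R => y - r0)}.
  by apply: cvgB; [exact: cvg_id|exact: cvg_cst].
apply: quadratic_root_continuous.
- by apply: cvgM; [exact: cvg_cst|apply: cvgM; [exact: cvg_cst|]].
- by apply: cvgD; [exact: cvg_id|exact: cvg_cst].
- apply: cvgM => //; apply: cvgM; first exact: cvg_cst.
  by apply: cvgB => //; exact: cvg_cst.
- by rewrite gt_eqF// addr_gt0.
Qed.

(** Thanks to [Num.min] and [Num.max] the curve is a sum of a rarefaction branch and a shock branch,
    each constant on the other's side of [r0], so nothing has to be glued at [r0]. *)
Lemma curve1_continuous u0 r0 x : s0 < r0 -> s0 < x ->
  {for x, continuous (curve1 u0 r0)}.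
Proof.
move=> sr sx; have cm : {for x, continuous (fun y : R => Num.min y r0)}.
  by apply: (@continuous_min R R id (cst r0)); [exact: cvg_id|exact: cvg_cst].
have cM : {for x, continuous (fun y : R => Num.max y r0)}.
  by apply: (@continuous_max R R id (cst r0)); [exact: cvg_id|exact: cvg_cst].
have sm : s0 < Num.min x r0 by rewrite lt_min sx.
apply: cvgB; [apply: cvgB; [exact: cvg_cst|apply: cvgB; [|exact: cvg_cst]]|].
  apply: (@continuous_comp _ _ _ (fun y : R => Num.min y r0) F x cm).
  exact: continuous_of_derive (DF sm).
apply: (@continuous_comp _ _ _ (fun y : R => Num.max y r0) _ x cM).
by apply: shock_drop_continuous; rewrite ?(lt_trans s00)// le_max lexx orbT.
Qed.

Lemma curve2_continuous u0 r0 x : s0 < r0 -> s0 < x ->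
  {for x, continuous (curve2 u0 r0)}.
Proof.
move=> sr sx; have cm : {for x, continuous (fun y : R => Num.min y r0)}.
  by apply: (@continuous_min R R id (cst r0)); [exact: cvg_id|exact: cvg_cst].
have cM : {for x, continuous (fun y : R => Num.max y r0)}.
  by apply: (@continuous_max R R id (cst r0)); [exact: cvg_id|exact: cvg_cst].
have sm : s0 < Num.min x r0 by rewrite lt_min sx.
apply: cvgD.
  apply: cvgD.
    apply: cvgD; [exact: cvg_cst|apply: cvgB; [|exact: cvg_cst]].
    apply: (@continuous_comp _ _ _ (fun y : R => Num.min y r0) F x cm).
    exact: continuous_of_derive (DF sm).
  apply: cvgM; first exact: cvg_cst.
  apply: cvgB; last exact: cvg_cst.
  apply: (@continuous_comp _ _ _ (fun y : R => Num.min y r0) (@ln R) x cm).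
  exact: continuous_of_derive (is_derive1_ln (lt_trans s00 sm)).
apply: (@continuous_comp _ _ _ (fun y : R => Num.max y r0) _ x cM).
by apply: shock_drop_continuous; rewrite ?(lt_trans s00)// le_max lexx orbT.
Qed.

(** The last inequality and its counterpart in [wave2_exists] separate the two waves: at a common
    intermediate state, the velocity minus [eps] lies strictly between them. *)
Lemma wave1_exists u0 r0 r : s0 < r0 -> s0 < r ->
  exists a b V, [/\ a <= b, wave1 f eps a b V (u0, r0) (curve1 u0 r0 r, r) &
                    b < curve1 u0 r0 r - eps].
Proof.
move=> sr0 sr; have r00 := lt_trans s00 sr0; have rr0 := lt_trans s00 sr.
have [rle|rlt] := leP r r0; last first.
  have [D0 DE] := shock_dropP (-1) r00 rlt.
  have -> : curve1 u0 r0 r = u0 - shock_drop (-1) r0 r.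
    by rewrite /curve1 min_r ?max_l ?(ltW rlt)// subrr subr0.
  have [|s sl S] := shock1_exists hf hf' hf'' eps0 (u0 - shock_drop (-1) r0 r) r00 rlt D0.
    by rewrite -DE; ring.
  rewrite subrK in S; exists s, s, (cst (0, 0)); split => //; by right.
pose u s := u0 - (F s - F r0).
pose dL s := (eps - rad s) / (2 * s) - dradical f eps s / 2.
have dL0 s : s0 < s -> dL s < 0.
  move=> ss; have p := lt_trans s00 ss.
  have d := dradical_gt0 hf' hf'' eps0 p; have g := radical_gt hf' eps0 p.
  rewrite /dL subr_lt0; apply: (@lt_trans _ _ 0); last exact: divr_gt0.
  by rewrite pmulr_llt0 ?invr_gt0 ?mulr_gt0// subr_lt0.
have Du s : s0 < s -> is_derive s 1 u ((eps - rad s) / (2 * s)).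
  move=> ss; have := DF ss => D.
  have -> : u = cst u0 - (F - cst (F r0)) :> (R -> R) by [].
  by apply: is_derive_eq; rewrite subr0 sub0r -mulNr opprB.
have DL s : s0 < s -> is_derive s 1 (fun s => lambda1 f eps (u s, s)) (dL s).
  move=> ss; have D1 := Du s ss.
  have D2 := radical_is_derive hf hf' eps0 (lt_trans s00 ss).
  have -> : (fun s => lambda1 f eps (u s, s)) =
      u - cst (eps / 2) - (2^-1 \*: rad) :> (R -> R).
    by apply/funext => x; rewrite /lambda1 /= !fctE /= /GRing.scale /= (mulrC 2^-1).
  by apply: is_derive_eq; rewrite subr0 /GRing.scale /= /dL (mulrC 2^-1).
have [V rV] := @rarefaction_of_curve R (lambda1 f eps) (X1 f eps) u dL s0 s00
  (fun _ => erefl) Du DL (fun s ss => negbT (lt_eqF (dL0 s ss))).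
have cE : curve1 u0 r0 r = u r.
  by rewrite /curve1 min_l// max_r// shock_drop0 subr0.
have uE : u r0 = u0 by rewrite /u subrr subr0.
have LL : lambda1 f eps (u r0, r0) <= lambda1 f eps (u r, r).
  rewrite -lerN2.
  have cL : {within `[r, r0], continuous (fun s => - lambda1 f eps (u s, s))}.
    apply: derivable_within_continuous => z; rewrite in_itv /= => /andP[rz _].
    by apply: derivableN; case: (DL z (lt_le_trans sr rz)).
  apply: (nondecreasing_of_derive cL) => //.
  move=> z /andP[rz _]; have sz := lt_trans sr rz.
  exists (- dL z); last by rewrite oppr_ge0 ltW// dL0.
  have := DL z sz => D; exact: is_deriveN.
exists (lambda1 f eps (u r0, r0)), (lambda1 f eps (u r, r)), V; split => //.
  by left; have := rV r0 r sr0 sr LL; rewrite uE cE.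
have g := radical_gt hf' eps0 rr0.
by rewrite cE /lambda1 /=; lra.
Qed.

Lemma wave2_exists u0 r0 r : s0 < r0 -> s0 < r ->
  exists a b V, [/\ a <= b, wave2 f eps a b V (curve2 u0 r0 r, r) (u0, r0) &
                    curve2 u0 r0 r - eps < a].
Proof.
move=> sr0 sr; have r00 := lt_trans s00 sr0; have rr0 := lt_trans s00 sr.
have [rle|rlt] := leP r r0; last first.
  have [D0 DE] := shock_dropP 1 r00 rlt.
  have -> : curve2 u0 r0 r = u0 + shock_drop 1 r0 r.
    by rewrite /curve2 min_r ?max_l ?(ltW rlt)// !subrr mulr0 !addr0.
  have [|s sl S] := shock2_exists hf hf' hf'' eps0 (u0 + shock_drop 1 r0 r) r00 rlt D0.
    by rewrite -DE; ring.
  rewrite addrK in S; exists s, s, (cst (0, 0)); split => //; by right.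
(* The logarithm accounts for [(eps + rad) / (2 * s) = (rad - eps) / (2 * s) + eps / s]. *)
pose u s := u0 + (F s - F r0) + eps * (ln s - ln r0).
pose dL s := (eps + rad s) / (2 * s) + dradical f eps s / 2.
have dL0 s : s0 < s -> 0 < dL s.
  move=> ss; have p := lt_trans s00 ss.
  have d := dradical_gt0 hf' hf'' eps0 p; have g := radical_gt hf' eps0 p.
  by rewrite addr_gt0// divr_gt0// ?mulr_gt0 ?addr_gt0// (lt_trans eps0).
have Du s : s0 < s -> is_derive s 1 u ((eps + rad s) / (2 * s)).
  move=> ss; have := DF ss => D; have p := lt_trans s00 ss.
  have Dl := is_derive1_ln p.
  have D1 := is_deriveB D (is_derive_cst (F r0) s 1).
  have D2 := is_deriveZ eps (is_deriveB Dl (is_derive_cst (ln r0) s 1)).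
  have D3 := is_deriveD (is_deriveD (is_derive_cst u0 s 1) D1) D2.
  apply: (@is_derive_eq _ _ _ _ _ _ _ _ D3); rewrite /GRing.scale /=.
  by field; rewrite gt_eqF.
have DL s : s0 < s -> is_derive s 1 (fun s => lambda2 f eps (u s, s)) (dL s).
  move=> ss; have D1 := Du s ss.
  have D2 := radical_is_derive hf hf' eps0 (lt_trans s00 ss).
  have -> : (fun s => lambda2 f eps (u s, s)) =
      u - cst (eps / 2) + (2^-1 \*: rad) :> (R -> R).
    by apply/funext => x; rewrite /lambda2 /= !fctE /= /GRing.scale /= (mulrC 2^-1).
  by apply: is_derive_eq; rewrite subr0 /GRing.scale /= /dL (mulrC 2^-1).
have [V rV] := @rarefaction_of_curve R (lambda2 f eps) (X2 f eps) u dL s0 s00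
  (fun _ => erefl) Du DL (fun s ss => negbT (gt_eqF (dL0 s ss))).
have cE : curve2 u0 r0 r = u r.
  by rewrite /curve2 min_l// max_r// shock_drop0 addr0.
have uE : u r0 = u0 by rewrite /u !subrr mulr0 !addr0.
have LL : lambda2 f eps (u r, r) <= lambda2 f eps (u r0, r0).
  have cL : {within `[r, r0], continuous (fun s => lambda2 f eps (u s, s))}.
    apply: derivable_within_continuous => z; rewrite in_itv /= => /andP[rz _].
    by case: (DL z (lt_le_trans sr rz)).
  apply: (nondecreasing_of_derive cL) => //.
  move=> z /andP[rz _]; have sz := lt_trans sr rz.
  by exists (dL z); [exact: DL|rewrite ltW// dL0].
exists (lambda2 f eps (u r, r)), (lambda2 f eps (u r0, r0)), V; split => //.
  by left; have := rV r r0 sr sr0 LL; rewrite uE cE.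
have g := radical_gt hf' eps0 rr0; have e0 := eps0.
by rewrite cE /lambda2 /=; lra.
Qed.

End fan_existence.

Lemma fan_exists (R : realType) (f : R -> R) (hf : C2_pos f)
    (hf' : forall r : R, 0 < r -> 0 < derive1 f r)
    (hf'' : forall r : R, 0 < r -> 0 < derive1 (derive1 f) r)
    (eps ul ur rl rr : R) : 0 < eps -> 0 < rl -> 0 < rr ->
  exists V, two_wave_fan f eps (ul, rl) (ur, rr) V.
Proof.
move=> eps0 rl0 rr0.
(* Below both densities the two curves are rarefaction branches, and the last bound lets the
   logarithm bring the second curve down to at most [ul], while the first stays at or above it. *)
pose p1 := Num.min (Num.min rl rr) (rr * expR ((ul - ur) / eps)).
have p10 : 0 < p1 by rewrite !lt_min rl0 rr0 mulr_gt0// expR_gt0.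
have p1l : p1 <= rl by rewrite !ge_min lexx.
have p1r : p1 <= rr by rewrite !ge_min lexx orbT.
have p1e : p1 <= rr * expR ((ul - ur) / eps) by rewrite ge_min lexx orbT.
clearbody p1; pose s0 := p1 / 2.
have s00 : 0 < s0 by rewrite divr_gt0.
have s0p : s0 < p1 by rewrite ltr_pdivrMr// mulr2n mulrDr mulr1 ltrDl.
have s0l := lt_le_trans s0p p1l; have s0r := lt_le_trans s0p p1r.
have [|F DF] := @primitive_right R (fun s => (radical f eps s - eps) / (2 * s)) 0 s0 s00.
  move=> s s_gt0; apply: cvgM.
    by apply: cvgB; [exact: radical_continuous|exact: cvg_cst].
  apply: cvgV; first by rewrite mulf_neq0// gt_eqF.
  by apply: cvgM; [exact: cvg_cst|exact: cvg_id].
have fr0 := hf' _ rr0.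
(* At density [rr + P] the drop [D] of the 2-shock is at least [ul - ur]: otherwise, since
   [2 * rr < P], the quadratic relation and the convexity of [f] would give
   [eps * derive1 f rr * P < D ^+ 2], against the last summand of [P]. *)
pose P := 2 * rr + rl + (ul - ur) ^+ 2 / (eps * derive1 f rr).
have q0 : 0 <= (ul - ur) ^+ 2 / (eps * derive1 f rr).
  by rewrite divr_ge0 ?sqr_ge0// ltW// mulr_gt0.
have qE : (ul - ur) ^+ 2 / (eps * derive1 f rr) * (eps * derive1 f rr) = (ul - ur) ^+ 2.
  by rewrite divfK// gt_eqF// mulr_gt0.
have Pr : 2 * rr < P by rewrite /P; lra.
have Pl : rl < P by rewrite /P; lra.
have Pq : (ul - ur) ^+ 2 <= P * (eps * derive1 f rr).
  by rewrite -[leLHS]qE ler_pM2r ?mulr_gt0// /P; lra.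
clear q0 qE; clearbody P; have P0 := lt_trans rl0 Pl.
pose p2 := rr + P; have p12 : p1 <= p2 by rewrite (le_trans p1r)// lerDl ltW.
have rlp2 : rl < p2 by rewrite (lt_trans Pl)// ltrDr.
have rrp2 : rr < p2 by rewrite ltrDl.
pose W1 := curve1 f eps F ul rl; pose W2 := curve2 f eps F ur rr.
have G1 : W2 p1 <= W1 p1.
  have Fl := primitive_le hf' eps0 s00 DF s0p p1l.
  have Fr := primitive_le hf' eps0 s00 DF s0p p1r.
  have : eps * (ln p1 - ln rr) <= ul - ur.
    rewrite mulrC -ler_pdivlMr// lerBlDl -[leRHS]expRK expRD lnK// .
    by rewrite ler_ln// posrE// mulr_gt0// expR_gt0.
  rewrite /W1 /W2 /curve1 /curve2 !min_l// !max_r// !shock_drop0.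
  by move: Fl Fr; clear; lra.
have G2 : W1 p2 <= W2 p2.
  have [D1 _] := shock_dropP hf hf' hf'' eps0 (-1) rl0 rlp2.
  have [D2 E2] := shock_dropP hf hf' hf'' eps0 1 rr0 rrp2.
  have : ul - ur <= shock_drop f eps 1 rr p2.
    rewrite leNgt; apply/negP => h.
    move: E2 D2 h; set D := shock_drop f eps 1 rr p2; clearbody D => E2 D2 h.
    have D2d : D ^+ 2 < (ul - ur) ^+ 2.
      by rewrite ltr_pXn2r// nnegrE ?ltW// (lt_trans D2 h).
    have /andP[c1 _] := chord_slope hf hf'' rr0 rrp2.
    have P2E : p2 - rr = P by rewrite /p2 addrC addKr.
    rewrite P2E in E2 c1.
    have k1 : D ^+ 2 * (p2 + rr) <= D ^+ 2 * (2 * P).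
      by rewrite ler_wpM2l ?sqr_ge0// /p2; move: Pr; clear; lra.
    have k2 : 0 < eps * P * D by rewrite !mulr_gt0.
    have k3 : 2 * eps * (derive1 f rr * P) * P < 2 * eps * (f p2 - f rr) * P.
      by rewrite ltr_pM2r// ltr_pM2l// mulr_gt0.
    have k4 : D ^+ 2 * (2 * P) < P * (eps * derive1 f rr) * (2 * P).
      by rewrite ltr_pM2r ?mulr_gt0// (lt_le_trans D2d).
    by move: E2 k1 k2 k3 k4; clear; lra.
  rewrite /W1 /W2 /curve1 /curve2 !min_r ?(ltW rlp2) ?(ltW rrp2)//.
  rewrite !max_l ?(ltW rlp2) ?(ltW rrp2)//.
  by move: D1; clear; lra.
have [||p pp E] := @IVT R (fun r => W1 r - W2 r) p1 p2 0 p12.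
- apply: continuous_in_subspaceT => x; rewrite inE /= in_itv /= => /andP[p1x _].
  have sx := lt_le_trans s0p p1x.
  by apply: cvgB; [exact: curve1_continuous|exact: curve2_continuous].
- by rewrite ge_min le_max !subr_le0 !subr_ge0 G1 G2 orbT.
have sp : s0 < p by move: pp; rewrite in_itv /= => /andP[/(lt_le_trans s0p)].
have [a1 [b1 [V1 [ab1 w1 b1u]]]] := wave1_exists hf hf' hf'' eps0 s00 DF ul s0l sp.
have [a2 [b2 [V2 [ab2 w2 a2u]]]] := wave2_exists hf hf' hf'' eps0 s00 DF ur s0r sp.
move/eqP: E; rewrite subr_eq0 /W1 /W2 => /eqP E; rewrite -E in w2 a2u.
pose m := (curve1 f eps F ul rl p, p); rewrite -/m in w1 w2.
(* The waves receive their closed intervals, as [rarefaction] prescribes the values at both ends. *)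
pose V xi := if xi < a1 then (ul, rl) else if xi <= b1 then V1 xi
  else if xi < a2 then m else if xi <= b2 then V2 xi else (ur, rr).
have b1a2 : b1 < a2 by rewrite (lt_trans b1u).
exists V, a1, b1, a2, b2, m; split.
- by split; [exact: lt_trans sp|].
- split.
  + case: w1 => [rV|[e S]]; [left|by right].
    apply: rarefaction_ext rV => xi /andP[h1 h2].
    by rewrite /V (le_gtF h1) h2.
  + case: w2 => [rV|[e S]]; [left|by right].
    apply: rarefaction_ext rV => xi /andP[h1 h2].
    have h3 := lt_le_trans b1a2 h1; have h4 := le_lt_trans ab1 h3.
    by rewrite /V (lt_gtF h4) (lt_geF h3) (le_gtF h1) h2.
- by move=> xi h; rewrite /V h.
- move=> xi /andP[h1 h2]; have h4 := le_lt_trans ab1 h1.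
  by rewrite /V (lt_gtF h4) (lt_geF h1) h2.
- move=> xi h1; have h2 := le_lt_trans ab2 h1; have h3 := lt_trans b1a2 h2.
  have h4 := le_lt_trans ab1 h3.
  by rewrite /V (lt_gtF h4) (lt_geF h3) (lt_gtF h2) (lt_geF h1).
Qed.

(** * Integrals over the half plane *)

Section plane.
Context {R : realType}.
Local Notation plane := (measurableTypeR R * measurableTypeR R)%type.
Local Notation leb := (@lebesgue_measure R).

(** The sigma-algebra is the product one, generated by rectangles. An open set reaches it as the
    countable union of the products of balls with rational centres and radii [1 / (n + 1)] that it
    contains. *)
Lemma open_measurable2 (U : set (R * R)) : open U -> measurable (U : set plane).
Proof.
move=> oU; pose B (i : rat * rat * nat) : set plane :=
  ball (ratr i.1.1 : R) i.2.+1%:R^-1 `*` ball (ratr i.1.2 : R) i.2.+1%:R^-1.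
have mB i : measurable (B i) by apply: measurableX; exact: measurable_ball.
have -> : U = \bigcup_i (if `[< B i `<=` U >] then B i else set0) :> set plane.
  apply/seteqP; split => [z Uz|z [i _]]; last by case: asboolP => // h /h.
  have [e /= e0 zeU] := (nbhs_ballP z U).1 (open_nbhs_nbhs (conj oU Uz)).
  have [n ne] : exists n, n.+1%:R^-1 < e / 2.
    have e20 : 0 < e / 2 by rewrite divr_gt0.
    have [n _ h] := near_infty_natSinv_lt (PosNum e20).
    by exists n; apply: h => /=.
  have r0 : 0 < n.+1%:R^-1 :> R by rewrite invr_gt0.
  have q (x : R) : exists q : rat, `|x - ratr q| < n.+1%:R^-1.
    have /rat_in_itvoo[q] : x - n.+1%:R^-1 < x + n.+1%:R^-1.
      by rewrite ltrBlDr -addrA ltrDl addr_gt0.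
    by rewrite in_itv /= => h; exists q; rewrite ltr_distlC.
  have [q1 h1] := q z.1; have [q2 h2] := q z.2.
  exists (q1, q2, n) => //; case: asboolP => [_|].
    by split => /=; rewrite /ball /= distrC.
  case; move=> y [/= y1 y2]; apply: zeU; split; rewrite /= /ball /=.
    rewrite (le_lt_trans (ler_distD (ratr q1) _ _))// (splitr e).
    by rewrite ltrD// (lt_trans _ ne).
  rewrite (le_lt_trans (ler_distD (ratr q2) _ _))// (splitr e).
  by rewrite ltrD// (lt_trans _ ne).
apply: countable_bigcupT_measurable => // i.
by case: asboolP => _; [exact: mB|exact: measurable0].
Qed.

Lemma compact_measurable2 (K : set (R * R)) :
  compact K -> measurable (K : set plane).
Proof.
move=> cK; rewrite -[K]setCK; apply: measurableC; apply: open_measurable2.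
by apply: closed_openC; apply: compact_closed => //; exact: norm_hausdorff.
Qed.

Lemma continuous_measurable2 (g : R * R -> R) :
  continuous g -> measurable_fun setT (g : plane -> R).
Proof.
move=> /continuousP cg; apply: (measurability _ (RGenOpens.measurableE R)).
move=> _ [_ [a [b ->] <-]]; rewrite setTI; apply: open_measurable2.
exact/cg/interval_open.
Qed.

Definition square (M : R) : set (R * R) := [set z | `|z.1| <= M /\ `|z.2| <= M].

Lemma squareE M : square M = `[- M, M] `*` `[- M, M].
Proof.
by apply/seteqP; split => z; rewrite /square /= !in_itv /= !ler_norml.
Qed.

Lemma measurable_square M : measurable (square M : set plane).
Proof. by rewrite squareE; apply: measurableX. Qed.

Lemma square_lt_pinfty M : (leb2 (square M) < +oo)%E.
Proof.
rewrite squareE /leb2 product_measure1E//= lebesgue_measure_itv.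
by case: ifP => _; rewrite ?mul0e// -EFinB -EFinM ltry.
Qed.

Lemma compact_square (K : set (R * R)) : compact K -> exists M, K `<=` square M.
Proof.
move=> cK; have [M [_ h]] := compact_bounded cK.
exists (`|M| + 1) => z Kz.
have := h (`|M| + 1) _ z Kz.
rewrite (le_lt_trans (ler_norm _)) ?ltrDl// => /(_ isT).
by rewrite /= prod_normE /= ge_max => /andP[].
Qed.

Lemma compact_lt_pinfty (K : set (R * R)) : compact K -> (leb2 K < +oo)%E.
Proof.
move=> cK; have [M KM] := compact_square cK.
apply: (le_lt_trans _ (square_lt_pinfty M)); apply: le_measure => //.
- by rewrite inE; exact: compact_measurable2.
- by rewrite inE; exact: measurable_square.
Qed.

Lemma measurable_half_plane :
  measurable (@closed_half_plane R : set plane) /\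
  measurable (@open_half_plane R : set plane).
Proof.
have m2 : measurable_fun setT (snd : plane -> R) := measurable_snd.
split.
  have -> : @closed_half_plane R = setT `&` snd @^-1` `[0, +oo[.
    by apply/seteqP; split => z /=; rewrite in_itv /= andbT => // -[].
  exact: m2.
have -> : @open_half_plane R = setT `&` snd @^-1` `]0, +oo[.
  by apply/seteqP; split => z /=; rewrite in_itv /= andbT => // -[].
exact: m2.
Qed.

End plane.

Lemma integrable_bounded_support d (T : measurableType d) (R : realType)
    (mu : {measure set T -> \bar R}) (f : T -> R) (A : set T) (M : R) :
  measurable A -> (mu A < +oo)%E -> measurable_fun setT f ->
  (forall x, `|f x| <= M) -> (forall x, ~ A x -> f x = 0) ->
  mu.-integrable setT (EFin \o f).
Proof.
move=> mA Aoo mf fM f0.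
have -> : EFin \o f = (EFin \o f) \_ A.
  by apply/funext => x; rewrite patchE; case: ifPn => //; rewrite notin_setE => /f0 /= ->.
rewrite -integrable_mkcond//; apply: measurable_bounded_integrable => //.
- exact: measurable_funTS.
- by exists M; split; [exact: num_real|move=> x /ltW Mx y _; exact: le_trans (fM y) Mx].
Qed.

(** Packs the image measure as a measure [nu], with its values kept as an equation. *)
Lemma pushforward_measureP d d' (T : measurableType d) (T' : measurableType d')
    (R : realType) (mu : {measure set T -> \bar R}) (g : T -> T') :
  measurable_fun setT g ->
  exists nu : {measure set T' -> \bar R}, nu = pushforward mu g :> (set T' -> \bar R).
Proof.
move=> mg.
by exists (measure_function_pushforward__canonical__measure_function_Measure mu mg).
Qed.

Section bounded_support.
Context {R : realType}.
Local Notation plane := (measurableTypeR R * measurableTypeR R)%type.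
Local Notation leb := (@lebesgue_measure R).
Local Notation leb2 := (@leb2 R).

(** The working class of integrands: integrable, stable under sums and under products with bounded
    measurable weights, and passing to sections, so that it also justifies Fubini. One number bounds
    both the values and the support. *)
Definition nice1 (g : R -> R) := measurable_fun setT (g : measurableTypeR R -> R) /\
  exists M, (forall x, `|g x| <= M) /\ (forall x, M < `|x| -> g x = 0).

Definition nice2 (g : R * R -> R) := measurable_fun setT (g : plane -> R) /\
  exists M, (forall z, `|g z| <= M) /\ (forall z, ~ square M z -> g z = 0).

Definition bounded_mfun d (T : measurableType d) (w : T -> R) :=
  measurable_fun setT w /\ exists M, forall x, `|w x| <= M.

Lemma nice1_integrable g : nice1 g -> leb.-integrable setT (EFin \o g).
Proof.
move=> [mg [M [gM g0]]].
apply: (@integrable_bounded_support _ _ R leb g `[- M, M]%classic M) => //.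
- rewrite [X in (X < _)%E]lebesgue_measure_itv /=.
  by case: ifP => _; rewrite ?ltry// -EFinB ltry.
- move=> x h; apply: g0; rewrite ltNge; apply: contra_notN h.
  by rewrite /= in_itv /= ler_norml.
Qed.

Lemma nice2_integrable g : nice2 g -> leb2.-integrable setT (EFin \o g).
Proof.
move=> [mg [M [gM g0]]].
apply: (@integrable_bounded_support _ plane R leb2 g (square M) M) => //.
- exact: measurable_square.
- exact: square_lt_pinfty.
Qed.

Lemma square_le (M N : R) : M <= N -> square M `<=` square N.
Proof. by move=> MN z [h1 h2]; split; exact: le_trans MN. Qed.

Lemma nice2_mul (w g : R * R -> R) : bounded_mfun (w : plane -> R) -> nice2 g ->
  nice2 (fun z => w z * g z).
Proof.
move=> [mw [C wC]] [mg [M [gM g0]]]; split; first exact: measurable_funM.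
have C0 : 0 <= C by exact: le_trans (wC point).
have M0 : 0 <= M by exact: le_trans (gM point).
exists (C * M + M); split.
  move=> z; rewrite normrM (@le_trans _ _ (C * M))// ?lerDl//.
  exact: ler_pM.
move=> z h; rewrite g0 ?mulr0// => h2; apply: h; apply: square_le h2.
by rewrite lerDr mulr_ge0.
Qed.

Lemma nice1_mul (w g : R -> R) : bounded_mfun (w : measurableTypeR R -> R) -> nice1 g ->
  nice1 (fun z => w z * g z).
Proof.
move=> [mw [C wC]] [mg [M [gM g0]]]; split; first exact: measurable_funM.
have C0 : 0 <= C by exact: le_trans (wC point).
have M0 : 0 <= M by exact: le_trans (gM point).
exists (C * M + M); split.
  move=> z; rewrite normrM (@le_trans _ _ (C * M))// ?lerDl//.
  exact: ler_pM.
move=> z h; rewrite g0 ?mulr0// (le_lt_trans _ h)//.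
by rewrite lerDr mulr_ge0.
Qed.

Lemma nice2_add (g h : R * R -> R) : nice2 g -> nice2 h -> nice2 (fun z => g z + h z).
Proof.
move=> [mg [M [gM g0]]] [mh [N [hN h0]]]; split; first exact: measurable_funD.
have M0 : 0 <= M by exact: le_trans (gM point).
have N0 : 0 <= N by exact: le_trans (hN point).
exists (M + N); split.
  by move=> z; rewrite (le_trans (ler_normD _ _))// lerD.
move=> z h'; rewrite g0 ?h0 ?addr0// => k; apply: h'; apply: square_le k.
  by rewrite lerDr.
by rewrite lerDl.
Qed.

Lemma nice1_add (g h : R -> R) : nice1 g -> nice1 h -> nice1 (fun z => g z + h z).
Proof.
move=> [mg [M [gM g0]]] [mh [N [hN h0]]]; split; first exact: measurable_funD.
have M0 : 0 <= M by exact: le_trans (gM point).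
have N0 : 0 <= N by exact: le_trans (hN point).
exists (M + N); split.
  by move=> z; rewrite (le_trans (ler_normD _ _))// lerD.
by move=> z h'; rewrite g0 ?h0 ?addr0// (le_lt_trans _ h')// ?lerDr ?lerDl.
Qed.

Lemma bounded_mfun_cst d (T : measurableType d) (k : R) : bounded_mfun (fun _ : T => k).
Proof. by split; [exact: measurable_cst|exists `|k|]. Qed.

Lemma bounded_mul d (T : measurableType d) (w v : T -> R) :
  bounded_mfun w -> bounded_mfun v -> bounded_mfun (fun x => w x * v x).
Proof.
move=> [mw [C wC]] [mv [D vD]]; split; first exact: measurable_funM.
by exists (C * D) => x; rewrite normrM ler_pM.
Qed.

Lemma bounded_sub d (T : measurableType d) (w v : T -> R) :
  bounded_mfun w -> bounded_mfun v -> bounded_mfun (fun x => w x - v x).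
Proof.
move=> [mw [C wC]] [mv [D vD]]; split; first exact: measurable_funB.
by exists (C + D) => x; rewrite (le_trans (ler_normB _ _))// lerD.
Qed.

Lemma nice2_section1 g x : nice2 g -> nice1 (fun t => g (x, t)).
Proof.
move=> [mg [M [gM g0]]]; split; first exact: (measurableT_comp mg (pair1_measurable x)).
exists M; split => // t tM; apply: g0 => -[_ /=].
by rewrite leNgt tM.
Qed.

Lemma nice2_section2 g t : nice2 g -> nice1 (fun x => g (x, t)).
Proof.
move=> [mg [M [gM g0]]]; split; first exact: (measurableT_comp mg (pair2_measurable t)).
exists M; split => // x xM; apply: g0 => -[/= h _].
by move: h; rewrite leNgt xM.
Qed.

Lemma integral_nice1 g : nice1 g ->
  (\int[leb]_x (g x)%:E = (\int[leb]_x g x)%:E)%E.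
Proof.
move=> ng; rewrite /Rintegral fineK//.
exact: (integrable_fin_num measurableT (nice1_integrable ng)).
Qed.

Lemma integral_nice2 g : nice2 g ->
  (\int[leb2]_x (g x)%:E = (\int[leb2]_x g x)%:E)%E.
Proof.
move=> ng; rewrite /Rintegral fineK//.
exact: (integrable_fin_num measurableT (nice2_integrable ng)).
Qed.

Lemma Rintegral_leb2_xt g : nice2 g ->
  \int[leb2]_z g z = \int[leb]_x (\int[leb]_t g (x, t)).
Proof.
move=> ng; rewrite /Rintegral.
have /= <- := integral12_prod_meas1 (nice2_integrable ng).
congr fine; apply: eq_integral => x _; rewrite /fubini_F /= -[RHS]/(EFin _).
by rewrite [LHS]integral_nice1//; exact: nice2_section1.
Qed.

Lemma Rintegral_leb2_tx g : nice2 g ->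
  \int[leb2]_z g z = \int[leb]_t (\int[leb]_x g (x, t)).
Proof.
move=> ng; rewrite /Rintegral.
have /= <- := integral21_prod_meas1 (nice2_integrable ng).
congr fine; apply: eq_integral => t _; rewrite /fubini_G /=.
by rewrite [LHS]integral_nice1//; exact: nice2_section2.
Qed.

(** The translated measure agrees with Lebesgue measure on half-open intervals, which determine
    it. *)
Lemma lebesgue_measure_shift (s : R) (A : set R) : measurable A ->
  leb A = leb ((fun x : R => x + s) @^-1` A).
Proof.
have ms : measurable_fun setT (fun x : measurableTypeR R => x + s : measurableTypeR R).
  by apply: measurable_funD.
have [nu nuE] := pushforward_measureP leb ms.
have -> : leb ((fun x : R => x + s) @^-1` A) = nu A by rewrite nuE.
move=> mA; apply: lebesgue_measure_unique => //.
move=> _ [[a b] _ <-] /=; rewrite nuE /pushforward /=.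
have -> : (fun x : R => x + s) @^-1` `]a, b] = `]a - s, b - s]%classic.
  by apply/seteqP; split => x; rewrite /= !in_itv /= ltrBlDr lerBrDr.
by rewrite !lebesgue_measure_itv /= !lte_fin ltrBlDr subrK -!EFinB opprB addrA subrK.
Qed.

Lemma integral_shift (s : R) (g : R -> R) : nice1 g ->
  \int[leb]_x g x = \int[leb]_x g (x + s).
Proof.
move=> [mg [M [gM g0]]]; rewrite /Rintegral; congr fine.
have ms : measurable_fun setT (fun x : measurableTypeR R => x + s : measurableTypeR R).
  by apply: measurable_funD.
have [nu nuE] := pushforward_measureP leb ms.
transitivity (\int[nu]_x (g x)%:E)%E.
  by apply: eq_measure_integral => A mA _; rewrite nuE; exact: lebesgue_measure_shift.
rewrite nuE integral_pushforward//; first exact/measurable_EFinP.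
rewrite preimage_setT; apply: (nice1_integrable (g := fun x => g (x + s))).
split; first exact: (measurableT_comp mg ms).
exists (M + `|s|); split => x.
  by rewrite (le_trans (gM _))// lerDl.
move=> h; apply: g0; rewrite -(ltrD2r `|s|) (lt_le_trans h)//.
by rewrite -{1}(addrK s x) (le_trans (ler_normB _ _)).
Qed.

(** With value 0 at the origin, [heaviside z.2] is exactly the indicator of the open half plane. *)
Definition heaviside (x : R) : R := if 0 < x then 1 else 0.

Lemma heaviside_le1 (x : R) : `|heaviside x| <= 1.
Proof. by rewrite /heaviside; case: ifP; rewrite ?normr1 ?normr0. Qed.

Lemma measurable_heaviside d (T : measurableType d) (w : T -> R) :
  measurable_fun setT w -> bounded_mfun (fun x => heaviside (w x)).
Proof.
move=> mw; split.
  by apply: measurable_fun_ifT => //; exact: measurable_fun_ltr.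
by exists 1 => x; exact: heaviside_le1.
Qed.

Lemma derivable_LRcontinuous (g : R -> R) a b :
  (forall x, derivable g x 1) -> derivable_oo_LRcontinuous g a b.
Proof.
move=> dg; have cg x : {for x, continuous g}.
  exact/differentiable_continuous/derivable1_diffP.
split => //.
- exact: cvg_at_right_filter (cg a).
- exact: cvg_at_left_filter (cg b).
Qed.

Lemma integral_derive_left (g dg : R -> R) (k M : R) :
  continuous dg -> (forall x : R, is_derive x 1 g (dg x)) ->
  (forall x, M < `|x| -> g x = 0) -> (forall x, M < `|x| -> dg x = 0) ->
  \int[leb]_x (heaviside (k - x) * dg x) = g k.
Proof.
move=> cdg Dg g0 dg0; pose N := `|M| + `|k| + 1.
(* [N] lies beyond the support and beyond [k]: the half line is cut at [- N], where the boundary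
   term vanishes. *)
have MN : M < N by rewrite /N (le_lt_trans (ler_norm M))// -addrA ltrDl ltr_wpDl.
have Nk : - N < k.
  by rewrite ltrNl (le_lt_trans (ler_norm (- k)))// normrN /N ltr_pwDr// lerDr.
have E : (\int[leb]_(x in `[(- N)%R, k]) (dg x)%:E = (g k)%:E - (g (- N))%:E)%E.
  apply: continuous_FTC2 => //.
  - exact: continuous_subspaceT.
  - by apply: derivable_LRcontinuous => x; case: (Dg x).
  - by move=> x _; rewrite derive1E; case: (Dg x) => _ ->.
have gN : g (- N) = 0 by apply: g0; rewrite normrN (lt_le_trans MN)// ler_norm.
rewrite /Rintegral; transitivity (fine (\int[leb]_(x in `[(- N)%R, k[) (dg x)%:E)%E).
  rewrite [in RHS]integral_mkcond; congr fine; apply: eq_integral => x _.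
  rewrite patchE /heaviside subr_gt0 mem_setE in_itv /=.
  have [xk|xk] := lt_or_le x k; last by rewrite (le_gtF xk) andbF mul0r.
  rewrite xk mul1r; have [h|h] := lt_or_le x (- N); last by rewrite h.
  rewrite (lt_geF h) dg0//= (lt_trans MN)//.
  by rewrite -normrN (lt_le_trans _ (ler_norm _))// ltrNr.
rewrite integral_itv_bndo_bndc; first by rewrite E gN /= subr0.
by apply/measurable_EFinP/measurable_funTS; exact: continuous_measurable_fun.
Qed.

Lemma integral_derive_right (g dg : R -> R) (k M : R) :
  continuous dg -> (forall x : R, is_derive x 1 g (dg x)) ->
  (forall x, M < `|x| -> g x = 0) -> (forall x, M < `|x| -> dg x = 0) ->
  \int[leb]_x (heaviside (x - k) * dg x) = - g k.
Proof.
move=> cdg Dg g0 dg0; pose N := `|M| + `|k| + 1.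
have MN : M < N by rewrite /N (le_lt_trans (ler_norm M))// -addrA ltrDl ltr_wpDl.
have Nk : k < N.
  by rewrite (le_lt_trans (ler_norm k))// /N ltr_pwDr// lerDr.
have E : (\int[leb]_(x in `[k, N]) (dg x)%:E = (g N)%:E - (g k)%:E)%E.
  apply: continuous_FTC2 => //.
  - exact: continuous_subspaceT.
  - by apply: derivable_LRcontinuous => x; case: (Dg x).
  - by move=> x _; rewrite derive1E; case: (Dg x) => _ ->.
have gN : g N = 0 by apply: g0; rewrite (lt_le_trans MN)// ler_norm.
rewrite /Rintegral; transitivity (fine (\int[leb]_(x in `]k, N]) (dg x)%:E)%E).
  rewrite [in RHS]integral_mkcond; congr fine; apply: eq_integral => x _.
  rewrite patchE /heaviside subr_gt0 mem_setE in_itv /=.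
  have [kx|kx] := lt_or_le k x; last by rewrite (le_gtF kx) mul0r.
  rewrite kx mul1r; have [h|h] := lt_or_le N x; last by rewrite h.
  by rewrite (lt_geF h) dg0//= (lt_trans MN)// (lt_le_trans _ (ler_norm _)).
rewrite integral_itv_obnd_cbnd; first by rewrite E gN /= sub0r.
by apply/measurable_EFinP/measurable_funTS; exact: continuous_measurable_fun.
Qed.

End bounded_support.

Lemma mvt_between (R : realType) (g dg : R -> R) (a b : R) :
  (forall x : R, is_derive x 1 g (dg x)) ->
  exists2 c, `|c - a| <= `|b - a| & g b - g a = dg c * (b - a).
Proof.
move=> Dg; have cg x y : {within `[x, y], continuous g}.
  by apply: derivable_within_continuous => z _; case: (Dg z).
have [ab|/ltW ba] := leP a b.
  have [c] := @MVT_segment R g dg a b ab (fun x _ => Dg x) (cg a b).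
  rewrite in_itv /= => /andP[ac cb] E; exists c => //.
  by rewrite !ger0_norm ?subr_ge0// lerD2r.
have [c] := @MVT_segment R g dg b a ba (fun x _ => Dg x) (cg b a).
rewrite in_itv /= => /andP[bc ca] E; exists c.
  by rewrite !ler0_norm ?subr_le0// lerN2 lerD2r.
by rewrite -opprB E -mulrN opprB.
Qed.

(** * Test functions and their derivatives along rays *)

Section test_functions.
Context {R : realType}.
Local Notation plane := (measurableTypeR R * measurableTypeR R)%type.
Local Notation leb := (@lebesgue_measure R).
Local Notation leb2 := (@leb2 R).

(** What the integral identities use of a test function, common to [test_closed] and [test_open]:
    first derivatives, and one square outside of which the function and both derivatives vanish. *)
Definition C1_compact (phi : R * R -> R) :=
  [/\ continuous phi, continuous (dx phi), continuous (dt phi),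
      forall z, derivable phi z (1, 0) /\ derivable phi z (0, 1) &
      exists M, forall z, ~ square M z -> [/\ phi z = 0, dx phi z = 0 & dt phi z = 0]].

Lemma test_C1_compact phi : test_closed phi -> C1_compact phi.
Proof.
move=> [sphi cphi]; split.
- by have [] := sphi [::].
- by have [] := sphi [:: true].
- by have [] := sphi [:: false].
- by move=> z; have [_] := sphi [::].
have [M sM] := compact_square cphi; exists M => z zM.
have [_ D] := sphi [::]; have [D1 D2] := D z.
have N : \forall y \near z, 0 = phi y.
  have : nbhs z (~` supp phi).
    apply: open_nbhs_nbhs; split; last by move/sM.
    by apply: closed_openC; exact: closed_closure.
  apply: filterS => y ys; apply/esym/eqP; apply: contra_notT ys => h2.
  exact: subset_closure.
have p0 : phi z = 0 by rewrite -(nbhs_singleton N).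
by split => //; rewrite /dx /dt -(near_eq_derive _ N) derive_cst.
Qed.

Lemma continuous_compact_nice2 (g : R * R -> R) (M : R) : continuous g ->
  (forall z, ~ square M z -> g z = 0) -> nice2 g.
Proof.
move=> cg g0; split; first exact: continuous_measurable2.
have cS : compact (square M).
  by rewrite squareE; apply: compact_setX; exact: segment_compact.
have [C [_ hC]] : bounded_set (g @` square M).
  apply: compact_bounded; apply: continuous_compact => //.
  exact: continuous_subspaceT.
pose D := Num.max (Num.max (`|C| + 1) M) 0; exists D; split => z.
  have [zM|zM] := pselect (square M z); last by rewrite g0// normr0 /D le_max lexx orbT.
  apply: (@le_trans _ _ (`|C| + 1)); last by rewrite /D !le_max lexx.
  by apply: hC; [rewrite (le_lt_trans (ler_norm C))// ltrDl|exists z].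
move=> zD; apply: g0 => zM; apply: zD; apply: square_le zM.
by rewrite /D !le_max lexx orbT.
Qed.

Lemma C1_compact_nice2 phi : C1_compact phi ->
  [/\ nice2 phi, nice2 (dx phi) & nice2 (dt phi)].
Proof.
move=> [c0 c1 c2 _ [M h]].
by split; apply: (@continuous_compact_nice2 _ M) => // z /h[].
Qed.

Lemma is_derive_dx phi (x t : R) : C1_compact phi ->
  is_derive x 1 (fun x => phi (x, t)) (dx phi (x, t)).
Proof.
move=> [_ _ _ /(_ (x, t))[D _] _].
have E : (fun h : R => h^-1 *: (phi (h *: (1, 0) + (x, t)) - phi (x, t))) =
         (fun h : R => h^-1 *: (phi (h *: 1 + x, t) - phi (x, t))).
  by apply/funext => h; congr (_ *: (phi _ - _)); congr pair; rewrite /= scaler0 add0r.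
by apply: DeriveDef; move: D; rewrite /dx /derivable /derive /= E.
Qed.

Lemma is_derive_dt phi (x t : R) : C1_compact phi ->
  is_derive t 1 (fun t => phi (x, t)) (dt phi (x, t)).
Proof.
move=> [_ _ _ /(_ (x, t))[_ D] _].
have E : (fun h : R => h^-1 *: (phi (h *: (0, 1) + (x, t)) - phi (x, t))) =
         (fun h : R => h^-1 *: (phi (x, h *: 1 + t) - phi (x, t))).
  by apply/funext => h; congr (_ *: (phi _ - _)); congr pair; rewrite /= scaler0 add0r.
by apply: DeriveDef; move: D; rewrite /dt /derivable /derive /= E.
Qed.

Definition ray_derivative (c : R) (phi : R * R -> R) (z : R * R) : R :=
  dt phi z + c * dx phi z.

Lemma continuous_sheared (g : R * R -> R) (c : R) : continuous g ->
  continuous (fun z : R * R => g (z.1 + c * z.2, z.2)).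
Proof.
move=> cg z; apply: (@continuous_comp _ _ _ (fun z : R * R => (z.1 + c * z.2, z.2)) g).
  have h : (w.1 + c * w.2 @[w --> z] --> z.1 + c * z.2).
    by apply: cvgD; [exact: cvg_fst|apply: cvgM; [exact: cvg_cst|exact: cvg_snd]].
  exact: (cvg_pair h cvg_snd).
exact: cg.
Qed.

(** Chain rule from continuous partial derivatives: the increment is a horizontal step at time
    [t + h] followed by a vertical one at fixed [x], and the mean value theorem applies to each. *)
Lemma is_derive_ray phi (c y t : R) : C1_compact phi ->
  is_derive t 1 (fun t => phi (y + c * t, t)) (ray_derivative c phi (y + c * t, t)).
Proof.
move=> C; have [_ c1 c2 _ _] := C; set p := (y + c * t, t).
pose F s := phi (y + c * s, s).
suff H : h^-1 *: (F (h *: 1 + t) - F t) @[h --> 0^'] --> ray_derivative c phi p.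
  by apply: DeriveDef; [exact: cvgP H|exact: cvg_lim H].
apply/cvgrPdist_lt => e e0.
have e'0 : 0 < e / (`|c| + 1) / 2 by rewrite !divr_gt0// ltr_wpDl.
have /cvgrPdist_lt/(_ _ e'0)/nbhs_ballP[d1 /= d10 h1] := c1 p.
have /cvgrPdist_lt/(_ _ e'0)/nbhs_ballP[d2 /= d20 h2] := c2 p.
near=> h.
have h0 : h != 0 by near: h; exact: nbhs_dnbhs_neq.
have hd : `|h| * (`|c| + 1) < Num.min d1 d2.
  rewrite -ltr_pdivlMr ?ltr_wpDl//; near: h; apply: dnbhs0_lt.
  by rewrite divr_gt0 ?ltr_wpDl// lt_min d10.
have hh : `|h| <= `|h| * (`|c| + 1) by rewrite ler_peMr// lerDr.
have hc : `|c * h| <= `|h| * (`|c| + 1).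
  by rewrite normrM mulrC ler_wpM2l// lerDl.
have [x1 x1h E1] := @mvt_between R _ _ (y + c * t) (y + c * (h *: 1 + t))
  (fun x => is_derive_dx x (h *: 1 + t) C).
have [t1 t1h E2] := @mvt_between R _ _ t (h *: 1 + t)
  (fun s => is_derive_dt (y + c * t) s C).
have hE : h *: 1 = h :> R by rewrite /GRing.scale /= mulr1.
rewrite hE in x1h E1 t1h E2 *.
have k1 : y + c * (h + t) - (y + c * t) = c * h by ring.
rewrite k1 in x1h E1; rewrite addrK in t1h E2.
have -> : h^-1 *: (F (h + t) - F t) = c * dx phi (x1, h + t) + dt phi (y + c * t, t1).
  have -> : F (h + t) - F t = dx phi (x1, h + t) * (c * h) + dt phi (y + c * t, t1) * h.
    by rewrite -E1 -E2 /F addrA subrK.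
  by rewrite /GRing.scale /=; field.
have b1 : `|dx phi p - dx phi (x1, h + t)| < e / (`|c| + 1) / 2.
  apply: h1; split; rewrite /= /ball /= distrC.
    by rewrite (le_lt_trans x1h)// (le_lt_trans hc)// (lt_le_trans hd)// ge_min lexx.
  by rewrite addrK (le_lt_trans hh)// (lt_le_trans hd)// ge_min lexx.
have b2 : `|dt phi p - dt phi (y + c * t, t1)| < e / (`|c| + 1) / 2.
  apply: h2; split; rewrite /= /ball /= ?subrr ?normr0// distrC.
  by rewrite (le_lt_trans t1h)// (le_lt_trans hh)// (lt_le_trans hd)// ge_min lexx orbT.
have -> : ray_derivative c phi p - (c * dx phi (x1, h + t) + dt phi (y + c * t, t1)) =
   c * (dx phi p - dx phi (x1, h + t)) + (dt phi p - dt phi (y + c * t, t1)).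
  by rewrite /ray_derivative; ring.
apply: (le_lt_trans (ler_normD _ _)); rewrite normrM.
have K : e = (`|c| + 1) * (e / (`|c| + 1) / 2) + (`|c| + 1) * (e / (`|c| + 1) / 2).
  by field; rewrite gt_eqF// ltr_wpDl.
rewrite K; apply: ler_ltD.
  by apply: ler_pM => //; [rewrite lerDl|exact: ltW].
by rewrite (lt_le_trans b2)// ler_peMl ?(ltW e'0)// lerDr.
Unshelve. all: by end_near. Qed.

End test_functions.

(** * Integration along rays *)

Section transport.
Context {R : realType}.
Local Notation plane := (measurableTypeR R * measurableTypeR R)%type.

Lemma leb2_sigma_finite : sigma_finite setT (@leb2 R : set plane -> \bar R).
Proof.
exists (fun n => square n%:R).
  apply/seteqP; split => // z _.
  exists (Num.truncn (`|z.1| + `|z.2|)).+1 => //.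
  have h1 := truncnS_gt (`|z.1| + `|z.2|).
  by split; rewrite (le_trans _ (ltW h1))// ?lerDl ?lerDr.
by move=> n; split; [exact: measurable_square|exact: square_lt_pinfty].
Qed.

HB.instance Definition _ := Measure.on (@leb2 R).
HB.instance Definition _ :=
  Measure_isSigmaFinite.Build _ _ _ (@leb2 R) leb2_sigma_finite.

Local Notation leb := (@lebesgue_measure R).
Local Notation leb2 := (@leb2 R).
Local Notation hv := (@heaviside R).

Lemma ray_derivative_nice2 (c : R) (phi : R * R -> R) : C1_compact phi -> nice2 (ray_derivative c phi).
Proof.
move=> /C1_compact_nice2[_ n1 n2]; apply: nice2_add => //.
by apply: (@nice2_mul _ (cst c)) => //; split; [exact: measurable_cst|exists `|c|].
Qed.

Lemma measurable_fst1 : measurable_fun setT (fst : plane -> R).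
Proof. exact: measurable_fst. Qed.

Lemma measurable_snd1 : measurable_fun setT (snd : plane -> R).
Proof. exact: measurable_snd. Qed.

Lemma measurable_speed (c : R) : measurable_fun setT (fun z : plane => z.1 - c * z.2).
Proof.
apply: measurable_funB; first exact: measurable_fst1.
by apply: measurable_funM => //; exact: measurable_snd1.
Qed.

Lemma bounded_time : bounded_mfun (fun z : plane => hv z.2).
Proof. by apply: measurable_heaviside; exact: measurable_snd1. Qed.

Lemma bounded_comp d d' (T : measurableType d) (T' : measurableType d')
    (w : T' -> R) (g : T -> T') :
  bounded_mfun w -> measurable_fun setT g -> bounded_mfun (fun x => w (g x)).
Proof.
move=> [mw [C wC]] mg; split; first exact: (measurableT_comp mw mg).
by exists C.
Qed.

(** The translation [x = y + c * t], at each fixed [t], straightens the rays. At fixed [y] the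
    weight is then constant in [t] and the other factor is the derivative of [phi] along the ray,
    which integrates to [- phi (y, 0)]. *)
Lemma transport (phi : R * R -> R) (c : R) (h : R -> R) :
  bounded_mfun (h : measurableTypeR R -> R) -> C1_compact phi ->
  \int[leb2]_z (hv z.2 * h (z.1 - c * z.2) * ray_derivative c phi z) =
  - \int[leb]_x (h x * phi (x, 0)).
Proof.
move=> bh C; have nr := ray_derivative_nice2 c C.
have bhz : bounded_mfun (fun z : plane => hv z.2 * h (z.1 - c * z.2)).
  apply: bounded_mul; first exact: bounded_time.
  exact: (bounded_comp bh (measurable_speed c)).
rewrite Rintegral_leb2_tx; last exact: nice2_mul.
pose g (z : R * R) := hv z.2 * h z.1 * ray_derivative c phi (z.1 + c * z.2, z.2).
have ng : nice2 g.
  apply: nice2_mul.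
    apply: bounded_mul; first exact: bounded_time.
    exact: (bounded_comp bh measurable_fst1).
  have [_ c1 c2 _ [M h0]] := C.
  (* The shear enlarges the support in [x] by at most [|c| * M]. *)
  apply: (@continuous_compact_nice2 _ _ (M + `|c| * M)).
    apply: (@continuous_sheared R (ray_derivative c phi) c) => z.
    by apply: cvgD; [exact: c2|apply: cvgM; [exact: cvg_cst|exact: c1]].
  move=> z zM; have [|_ e1 e2] := h0 (z.1 + c * z.2, z.2).
    move=> [/= k1 k2]; apply: zM; split; last first.
      by rewrite (le_trans k2)// lerDl mulr_ge0// (le_trans _ k2).
    rewrite -[z.1](addrK (c * z.2)) (le_trans (ler_normB _ _))// lerD//.
    by rewrite normrM ler_wpM2l.
  by rewrite /ray_derivative e1 e2 mulr0 addr0.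
transitivity (\int[leb]_t (\int[leb]_y g (y, t))).
  apply: eq_Rintegral => t _ /=.
  rewrite (@integral_shift R (c * t)).
    by apply: eq_Rintegral => y _; rewrite /g /= addrK.
  exact: (nice2_section2 (g := fun z => hv z.2 * h (z.1 - c * z.2) * ray_derivative c phi z)
           t (nice2_mul bhz nr)).
rewrite -Rintegral_leb2_tx// Rintegral_leb2_xt//.
have [_ _ _ _ [M h0]] := C.
have rd0 y t : M < `|t| -> phi (y + c * t, t) = 0 /\ ray_derivative c phi (y + c * t, t) = 0.
  move=> Mt; have [|p0 e1 e2] := h0 (y + c * t, t).
    by move=> [_ /=]; rewrite leNgt Mt.
  by rewrite /ray_derivative p0 e1 e2 mulr0 addr0.
have cr : continuous (ray_derivative c phi).
  have [_ c1 c2 _ _] := C.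
  by move=> z; apply: cvgD; [exact: c2|apply: cvgM; [exact: cvg_cst|exact: c1]].
have nphi : nice1 (fun x => phi (x, 0)).
  by have [n0 _ _] := C1_compact_nice2 C; exact: (nice2_section2 0 n0).
transitivity (\int[leb]_y (-1 * (h y * phi (y, 0)))); last first.
  by rewrite RintegralZl ?mulN1r//; exact: (nice1_integrable (nice1_mul bh nphi)).
apply: eq_Rintegral => y _ /=.
transitivity (\int[leb]_t (h y * (hv (t - 0) * ray_derivative c phi (y + c * t, t)))).
  by apply: eq_Rintegral => t _; rewrite /g /= subr0 mulrCA mulrA.
have ny : nice1 (fun t => ray_derivative c phi (y + c * t, t)).
  split.
    have cy : continuous (fun t : R => ray_derivative c phi (y + c * t, t)).
      move=> t; have h1 : (y + c * s @[s --> t] --> y + c * t).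
        by apply: cvgD; [exact: cvg_cst|apply: cvgM; [exact: cvg_cst|exact: cvg_id]].
      by apply: (cvg_comp _ _ (cvg_pair h1 cvg_id)); exact: cr.
    exact: continuous_measurable_fun.
  have [_ [C' [rC _]]] := nr; exists (Num.max M C'); split => t.
    by rewrite (le_trans (rC _))// le_max lexx orbT.
  by rewrite gt_max => /andP[/rd0 -/(_ y)[]].
rewrite RintegralZl//; last first.
  apply: (nice1_integrable (g := fun t => hv (t - 0) * ray_derivative c phi (y + c * t, t))).
  apply: nice1_mul => //; apply: measurable_heaviside; exact: measurable_funB.
have -> : \int[leb]_t (hv (t - 0) * ray_derivative c phi (y + c * t, t)) = - phi (y + c * 0, 0).
  apply: (@integral_derive_right R (fun t => phi (y + c * t, t))
    (fun t => ray_derivative c phi (y + c * t, t)) 0 M).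
  - move=> t; have h1 : (y + c * s @[s --> t] --> y + c * t).
      by apply: cvgD; [exact: cvg_cst|apply: cvgM; [exact: cvg_cst|exact: cvg_id]].
    by apply: (cvg_comp _ _ (cvg_pair h1 cvg_id)); exact: cr.
  - by move=> t; exact: is_derive_ray.
  - by move=> t /rd0 -/(_ y)[].
  - by move=> t /rd0 -/(_ y)[].
by rewrite mulr0 addr0 mulrN mulN1r.
Qed.

Definition hl (y : R) : R := hv (- y).

Lemma bounded_hl : bounded_mfun (hl : measurableTypeR R -> R).
Proof. by apply: measurable_heaviside; exact: measurable_funN. Qed.

(** Integration in [x] at fixed [t] leaves the trace on the ray. Such traces measure the mass that a
    discontinuity fails to transport, and they balance the delta shock. *)
Lemma integral_dx_left (phi : R * R -> R) (c : R) : C1_compact phi ->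
  \int[leb2]_z (hv z.2 * hl (z.1 - c * z.2) * dx phi z) =
  \int[leb]_t (hv t * phi (c * t, t)).
Proof.
move=> C; have [n0 n1 n2] := C1_compact_nice2 C; have [c0 c1 c2 _ [M h0]] := C.
rewrite Rintegral_leb2_tx; last first.
  apply: nice2_mul => //; apply: bounded_mul; first exact: bounded_time.
  exact: (bounded_comp bounded_hl (measurable_speed c)).
apply: eq_Rintegral => t _ /=.
have nx : nice1 (fun x => hv (c * t - x) * dx phi (x, t)).
  apply: nice1_mul; last exact: (nice2_section2 t n1).
  by apply: measurable_heaviside; exact: measurable_funB.
transitivity (\int[leb]_x (hv t * (hv (c * t - x) * dx phi (x, t)))).
  by apply: eq_Rintegral => x _; rewrite /hl opprB mulrA.
rewrite RintegralZl//; last exact: (nice1_integrable nx).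
congr (_ * _); apply: (@integral_derive_left R (fun x => phi (x, t)) (fun x => dx phi (x, t)) (c * t) M).
- move=> x; apply: (cvg_comp _ _ (cvg_pair cvg_id (cvg_cst t))); exact: c1.
- by move=> x; exact: is_derive_dx.
- by move=> x Mx; have [|] := h0 (x, t); first by move=> [/=]; rewrite leNgt Mx.
- by move=> x Mx; have [|] := h0 (x, t); first by move=> [/=]; rewrite leNgt Mx.
Qed.

Lemma integral_dx0 (phi : R * R -> R) : C1_compact phi ->
  \int[leb2]_z (hv z.2 * dx phi z) = 0.
Proof.
move=> C; have [n0 n1 n2] := C1_compact_nice2 C; have [c0 c1 c2 _ [M h0]] := C.
rewrite Rintegral_leb2_tx; last by apply: nice2_mul => //; exact: bounded_time.
transitivity (\int[leb]_(t in setT) (0 : R)); last first.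
  by rewrite /Rintegral integral0.
apply: eq_Rintegral => t _ /=.
(* A cut at [|M| + 1], beyond the support, changes nothing and brings the integral under
   [integral_derive_left]. *)
have nx : nice1 (fun x => hv (`|M| + 1 - x) * dx phi (x, t)).
  apply: nice1_mul; last exact: (nice2_section2 t n1).
  by apply: measurable_heaviside; exact: measurable_funB.
have M1 : M < `| `|M| + 1 |.
  by rewrite ger0_norm ?addr_ge0// (le_lt_trans (ler_norm M))// ltrDl.
transitivity (\int[leb]_x (hv t * (hv (`|M| + 1 - x) * dx phi (x, t)))).
  apply: eq_Rintegral => x _; rewrite /heaviside subr_gt0.
  have [xM|xM] := lt_or_le x (`|M| + 1); first by rewrite xM mul1r.
  have [|_ -> _] := h0 (x, t); last by rewrite !mulr0.
  move=> [/= h _]; move: M1; rewrite ger0_norm ?addr_ge0// ltNge => /negP; apply.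
  by rewrite (le_trans xM)// (le_trans (ler_norm x)).
rewrite RintegralZl//; last exact: (nice1_integrable nx).
suff -> : \int[leb]_x (hv (`|M| + 1 - x) * dx phi (x, t)) = phi (`|M| + 1, t).
  have [|-> _ _] := h0 (`|M| + 1, t); last by rewrite mulr0.
  by move=> [/=]; rewrite leNgt M1.
apply: (@integral_derive_left R (fun x => phi (x, t)) (fun x => dx phi (x, t)) (`|M| + 1) M).
- move=> x; apply: (cvg_comp _ _ (cvg_pair cvg_id (cvg_cst t))); exact: c1.
- by move=> x; exact: is_derive_dx.
- by move=> x Mx; have [|] := h0 (x, t); first by move=> [/=]; rewrite leNgt Mx.
- by move=> x Mx; have [|] := h0 (x, t); first by move=> [/=]; rewrite leNgt Mx.
Qed.

(* Integration by parts against [t]: the delta shock carries a mass growing like [t]. *)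
Lemma integral_ray (phi : R * R -> R) (c : R) : C1_compact phi ->
  \int[leb]_t (hv t * (t * ray_derivative c phi (c * t, t))) =
  - \int[leb]_t (hv t * phi (c * t, t)).
Proof.
move=> C; have [c0 c1 c2 _ [M h0]] := C.
have z0 (t : R) : M < `|t| -> phi (c * t, t) = 0 /\ ray_derivative c phi (c * t, t) = 0.
  move=> Mt; have [|p0 e1 e2] := h0 (c * t, t); first by move=> [_ /=]; rewrite leNgt Mt.
  by rewrite /ray_derivative p0 e1 e2 mulr0 addr0.
have cray (g : R * R -> R) : continuous g -> continuous (fun t : R => g (c * t, t)).
  move=> cg t; have h1 : (c * s @[s --> t] --> c * t).
    by apply: cvgM; [exact: cvg_cst|exact: cvg_id].
  by apply: (cvg_comp _ _ (cvg_pair h1 cvg_id)); exact: cg.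
have crd : continuous (ray_derivative c phi).
  by move=> z; apply: cvgD; [exact: c2|apply: cvgM; [exact: cvg_cst|exact: c1]].
have Dray (t : R) : is_derive t 1 (fun t => phi (c * t, t)) (ray_derivative c phi (c * t, t)).
  have := @is_derive_ray R phi c 0 t C; rewrite add0r; congr (is_derive _ _ _ _).
  by apply/funext => s; rewrite add0r.
have nr (g : R -> R) : continuous g -> (forall t, M < `|t| -> g t = 0) -> nice1 g.
  move=> cg g0; split; first exact: continuous_measurable_fun.
  have [D [_ hD]] : bounded_set (g @` `[- `|M|, `|M|]).
    apply: compact_bounded; apply: continuous_compact; last exact: segment_compact.
    exact: continuous_subspaceT.
  exists (Num.max (`|D| + 1) M); split => t; last first.
    by rewrite gt_max => /andP[_ /g0].
  have [tM|tM] := lt_or_le M `|t|.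
    by rewrite g0// normr0 le_max addr_ge0.
  rewrite le_max; apply/orP; left; apply: hD.
    by rewrite (le_lt_trans (ler_norm D))// ltrDl.
  by exists t => //=; rewrite in_itv /= -ler_norml (le_trans tM)// ler_norm.
have n1 : nice1 (fun t => hv t * (t * ray_derivative c phi (c * t, t))).
  apply: nice1_mul; first by apply: measurable_heaviside.
  apply: nr; last by move=> t /z0[_ ->]; rewrite mulr0.
  by move=> t; apply: cvgM; [exact: cvg_id|exact: (cray _ crd)].
have n2 : nice1 (fun t => hv t * phi (c * t, t)).
  apply: nice1_mul; first by apply: measurable_heaviside.
  apply: nr; last by move=> t /z0[-> _].
  exact: cray.
apply/eqP; rewrite -subr_eq0 opprK -RintegralD//; last 2 first.
- exact: nice1_integrable n1.
- exact: nice1_integrable n2.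
apply/eqP; transitivity (\int[leb]_t (hv (t - 0) *
    (t * ray_derivative c phi (c * t, t) + phi (c * t, t)))).
  by apply: eq_Rintegral => t _ /=; rewrite subr0 -mulrDr.
rewrite -[RHS]oppr0 -[in RHS](mul0r (phi (c * 0, 0))).
apply: (@integral_derive_right R (fun t => t * phi (c * t, t))
  (fun t => t * ray_derivative c phi (c * t, t) + phi (c * t, t)) 0 M).
- move=> t; apply: cvgD; last exact: cray.
  by apply: cvgM; [exact: cvg_id|exact: (cray _ crd)].
- move=> t; have := is_deriveM (is_derive_id t (1 : R)) (Dray t) => h.
  apply: (@is_derive_eq _ _ _ _ _ _ _ _ h).
  by rewrite /GRing.scale /= mulr1.
- by move=> t /z0[-> _]; rewrite mulr0.
- by move=> t /z0[-> ->]; rewrite mulr0 addr0.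
Qed.

End transport.

Section null_lines.
Context {R : realType}.
Local Notation plane := (measurableTypeR R * measurableTypeR R)%type.
Local Notation leb := (@lebesgue_measure R).
Local Notation leb2 := (@leb2 R).
Local Notation hv := (@heaviside R).

Definition line (c : R) : set (R * R) := [set z | z.1 = c * z.2].

Lemma measurable_line c : measurable (line c : set plane).
Proof.
have -> : line c = setT `&` (fun z : plane => z.1 - c * z.2) @^-1` [set 0].
  apply/seteqP; split => z /=; rewrite /line /=; first by move=> ->; rewrite subrr.
  by move=> [_ /eqP]; rewrite subr_eq0 => /eqP.
exact: measurable_speed.
Qed.

Lemma line_negligible c : leb2.-negligible (line c).
Proof.
exists (line c); split => //; first exact: measurable_line.
have mi : measurable_fun setT (fun z : plane => (\1_(line c) z)%:E : \bar R).
  by apply/measurable_EFinP; apply: measurable_indic; exact: measurable_line.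
rewrite -[line c]setIT -integral_indic//; last exact: measurable_line.
rewrite /Defs.leb2 fubini_tonelli2//.
apply: integral0_eq => t _; rewrite /fubini_G /=.
transitivity (\int[leb]_(x in setT) (\1_([set c * t] : set R) x)%:E)%E.
  apply: eq_integral => x _; congr (EFin _%:R); apply/idP/idP => /[!inE] //.
by rewrite integral_indic// setIT; exact: lebesgue_measure_set1.
Qed.

Lemma axis_negligible : leb2.-negligible [set z : R * R | z.2 = 0].
Proof.
exists (setT `*` [set 0]); split; last by move=> [x t] /= ->.
  exact: measurableX.
by rewrite /Defs.leb2 product_measure1E// [X in (_ * X)%E]lebesgue_measure_set1 mule0.
Qed.

(** The rays and the axis [t = 0] are null; pointwise identities between weights fail there, since
    the values on a discontinuity follow different conventions. *)
Lemma Rintegral_off_lines (a b : R) (F G : R * R -> R) :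
  measurable_fun setT (F : plane -> R) -> measurable_fun setT (G : plane -> R) ->
  (forall z, z.2 != 0 -> z.1 != a * z.2 -> z.1 != b * z.2 -> F z = G z) ->
  \int[leb2]_z F z = \int[leb2]_z G z.
Proof.
move=> mF mG FG; congr fine; apply: ae_eq_integral => //; [exact/measurable_EFinP|exact/measurable_EFinP|].
have := negligibleU axis_negligible (negligibleU (line_negligible a) (line_negligible b)).
apply: negligibleS => z /= nz; apply: contrapT => h; apply: nz => _; congr EFin.
by apply: FG; apply/eqP => e; apply: h; [left|right; left|right; right].
Qed.

Lemma integral_half_plane (F : R * R -> R) :
  measurable_fun (@closed_half_plane R : set plane) (F : plane -> R) ->
  (\int[leb2]_(z in @closed_half_plane R) (F z)%:E =
   \int[leb2]_z (hv z.2 * F z)%:E)%E.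
Proof.
have [mc mo] := @measurable_half_plane R; move=> mF; rewrite integral_mkcond.
have mFc : measurable_fun setT (F \_ (@closed_half_plane R) : plane -> R).
  exact/(measurable_restrictT _ mc).
transitivity (\int[leb2]_z ((F \_ (@closed_half_plane R)) z)%:E)%E.
  by apply: eq_integral => z _; rewrite [RHS]/= -[RHS]/((EFin \o _) z) -restrict_EFin.
apply: ae_eq_integral => //.
- exact/measurable_EFinP.
- apply/measurable_EFinP.
  have -> : (fun z => hv z.2 * F z) = (fun z => hv z.2 * (F \_ (@closed_half_plane R)) z).
    apply/funext => z; rewrite patchE /heaviside; case: ifPn; last by rewrite !mul0r.
    by move=> z0; rewrite mem_set//; exact: ltW.
  by apply: measurable_funM => //; have [] := @bounded_time R.
have := axis_negligible; apply: negligibleS => z /= nz; apply: contrapT => h; apply: nz => _.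
congr EFin; rewrite patchE /heaviside; have [z0|z0] := lt_or_le 0 z.2.
  by rewrite z0 mul1r mem_set//; exact: ltW.
rewrite (le_gtF z0) mul0r memNset// /closed_half_plane /= => z0'; apply: h.
by apply: le_anti; rewrite z0.
Qed.

Lemma integral_open_half_plane (F : R * R -> R) :
  (\int[leb2]_(z in @open_half_plane R) (F z)%:E =
   \int[leb2]_z (hv z.2 * F z)%:E)%E.
Proof.
rewrite integral_mkcond; apply: eq_integral => z _; rewrite patchE /heaviside.
case: ifPn => [|]; first by rewrite inE /open_half_plane /= => ->; rewrite mul1r.
by rewrite notin_setE /open_half_plane /= => /negP/negbTE ->; rewrite mul0r.
Qed.

End null_lines.

(** * Measures with a density carried by a map *)

Section density.
Context {R : realType}.
Local Notation plane := (measurableTypeR R * measurableTypeR R)%type.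
Local Notation leb := (@lebesgue_measure R).

Let cut (w s : R) := (0 <= s) && (s < w).

Lemma integral_cut (w k : R) : 0 <= w ->
  (\int[leb]_s (if cut w s then k else 0)%:E = (w * k)%:E)%E.
Proof.
move=> w0; transitivity (\int[leb]_(s in `[0%R, w[) (cst k%:E s))%E.
  rewrite [in RHS]integral_mkcond; apply: eq_integral => s _.
  by rewrite patchE mem_setE in_itv /= /cut; case: ifP.
rewrite integral_cst// [X in (_ * X)%E]lebesgue_measure_itv /= lte_fin.
case: ifPn => [_|]; first by rewrite oppr0 adde0 -EFinM mulrC.
by rewrite -leNgt => w0'; rewrite (le_anti _ : w = 0) ?mul0r ?mule0// w0' w0.
Qed.

(* The measure [w . mu] carried along [g] is the image of [mu \x leb] restricted to
   the region under the graph of [w]; the points that are cut off are sent to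
   [(0, -1)], outside of the half plane. *)
Lemma density_measure d (T : measurableType d)
    (mu : {sigma_finite_measure set T -> \bar R}) (g : T -> plane) (w : T -> R) :
  measurable_fun setT g -> measurable_fun setT w -> (forall x, 0 <= w x) ->
  exists nu : {measure set plane -> \bar R},
  forall (D : set plane) (f : plane -> R), measurable D -> D `<=` @closed_half_plane R ->
    (forall x, 0 < w x -> D (g x)) -> measurable_fun D f ->
    mu.-integrable setT (fun x => (w x * f (g x))%:E) ->
    nu.-integrable D (EFin \o f) /\
    (\int[nu]_(z in D) (f z)%:E = \int[mu]_x (w x * f (g x))%:E)%E.
Proof.
move=> mg mw w0.
pose G (p : T * measurableTypeR R) : plane := if cut (w p.1) p.2 then g p.1 else (0, -1).
have mw1 : measurable_fun setT (fun p : T * measurableTypeR R => w p.1).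
  exact: (measurableT_comp mw measurable_fst).
have mG : measurable_fun setT G.
  apply: measurable_fun_ifT => //; last exact: (measurableT_comp mg measurable_fst).
  apply: measurable_and.
    by apply: measurable_fun_ler => //; exact: measurable_snd.
  by apply: measurable_fun_ltr => //; exact: measurable_snd.
have [nu nuE] := pushforward_measureP (mu \x leb)%E mG.
exists nu => D f mD Dc wD mf intf.
pose fD := f \_ D.
have mfD : measurable_fun setT fD by exact/(measurable_restrictT _ mD).
(* A point kept by the cut has positive weight, so its image lies in [D]; a point cut off goes to
   [(0, -1)], which is not in [D]. *)
have fG p : fD (G p) = if cut (w p.1) p.2 then f (g p.1) else 0.
  rewrite /fD /G patchE; case: ifPn; rewrite ?inE ?notin_setE; case: ifPn => //.
    by move=> _ /Dc; rewrite /closed_half_plane /= oppr_ge0 ler10.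
  by move=> /andP[s0 sw]; case; apply: wD; exact: le_lt_trans sw.
have mh : measurable_fun setT (EFin \o (fD \o G)).
  by apply/measurable_EFinP; exact: measurableT_comp.
have ih : (mu \x leb)%E.-integrable setT (EFin \o (fD \o G)).
  apply/(integrable12ltyP _ _ mh); have /integrableP[_] := intf; apply: le_lt_trans.
  apply: ge0_le_integral => //.
  - by move=> x _; exact: integral_ge0.
  - apply: (measurable_fun_fubini_tonelli_F (fun p => `|(fD (G p))%:E|%E)) => //.
    exact: measurableT_comp.
  - apply: measurableT_comp => //; by have /integrableP[] := intf.
  move=> x _; rewrite le_eqVlt; apply/orP; left; apply/eqP.
  transitivity (\int[leb]_s (if cut (w x) s then `|f (g x)| else 0)%:E)%E.
    apply: eq_integral => s _ /=; rewrite fG /=; case: ifP => _ //.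
    by rewrite normr0.
  by rewrite integral_cut//= normrM (ger0_norm (w0 x)).
have E : (\int[nu]_(z in D) (f z)%:E = \int[mu]_x (w x * f (g x))%:E)%E.
  rewrite integral_mkcond.
  transitivity (\int[nu]_z (fD z)%:E)%E.
    by apply: eq_integral => z _; rewrite [RHS]/= -[RHS]/((EFin \o _) z) -restrict_EFin.
  rewrite nuE integral_pushforward//=; last exact/measurable_EFinP.
  rewrite preimage_setT -integral12_prod_meas1//; apply: eq_integral => x _.
  rewrite /fubini_F /= -integral_cut//; apply: eq_integral => s _.
  by rewrite fG.
split => //; rewrite integrable_mkcond// restrict_EFin nuE.
by apply: integrable_pushforward => //; exact/measurable_EFinP.
Qed.

End density.

(** * Centered rarefactions as averages over speeds *)

Section fan_identity.
Context {R : realType}.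
Local Notation plane := (measurableTypeR R * measurableTypeR R)%type.
Local Notation leb := (@lebesgue_measure R).
Local Notation leb2 := (@leb2 R).
Local Notation hv := (@heaviside R).
Local Notation hl := (@hl R).

Lemma nice2_scale (k : R) (F : R * R -> R) : nice2 F -> nice2 (fun z => k * F z).
Proof. by apply: (@nice2_mul _ (cst k)); split; [exact: measurable_cst|exists `|k|]. Qed.

Lemma nice1_scale (k : R) (F : R -> R) : nice1 F -> nice1 (fun z => k * F z).
Proof. by apply: (@nice1_mul _ (cst k)); split; [exact: measurable_cst|exists `|k|]. Qed.

Lemma integral_nice2D (F G : R * R -> R) : nice2 F -> nice2 G ->
  \int[leb2]_z (F z + G z) = \int[leb2]_z F z + \int[leb2]_z G z.
Proof. by move=> nF nG; rewrite RintegralD//; exact: nice2_integrable. Qed.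

Lemma integral_nice2Z (k : R) (F : R * R -> R) : nice2 F ->
  \int[leb2]_z (k * F z) = k * \int[leb2]_z F z.
Proof. by move=> nF; rewrite RintegralZl//; exact: nice2_integrable. Qed.

Lemma integral_nice1D (F G : R -> R) : nice1 F -> nice1 G ->
  \int[leb]_z (F z + G z) = \int[leb]_z F z + \int[leb]_z G z.
Proof. by move=> nF nG; rewrite RintegralD//; exact: nice1_integrable. Qed.

Lemma integral_nice1Z (k : R) (F : R -> R) : nice1 F ->
  \int[leb]_z (k * F z) = k * \int[leb]_z F z.
Proof. by move=> nF; rewrite RintegralZl//; exact: nice1_integrable. Qed.

(** With [p] and [q] the two partial derivatives of [phi], averaging [dt phi + c * dx phi] over the
    speeds is what produces the quadratic flux. *)
Lemma integral_affine (m b p q : R) : m <= b ->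
  \int[leb]_c (hv (c - m) * hv (b - c) * (p + c * q)) =
  (b - m) * p + (b ^+ 2 - m ^+ 2) / 2 * q.
Proof.
rewrite le_eqVlt => /orP[/eqP <-|mb].
  rewrite !subrr !mul0r addr0; transitivity (\int[leb]_(c in setT) (0 : R)); last first.
    by rewrite /Rintegral integral0.
  apply: eq_Rintegral => c _; rewrite /heaviside !subr_gt0.
  by have [h|h] := lt_or_le m c; [rewrite h (lt_gtF h) mulr0 mul0r|rewrite (le_gtF h) !mul0r].
have D (c : R) : is_derive c 1 (fun c : R => c * p + c * c * (q / 2)) (p + c * q).
  have h1 := is_deriveM (is_derive_id c (1 : R)) (is_derive_id c (1 : R)).
  have h2 := is_deriveM h1 (is_derive_cst (q / 2 : R) c (1 : R)).
  have h3 := is_deriveM (is_derive_id c (1 : R)) (is_derive_cst (p : R) c (1 : R)).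
  apply: (@is_derive_eq _ _ _ _ _ _ _ _ (is_deriveD h3 h2)).
  by rewrite /GRing.scale /=; field.
have cd : continuous (fun c : R => p + c * q).
  move=> c; apply: cvgD; first exact: cvg_cst.
  by apply: cvgM; [exact: cvg_id|exact: cvg_cst].
have E : (\int[leb]_(c in `[m, b]) (p + c * q)%:E =
    (b * p + b * b * (q / 2))%:E - (m * p + m * m * (q / 2))%:E)%E.
  apply: (@continuous_FTC2 R (fun c => p + c * q) (fun c => c * p + c * c * (q / 2))) => //.
  - exact: continuous_subspaceT.
  - by apply: derivable_LRcontinuous => x; case: (D x).
  - by move=> x _; rewrite derive1E; case: (D x) => _ ->.
transitivity (fine (\int[leb]_(c in `]m, b[) (p + c * q)%:E)%E).
  rewrite /Rintegral [in RHS]integral_mkcond; congr fine; apply: eq_integral => c _.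
  rewrite patchE mem_setE in_itv /= /heaviside !subr_gt0.
  by case: (m < c); case: (c < b); rewrite ?mul0r ?mulr0 ?mul0r ?mulr1 ?mul1r.
have mc : measurable_fun setT (fun c : R => (p + c * q)%:E : \bar R).
  by apply/measurable_EFinP; exact: continuous_measurable_fun.
rewrite integral_itv_bndo_bndc; last exact: measurable_funTS.
rewrite integral_itv_obnd_cbnd; last exact: measurable_funTS.
by rewrite E /=; field.
Qed.

(** One formula for both cases. If [a = b], then for positive time the last branch is the ray itself
    and its value is the speed [a]: this is the velocity seen by the mass concentrated there. *)
Definition limit_u (a b ul ur : R) (z : R * R) : R :=
  if z.1 < a * z.2 then ul else if b * z.2 < z.1 then ur else z.1 / z.2.

Lemma measurable_ratio : measurable_fun setT (fun z : plane => z.1 / z.2 : R).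
Proof.
have mV : measurable_fun setT (fun t : measurableTypeR R => t^-1 : R).
  rewrite -(setvU [set 0 : R]); apply/measurable_funU => //; first exact: measurableC.
  split; last exact: measurable_fun_set1.
  apply: open_continuous_measurable_fun.
    by apply: closed_openC; exact: closed_eq.
  by move=> x; rewrite inE /= => /eqP x0; exact: inv_continuous.
apply: measurable_funM; first exact: measurable_fst1.
exact: (measurableT_comp mV measurable_snd).
Qed.

Lemma bounded_limit_u (a b ul ur : R) : a <= b ->
  bounded_mfun (limit_u a b ul ur : plane -> R).
Proof.
move=> ab; split.
  apply: measurable_fun_ifT.
  - apply: measurable_fun_ltr; first exact: measurable_fst1.
    by apply: measurable_funM => //; exact: measurable_snd1.
  - exact: measurable_cst.
  - apply: measurable_fun_ifT; last exact: measurable_ratio.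
      apply: measurable_fun_ltr; last exact: measurable_fst1.
      by apply: measurable_funM => //; exact: measurable_snd1.
    exact: measurable_cst.
exists (`|ul| + `|ur| + (`|a| + `|b|)) => z; rewrite /limit_u.
case: ifPn => [_|]; last rewrite -leNgt => az.
  by rewrite -addrA lerDl !addr_ge0.
case: ifPn => [_|]; last rewrite -leNgt => bz.
  by rewrite -addrA addrCA lerDl !addr_ge0.
rewrite (@le_trans _ _ (`|a| + `|b|)) ?lerDr ?addr_ge0//.
have ha : - (`|a| + `|b|) <= a.
  by rewrite lerNl (le_trans (ler_norm (- a)))// normrN lerDl.
have hb : b <= `|a| + `|b| by rewrite (le_trans (ler_norm b))// lerDr.
have [t0|t0] := lt_or_le 0 z.2.
  by rewrite ler_norml ler_pdivlMr// ler_pdivrMr// (le_trans _ az) ?(le_trans bz)// ler_pM2r.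
move: t0; rewrite le_eqVlt => /orP[/eqP ->|t0].
  by rewrite invr0 mulr0 normr0 addr_ge0.
have ha' : a <= `|a| + `|b| by rewrite (le_trans (ler_norm a))// lerDl.
have hb' : - (`|a| + `|b|) <= b.
  by rewrite lerNl (le_trans (ler_norm (- b)))// normrN lerDr.
by rewrite ler_norml ler_ndivlMr// ler_ndivrMr// (le_trans bz) ?(le_trans _ az)// ler_nM2r.
Qed.

(** At a fixed point, the speeds [c] between [a] and [b] whose ray lies to the right of it are those
    above [x / t] clamped from below by [a] and from above by [b]. *)
Lemma fan_parametrization (a b x t : R) : a <= b -> 0 < t -> exists2 m : R,
  limit_u a b a b (x, t) = m /\ m <= b &
  forall c, hv (c - a) * hv (b - c) * hl (x - c * t) = hv (c - m) * hv (b - c).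
Proof.
move=> ab t0; exists (limit_u a b a b (x, t)); first split => //.
  rewrite /limit_u /=; case: ifPn => // _.
  by case: ifPn => //; rewrite -leNgt ler_pdivrMr.
move=> c; rewrite /limit_u /hl /heaviside /= opprB !subr_gt0.
have [xa|xa] := lt_or_le x (a * t).
  rewrite xa; have [ac|ac] := lt_or_le a c; last by rewrite (le_gtF ac) !mul0r.
  by rewrite ac (lt_trans xa) ?mulr1// ltr_pM2r.
rewrite (le_gtF xa); have [bx|bx] := lt_or_le (b * t) x.
  rewrite bx; have [bc|bc] := lt_or_le c b; last by rewrite (le_gtF bc) mulr0 mul0r mulr0.
  rewrite (lt_gtF bc) mul0r (@lt_gtF _ _ (c * t) x) ?mulr0//.
  by rewrite (lt_trans _ bx)// ltr_pM2r.
rewrite (le_gtF bx) -ltr_pdivrMr//; have [xc|xc] := lt_or_le (x / t) c.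
  by rewrite xc mulr1 (_ : a < c)// (le_lt_trans _ xc)// ler_pdivlMr.
by rewrite (le_gtF xc) mulr0 mul0r.
Qed.

Lemma nice_affine (m b p q : R) :
  nice1 (fun c => hv (c - m) * hv (b - c) * (p + c * q)).
Proof.
have hv1 := @heaviside_le1 R.
split.
  apply: measurable_funM; last by apply: measurable_funD => //; exact: measurable_funM.
  by apply: measurable_funM; apply: (measurable_heaviside _).1; exact: measurable_funB.
pose K := `|m| + `|b|.
exists (Num.max (`|p| + K * `|q|) K).
have K0 : 0 <= K by rewrite addr_ge0.
have Z c : ~ (m < c < b) -> hv (c - m) * hv (b - c) * (p + c * q) = 0.
  have [ac|ac] := lt_or_le m c; last by rewrite {1}/heaviside subr_gt0 (le_gtF ac) !mul0r.
  have [cb|cb] := lt_or_le c b; first by rewrite ac.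
  by rewrite [hv (b - c)]/heaviside subr_gt0 (le_gtF cb) mulr0 mul0r.
have hc c : m < c < b -> `|c| <= K.
  move=> /andP[ac cb].
  rewrite ler_norml (le_trans _ (ltW ac)) ?(le_trans (ltW cb)) ?(le_trans (ler_norm b)) ?lerDr//.
  by rewrite lerNl (le_trans (ler_norm (- m)))// normrN lerDl.
split => c.
  have [/hc cK|/Z ->] := pselect (m < c < b); last first.
    by rewrite normr0 le_max addr_ge0// mulr_ge0.
  rewrite le_max; apply/orP; left; rewrite normrM -[leRHS]mul1r ler_pM//.
    by rewrite normrM -[leRHS]mulr1 ler_pM.
  by rewrite (le_trans (ler_normD _ _))// lerD// normrM ler_pM.
rewrite gt_max => /andP[_ h]; apply: Z => /hc; rewrite leNgt h //.
Qed.

Lemma fan_identity (a b : R) (phi : R * R -> R) : a <= b -> C1_compact phi ->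
  \int[leb2]_z (hv z.2 * ((b - limit_u a b a b z) * dt phi z
                  + (b ^+ 2 - limit_u a b a b z ^+ 2) / 2 * dx phi z)) =
  - ((b - a) * \int[leb]_x (hl x * phi (x, 0))).
Proof.
move=> ab C; have [n0 n1 n2] := C1_compact_nice2 C.
pose H (p : R * (R * R)) := hv (p.1 - a) * hv (b - p.1) *
  (hv p.2.2 * hl (p.2.1 - p.1 * p.2.2) * ray_derivative p.1 phi p.2).
have mc : measurable_fun setT (fun p : measurableTypeR R * plane => p.1 : R).
  exact: measurable_fst.
have mx : measurable_fun setT (fun p : measurableTypeR R * plane => p.2.1 : R).
  exact: (measurableT_comp (@measurable_fst1 R) measurable_snd).
have mt : measurable_fun setT (fun p : measurableTypeR R * plane => p.2.2 : R).
  exact: (measurableT_comp (@measurable_snd1 R) measurable_snd).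
have mH : measurable_fun setT (H : measurableTypeR R * plane -> R).
  apply: measurable_funM.
    by apply: measurable_funM; apply: (measurable_heaviside _).1; exact: measurable_funB.
  apply: measurable_funM.
    apply: measurable_funM; apply: (measurable_heaviside _).1 => //.
    by apply: measurable_funN; apply: measurable_funB => //; exact: measurable_funM.
  apply: measurable_funD; first exact: (measurableT_comp n2.1 measurable_snd).
  by apply: measurable_funM => //; exact: (measurableT_comp n1.1 measurable_snd).
have hv1 := @heaviside_le1 R.
(* The two orders of integration over speeds and plane are compared; [H] is bounded and lives on
   [[a, b]] times a square. *)
have iH : (leb \x leb2)%E.-integrable setT (EFin \o H).
  have [_ [M1 [b1 s1]]] := n1; have [_ [M2 [b2 s2]]] := n2.
  pose M := Num.max M1 M2; pose K := `|a| + `|b|.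
  have M10 : 0 <= M1 by exact: le_trans (b1 point).
  have fin : ((leb \x leb2)%E (`[a, b]%classic `*` square M) < +oo)%E.
    rewrite product_measure1E//; last exact: measurable_square.
    apply: lte_mul_pinfty => //; last exact: square_lt_pinfty.
    by rewrite [X in X \is a _]lebesgue_measure_itv /=; case: ifP.
  apply: (@integrable_bounded_support _ (measurableTypeR R * plane)%type R (leb \x leb2)%E H
    (`[a, b]%classic `*` square M) (M2 + K * M1)) => //.
  - by apply: measurableX => //; exact: measurable_square.
  - move=> [c z]; rewrite /H /=.
    have [ac|ac] := lt_or_le a c; last first.
      rewrite {1}/heaviside subr_gt0 (le_gtF ac) !mul0r normr0 addr_ge0//; first exact: le_trans (b2 point).
      by rewrite mulr_ge0// addr_ge0.
    have [cb|cb] := lt_or_le c b; last first.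
      rewrite [hv (b - c)]/heaviside subr_gt0 (le_gtF cb) mulr0 mul0r normr0 addr_ge0//; first exact: le_trans (b2 point).
      by rewrite mulr_ge0// addr_ge0.
    have hc : `|c| <= K.
      rewrite ler_norml (le_trans _ (ltW ac)) ?(le_trans (ltW cb)) ?(le_trans (ler_norm b)) ?lerDr//.
      by rewrite lerNl (le_trans (ler_norm (- a)))// normrN lerDl.
    have hr : `|ray_derivative c phi z| <= M2 + K * M1.
      by rewrite (le_trans (ler_normD _ _))// lerD// normrM ler_pM.
    have p1 (x y : R) : `|x| <= 1 -> `|y| <= 1 -> `|x * y| <= 1.
      by move=> h1 h2; rewrite normrM -[leRHS]mulr1 ler_pM.
    rewrite normrM -[leRHS]mul1r ler_pM//; first exact: p1.
    by rewrite normrM -[leRHS]mul1r ler_pM//; apply: p1 => //; exact: hv1.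
  - move=> [c z] h; rewrite /H /=.
    have [ac|ac] := lt_or_le a c; last by rewrite {1}/heaviside subr_gt0 (le_gtF ac) !mul0r.
    have [cb|cb] := lt_or_le c b; last first.
      by rewrite [hv (b - c)]/heaviside subr_gt0 (le_gtF cb) mulr0 mul0r.
    have zM : ~ square M z by move=> zM; apply: h; split => //=; rewrite in_itv /= !ltW.
    rewrite /ray_derivative s1 ?s2 ?mulr0 ?addr0 ?mulr0//.
      by move=> k; apply: zM; apply: square_le k; rewrite le_max lexx orbT.
    by move=> k; apply: zM; apply: square_le k; rewrite le_max lexx.
have nh (c : R) : nice2 (fun z => hv z.2 * hl (z.1 - c * z.2) * ray_derivative c phi z).
  apply: nice2_mul; last exact: ray_derivative_nice2.
  apply: bounded_mul; first exact: bounded_time.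
  exact: (bounded_comp (@bounded_hl R) (measurable_speed c)).
(* For each speed the plane integral is [transport], whose value does not depend on [c]; the factor
   [b - a] is the length of the interval of speeds. *)
have L : (\int[leb \x leb2]_p (H p)%:E =
    (- ((b - a) * \int[leb]_x (hl x * phi (x, 0))))%:E)%E.
  rewrite -(integral12_prod_meas1 iH) /fubini_F /=.
  transitivity (\int[leb]_c (hv (c - a) * hv (b - c) *
      ((- \int[leb]_x (hl x * phi (x, 0))) + c * 0))%:E)%E.
    apply: eq_integral => c _; rewrite mulr0 addr0 -(transport c (@bounded_hl R) C).
    rewrite -integral_nice2Z// -integral_nice2//.
    exact: nice2_scale.
  rewrite integral_nice1 ?integral_affine//.
    by rewrite mulr0 addr0 mulrN.
  exact: nice_affine.
(* In the other order the speed is integrated first, at a fixed point of the plane, by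
   [fan_parametrization] and [integral_affine]. *)
apply: EFin_inj; rewrite -L -(integral21_prod_meas1 iH) /fubini_G /=.
have bU := @bounded_limit_u a b a b ab.
have sq : bounded_mfun (fun z : plane => limit_u a b a b z ^+ 2) by exact: bounded_mul.
rewrite -integral_nice2; last first.
  apply: nice2_mul; first exact: bounded_time.
  apply: nice2_add; apply: nice2_mul => //.
    exact: (bounded_sub (bounded_mfun_cst _ b) bU).
  apply: bounded_mul; last exact: bounded_mfun_cst.
  exact: (bounded_sub (bounded_mfun_cst _ (b ^+ 2)) sq).
apply: eq_integral => -[x t] _; rewrite /H /=.
have [t0|t0] := lt_or_le 0 t; last first.
  have -> : hv t = 0 by rewrite /heaviside (le_gtF t0).
  rewrite !mul0r; transitivity (\int[leb]_(x in setT) (cst 0%E x))%E; first by rewrite integral0.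
  by apply: eq_integral => c _; rewrite !mul0r mulr0.
have [m [-> mb] Hm] := fan_parametrization x ab t0.
have -> : hv t = 1 by rewrite /heaviside t0.
rewrite mul1r -integral_affine// -integral_nice1; last exact: nice_affine.
apply: eq_integral => c _; congr EFin; rewrite -Hm /ray_derivative mul1r.
by rewrite mulrA.
Qed.

End fan_identity.

(** * The limit system *)

Section limit_system.
Context {R : realType}.
Local Notation plane := (measurableTypeR R * measurableTypeR R)%type.
Local Notation leb := (@lebesgue_measure R).
Local Notation leb2 := (@leb2 R).
Local Notation hv := (@heaviside R).
Local Notation hl := (@hl R).

Lemma hl01 (y : R) : hl y = if y < 0 then 1 else 0.
Proof. by rewrite /hl /heaviside oppr_gt0. Qed.

Lemma riemann_dataE (l r x : R) : riemann_data l r x = r + (l - r) * hl x.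
Proof. by rewrite /riemann_data hl01; case: ifP => _; ring. Qed.

Lemma nice_initial (phi : R * R -> R) : C1_compact phi -> nice1 (fun x => phi (x, 0)).
Proof. by move=> /C1_compact_nice2[n0 _ _]; exact: (nice2_section2 0 n0). Qed.

Lemma integral_riemann (l r : R) (phi : R * R -> R) : C1_compact phi ->
  (\int[leb]_x (riemann_data l r x * phi (x, 0))%:E =
   (r * \int[leb]_x phi (x, 0) + (l - r) * \int[leb]_x (hl x * phi (x, 0)))%:E)%E.
Proof.
move=> /nice_initial n0; have nl := nice1_mul (@bounded_hl R) n0.
rewrite -!integral_nice1Z// -integral_nice1D//; [|exact: nice1_scale|exact: nice1_scale].
rewrite -integral_nice1; last by apply: nice1_add; exact: nice1_scale.
by apply: eq_integral => x _; rewrite riemann_dataE mulrDl mulrA.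
Qed.

Lemma transport1 (phi : R * R -> R) (c : R) : C1_compact phi ->
  \int[leb2]_z (hv z.2 * ray_derivative c phi z) = - \int[leb]_x phi (x, 0).
Proof.
move=> C; transitivity (- \int[leb]_x (cst 1 x * phi (x, 0))); last first.
  by congr (- _); apply: eq_Rintegral => x _; rewrite mul1r.
rewrite -(@transport _ phi c (cst 1))//; last exact: (bounded_mfun_cst _ (1 : R)).
by apply: eq_Rintegral => z _; rewrite mulr1.
Qed.

Lemma nice_left (c : R) (F : R * R -> R) : nice2 F ->
  nice2 (fun z => hv z.2 * hl (z.1 - c * z.2) * F z).
Proof.
apply: nice2_mul; apply: bounded_mul; first exact: bounded_time.
exact: (bounded_comp (@bounded_hl R) (measurable_speed c)).
Qed.

Lemma nice_time (F : R * R -> R) : nice2 F -> nice2 (fun z => hv z.2 * F z).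
Proof. by apply: nice2_mul; exact: bounded_time. Qed.

Lemma nice_flux (a b ul ur : R) (phi : R * R -> R) : a <= b -> C1_compact phi ->
  nice2 (fun z => limit_u a b ul ur z * dt phi z +
                  limit_u a b ul ur z ^+ 2 / 2 * dx phi z).
Proof.
move=> ab /C1_compact_nice2[_ n1 n2]; have bU := @bounded_limit_u _ a b ul ur ab.
apply: nice2_add; first exact: nice2_mul.
apply: nice2_mul => //; apply: bounded_mul; first exact: bounded_mul.
exact: (bounded_mfun_cst _ (2^-1 : R)).
Qed.

(** The integrand is that of the constant state [ur] minus that of [fan_identity], and a constant
    state is transported at speed [ur / 2], as its flux is [ur * (ur / 2)]. *)
Lemma burgers_fan (ul ur : R) (phi : R * R -> R) : ul <= ur -> C1_compact phi ->
  \int[leb2]_z (hv z.2 * (limit_u ul ur ul ur z * dt phi z +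
                          limit_u ul ur ul ur z ^+ 2 / 2 * dx phi z)) =
  - (ur * \int[leb]_x phi (x, 0) + (ul - ur) * \int[leb]_x (hl x * phi (x, 0))).
Proof.
move=> lr C; have nr := ray_derivative_nice2 (ur / 2) C.
transitivity (ur * (- \int[leb]_x phi (x, 0)) -
  (- ((ur - ul) * \int[leb]_x (hl x * phi (x, 0))))); last by ring.
rewrite -(transport1 (ur / 2) C) -(fan_identity lr C) -integral_nice2Z; last exact: nice_time.
set U := limit_u ul ur ul ur.
transitivity (\int[leb2]_z (ur * (hv z.2 * ray_derivative (ur / 2) phi z)) +
  \int[leb2]_z (-1 * (hv z.2 * ((ur - U z) * dt phi z +
                  (ur ^+ 2 - U z ^+ 2) / 2 * dx phi z)))).
  rewrite -integral_nice2D; [|by apply: nice2_scale; exact: nice_time|].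
    apply: eq_Rintegral => z _; rewrite /ray_derivative; ring.
  apply: nice2_scale; apply: nice_time.
  have := nice2_add (nice2_scale ur nr) (nice2_scale (-1) (nice_flux ul ur lr C)).
  by congr nice2; apply/funext => z; rewrite /ray_derivative -/U; ring.
rewrite (@integral_nice2Z _ (-1)) ?mulN1r//.
apply: nice_time.
have := nice2_add (nice2_scale ur nr) (nice2_scale (-1) (nice_flux ul ur lr C)).
by congr nice2; apply/funext => z; rewrite /ray_derivative -/U; ring.
Qed.

(** On top of the constant state [ur], the left side carries [ul - ur], and its flux excess
    [(ul ^+ 2 - ur ^+ 2) / 2] equals [(ul - ur) * s]: it is transported at speed [s]. *)
Lemma burgers_shock (ul ur s : R) (phi : R * R -> R) : s = (ul + ur) / 2 -> C1_compact phi ->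
  \int[leb2]_z (hv z.2 * (limit_u s s ul ur z * dt phi z +
                          limit_u s s ul ur z ^+ 2 / 2 * dx phi z)) =
  - (ur * \int[leb]_x phi (x, 0) + (ul - ur) * \int[leb]_x (hl x * phi (x, 0))).
Proof.
move=> sE C; have nr := ray_derivative_nice2 (ur / 2) C.
have ns := ray_derivative_nice2 s C.
transitivity (ur * (- \int[leb]_x phi (x, 0)) +
  (ul - ur) * (- \int[leb]_x (hl x * phi (x, 0)))); last by ring.
rewrite -(transport1 (ur / 2) C) -(transport s (@bounded_hl R) C).
rewrite -!integral_nice2Z; [|exact: nice_left|exact: nice_time].
have m1 : nice2 (fun z => ur * (hv z.2 * ray_derivative (ur / 2) phi z)).
  by apply: nice2_scale; exact: nice_time.
have m2 : nice2 (fun z => (ul - ur) * (hv z.2 * hl (z.1 - s * z.2) * ray_derivative s phi z)).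
  by apply: nice2_scale; exact: nice_left.
rewrite -integral_nice2D//; apply: (@Rintegral_off_lines _ s s).
- exact: (nice_time (nice_flux ul ur (lexx s) C)).1.
- exact: (nice2_add m1 m2).1.
move=> z _ zs _; rewrite /limit_u hl01 subr_lt0 /ray_derivative.
case: ifPn => [_|]; first by rewrite sE; field.
by rewrite -leNgt le_eqVlt eq_sym (negbTE zs) /= => ->; field.
Qed.

Definition limit_density (a b rl rr : R) (z : R * R) : R :=
  hv z.2 * (rl * hl (z.1 - a * z.2) + rr * (1 - hl (z.1 - b * z.2))).

Lemma bounded_limit_density a b rl rr :
  bounded_mfun (limit_density a b rl rr : plane -> R).
Proof.
have bh c := bounded_comp (@bounded_hl R) (measurable_speed c).
apply: bounded_mul; first exact: bounded_time.
have [ma [A hA]] := bh a; have [mb [B hB]] := bh b; split.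
  apply: measurable_funD; apply: measurable_funM => //; exact: measurable_funB.
exists (`|rl| * A + `|rr| * (1 + B)) => z.
rewrite (le_trans (ler_normD _ _))// !normrM lerD// ler_wpM2l//.
by rewrite (le_trans (ler_normB _ _))// normr1 lerD.
Qed.

Lemma limit_density_ge0 a b rl rr z : 0 <= rl -> 0 <= rr -> 0 <= limit_density a b rl rr z.
Proof.
move=> l0 r0; rewrite /limit_density /heaviside !hl01.
case: (0 < z.2); rewrite ?mul0r// mul1r.
by case: (_ < 0); case: (_ < 0); rewrite ?subr0 ?subrr ?mulr1 ?mulr0 ?addr0 ?add0r// addr_ge0.
Qed.

(** On the left [dt phi + ul * dx phi] is the derivative along the bounding ray plus
    [(ul - a) * dx phi], and likewise on the right with [ur] and [b]. The first parts give the
    initial data, the remainders the traces on the two rays. *)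
Lemma mass_identity (a b ul ur rl rr : R) (phi : R * R -> R) : a <= b -> C1_compact phi ->
  \int[leb2]_z (limit_density a b rl rr z * (dt phi z + limit_u a b ul ur z * dx phi z)) =
  - (rr * \int[leb]_x phi (x, 0) + (rl - rr) * \int[leb]_x (hl x * phi (x, 0)))
  + rl * (ul - a) * \int[leb]_t (hv t * phi (a * t, t))
  - rr * (ur - b) * \int[leb]_t (hv t * phi (b * t, t)).
Proof.
move=> ab C; have [n0 n1 n2] := C1_compact_nice2 C.
have na := ray_derivative_nice2 a C; have nb := ray_derivative_nice2 b C.
pose T1 (z : R * R) := hv z.2 * ray_derivative b phi z.
pose T2 (z : R * R) := hv z.2 * hl (z.1 - b * z.2) * ray_derivative b phi z.
pose T3 (z : R * R) := hv z.2 * hl (z.1 - a * z.2) * ray_derivative a phi z.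
pose S1 (z : R * R) := hv z.2 * dx phi z.
pose S2 (z : R * R) := hv z.2 * hl (z.1 - b * z.2) * dx phi z.
pose S3 (z : R * R) := hv z.2 * hl (z.1 - a * z.2) * dx phi z.
have t1 : nice2 T1 := nice_time nb.
have t2 : nice2 T2 := nice_left b nb.
have t3 : nice2 T3 := nice_left a na.
have s1 : nice2 S1 := nice_time n1.
have s2 : nice2 S2 := nice_left b n1.
have s3 : nice2 S3 := nice_left a n1.
have E1 : \int[leb2]_z T1 z = - \int[leb]_x phi (x, 0) by exact: transport1.
have E2 : \int[leb2]_z T2 z = - \int[leb]_x (hl x * phi (x, 0)).
  by apply: transport => //; exact: bounded_hl.
have E3 : \int[leb2]_z T3 z = - \int[leb]_x (hl x * phi (x, 0)).
  by apply: transport => //; exact: bounded_hl.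
have F1 : \int[leb2]_z S1 z = 0 by exact: integral_dx0.
have F2 : \int[leb2]_z S2 z = \int[leb]_t (hv t * phi (b * t, t)) by exact: integral_dx_left.
have F3 : \int[leb2]_z S3 z = \int[leb]_t (hv t * phi (a * t, t)) by exact: integral_dx_left.
pose G z := rr * T1 z + (- rr * T2 z + (rl * T3 z +
  (rr * (ur - b) * S1 z + (- (rr * (ur - b)) * S2 z + rl * (ul - a) * S3 z)))).
have g5 : nice2 (fun z => - (rr * (ur - b)) * S2 z + rl * (ul - a) * S3 z).
  by apply: nice2_add; exact: nice2_scale.
have g4 := nice2_add (nice2_scale (rr * (ur - b)) s1) g5.
have g3 := nice2_add (nice2_scale rl t3) g4.
have g2 := nice2_add (nice2_scale (- rr) t2) g3.
have g1 := nice2_add (nice2_scale rr t1) g2.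
transitivity (\int[leb2]_z G z).
  apply: (@Rintegral_off_lines _ b b) => //.
  - apply: (nice2_mul (bounded_limit_density a b rl rr) _).1; apply: nice2_add => //.
    by apply: nice2_mul => //; exact: bounded_limit_u.
  - exact: g1.1.
  move=> z z20 zb _; rewrite /G /T1 /T2 /T3 /S1 /S2 /S3 /limit_density /limit_u.
  rewrite !hl01 !subr_lt0 /ray_derivative /heaviside.
  have [t0|t0] := lt_or_le 0 z.2; last by rewrite (le_gtF t0) !mul0r !mulr0 !addr0.
  have abz : a * z.2 <= b * z.2 by rewrite ler_pM2r.
  rewrite t0; have [za|za] := lt_or_le z.1 (a * z.2).
    by rewrite za (lt_le_trans za abz); ring.
  rewrite (le_gtF za); have [zb'|zb'] := lt_or_le z.1 (b * z.2).
    by rewrite zb' (lt_gtF zb'); ring.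
  have -> : b * z.2 < z.1 by rewrite lt_neqAle eq_sym zb.
  by rewrite (le_gtF zb'); ring.
rewrite /G integral_nice2D//; last exact: nice2_scale.
rewrite integral_nice2D//; last exact: nice2_scale.
rewrite integral_nice2D//; last exact: nice2_scale.
rewrite integral_nice2D//; last exact: nice2_scale.
rewrite integral_nice2D//; [|exact: nice2_scale|exact: nice2_scale].
by rewrite !integral_nice2Z// E1 E2 E3 F1 F2 F3; ring.
Qed.

Lemma nice_ray (a w : R) (F : R * R -> R) : nice2 F ->
  nice1 (fun t => w * (hv t * t) * F (a * t, t)).
Proof.
move=> [mF [M [FM F0]]]; split.
  apply: measurable_funM.
    by do 2! (apply: measurable_funM => //); exact: (measurable_heaviside _).1.
  by apply: (measurableT_comp mF); apply: measurable_fun_pair => //; exact: measurable_funM.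
have M0 : 0 <= M := le_trans (normr_ge0 _) (FM point).
have Z t : M < `|t| -> F (a * t, t) = 0.
  by move=> Mt; apply: F0 => -[_ /=]; rewrite leNgt Mt.
exists (Num.max (`|w| * (1 * M) * M) M); split => t; last first.
  by rewrite gt_max => /andP[_ /Z ->]; rewrite mulr0.
have [/Z ->|tM] := lt_or_le M `|t|.
  by rewrite mulr0 normr0 le_max !mulr_ge0.
rewrite le_max; apply/orP; left; rewrite !normrM ler_pM// ?mulr_ge0// ler_wpM2l//.
by rewrite ler_pM// /heaviside; case: ifP; rewrite ?normr1 ?normr0.
Qed.

(** Sum of two instances of [density_measure]: [limit_density] on the plane, and the weight [w * t]
    carried along the ray of speed [a]. Both weights vanish for [t <= 0], so the open and the closed
    half plane give the same integral. *)
Lemma limit_measure (a b rl rr w : R) : 0 <= rl -> 0 <= rr -> 0 <= w ->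
  exists nu : {measure set plane -> \bar R},
  forall (D : set (R * R)) (F : R * R -> R),
    D = @closed_half_plane R \/ D = @open_half_plane R -> nice2 F ->
    (\int[nu]_(z in D) (F z)%:E =
     (\int[leb2]_z (limit_density a b rl rr z * F z) +
      \int[leb]_t (w * (hv t * t) * F (a * t, t)))%:E)%E.
Proof.
move=> l0 r0 w0; have [md _] := bounded_limit_density a b rl rr.
have mray : measurable_fun setT (fun t : measurableTypeR R => (a * t, t) : plane).
  by apply: measurable_fun_pair => //; exact: measurable_funM.
have mw : measurable_fun setT (fun t : measurableTypeR R => w * (hv t * t)).
  by do 2! (apply: measurable_funM => //); exact: (measurable_heaviside _).1.
have w_ge0 t : 0 <= w * (hv t * t).
  rewrite mulr_ge0// /heaviside; have [t0|t0] := lt_or_le 0 t; last by rewrite (le_gtF t0) mul0r.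
  by rewrite t0 mul1r ltW.
have [nu1 h1] := @density_measure R _ plane leb2 id (limit_density a b rl rr)
  (@measurable_id _ _ _) md (fun z => limit_density_ge0 a b z l0 r0).
have [nu2 h2] := @density_measure R _ _ leb _ _ mray mw w_ge0.
exists (measure_add nu1 nu2) => D F hD nF.
have [mc mo] := @measurable_half_plane R.
have mD : measurable (D : set plane) by case: hD => ->.
have Dc : D `<=` @closed_half_plane R by case: hD => -> // z /ltW.
have oD : @open_half_plane R `<=` D by case: hD => -> // z /ltW.
have mF : measurable_fun (D : set plane) (F : plane -> R) by apply: measurable_funTS; exact: nF.1.
have n1 : nice2 (fun z => limit_density a b rl rr z * F z).
  by apply: nice2_mul => //; exact: bounded_limit_density.
have n2 := nice_ray a w nF.
have D1 z : 0 < limit_density a b rl rr z -> D z.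
  rewrite /limit_density /heaviside => h; apply: oD; move: h.
  by rewrite /open_half_plane /=; case: ifP => //; rewrite mul0r ltxx.
have D2 t : 0 < w * (hv t * t) -> D (a * t, t).
  rewrite /heaviside => h; apply: oD; move: h.
  by rewrite /open_half_plane /=; case: ifP => //; rewrite mul0r mulr0 ltxx.
have [i1 E1] := h1 D F mD Dc D1 mF (nice2_integrable n1).
have [i2 E2] := h2 D F mD Dc D2 mF (nice1_integrable n2).
by rewrite integral_measure_add// E1 E2 [in RHS]EFinD integral_nice2// integral_nice1.
Qed.

(* [a = ul], [b = ur], [w = 0] for a rarefaction; otherwise [a = b] is the speed of the
   delta shock and [w] the growth rate of its mass. *)
Lemma limit_solution_exists (a b ul ur rl rr w : R) :
  0 <= rl -> 0 <= rr -> 0 <= w -> a <= b ->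
  [/\ a = ul, b = ur & w = 0] \/
  [/\ a = b, a = (ul + ur) / 2 & w = (ul - ur) / 2 * (rl + rr)] ->
  exists nu : {measure set plane -> \bar R},
    limit_solution (riemann_data ul ur) (riemann_data rl rr) (limit_u a b ul ur) nu /\
    forall phi, test_open phi -> distr_of_measure nu phi =
     (\int[leb2]_z (limit_density a b rl rr z * phi z) +
      \int[leb]_t (w * (hv t * t) * phi (a * t, t)))%:E.
Proof.
move=> l0 r0 w0 ab cases; have [nu nuP] := limit_measure a b l0 r0 w0; exists nu.
have bU := @bounded_limit_u _ a b ul ur ab; split; last first.
  move=> phi [s c _]; apply: nuP; first by right.
  by have [] := C1_compact_nice2 (test_C1_compact (conj s c)).
split.
- by apply: measurable_funTS; exact: bU.1.
- move=> K cK Kc; have mK : measurable (K : set plane) by exact: compact_measurable2.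
  have [M KM] := compact_square cK.
  (* Applied to this indicator, [nuP] exhibits the mass of [K] as a real number. *)
  have nK : nice2 (\1_K : R * R -> R).
    split; first exact: measurable_indic.
    exists (Num.max 1 M); split => z.
      by rewrite indicE le_max; case: (_ \in _); rewrite ?normr1 ?normr0 ?lexx ?ler01.
    move=> h; rewrite indicE memNset// => Kz; apply: h; apply: square_le (KM _ Kz).
    by rewrite le_max lexx orbT.
  have := nuP _ _ (or_introl erefl) nK.
  rewrite integral_indic//; last by have [] := @measurable_half_plane R.
  by rewrite setIidl// => ->; exact: ltry.
- move=> phi /test_C1_compact C; rewrite integral_riemann// integral_half_plane; last first.
    by apply: measurable_funTS; exact: (nice_flux ul ur ab C).1.
  rewrite integral_nice2; last exact/nice_time/nice_flux.
  suff -> : \int[leb2]_z (hv z.2 * (limit_u a b ul ur z * dt phi z +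
                          limit_u a b ul ur z ^+ 2 / 2 * dx phi z)) =
    - (ur * \int[leb]_x phi (x, 0) + (ul - ur) * \int[leb]_x (hl x * phi (x, 0))).
    by rewrite -EFinD addNr.
  case: cases => [[aE bE _]|[<- aE _]]; last exact: burgers_shock.
  by move: ab; rewrite aE bE => ab; exact: burgers_fan.
move=> phi /test_C1_compact C; rewrite integral_riemann//.
have [_ n1 n2] := C1_compact_nice2 C.
rewrite nuP; [|by left|]; last by apply: nice2_add => //; exact: nice2_mul.
rewrite mass_identity// -EFinD; congr EFin.
have -> : \int[leb]_t (w * (hv t * t) * (dt phi (a * t, t) +
    limit_u a b ul ur (a * t, t) * dx phi (a * t, t))) =
  - (w * \int[leb]_t (hv t * phi (a * t, t))).
  case: cases => [[_ _ ->]|[abE _ _]].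
    transitivity (\int[leb]_(t in setT) (0 : R)); last by rewrite mul0r oppr0 /Rintegral integral0.
    by apply: eq_Rintegral => t _; rewrite !mul0r.
  rewrite -mulrN -integral_ray// -integral_nice1Z; last first.
    have := nice_ray a 1 (ray_derivative_nice2 a C).
    by congr nice1; apply/funext => t; rewrite mul1r mulrA.
  (* On the ray [limit_u] takes its last branch, of value [a], and the integrand is the derivative
     of [phi] along the ray. *)
  apply: eq_Rintegral => t _; rewrite /limit_u -abE /= ltxx.
  have [t0|t0] := lt_or_le 0 t; last by rewrite /heaviside (le_gtF t0) !(mul0r, mulr0).
  by rewrite mulfK ?gt_eqF// /ray_derivative; ring.
(* The coefficients [rl * (ul - a)] and [rr * (ur - b)] of the traces vanish for a rarefaction; for
   a delta shock their difference is [w], and the growth of the concentrated mass cancels them. *)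
case: cases => [[-> -> ->]|[<- aE ->]]; first by rewrite !subrr; ring.
by rewrite aE; field.
Qed.

End limit_system.

(** * Convergence *)

Section convergence.
Context {R : realType}.
Local Notation plane := (measurableTypeR R * measurableTypeR R)%type.
Local Notation leb := (@lebesgue_measure R).
Local Notation leb2 := (@leb2 R).
Local Notation hv := (@heaviside R).
Local Notation hl := (@hl R).

Lemma nice2_norm_le (k g : R * R -> R) : nice2 k -> nice2 g -> (forall z, `|k z| <= g z) ->
  `|\int[leb2]_z k z| <= \int[leb2]_z g z.
Proof.
move=> nk ng kg; have ik := nice2_integrable nk.
apply: (le_trans (le_normr_Rintegral measurableT ik)).
apply: le_Rintegral => //; first exact: (integrable_norm ik).
exact: nice2_integrable.
Qed.

Definition strip (c h M : R) (z : R * R) : R :=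
  \1_`[- h, h] (z.1 - c * z.2) * \1_`[- M, M] z.2.

Lemma strip_ge0 c h M z : 0 <= strip c h M z.
Proof. by rewrite mulr_ge0. Qed.

Lemma strip1 c h M z : `|z.1 - c * z.2| <= h -> `|z.2| <= M -> strip c h M z = 1.
Proof.
move=> zh zM; rewrite /strip !indicE !mem_set ?mulr1//= in_itv /= -ler_norml//.
Qed.

Lemma nice_strip c h M : nice2 (strip c h M).
Proof.
split.
  apply: measurable_funM; last first.
    by apply: (measurableT_comp _ (@measurable_snd1 R)); exact: measurable_indic.
  by apply: (measurableT_comp _ (measurable_speed c)); exact: measurable_indic.
exists (Num.max 1 (Num.max (`|h| + `|c| * `|M|) `|M|)); split => z.
  rewrite /strip !indicE le_max; apply/orP; left.
  by case: (_ \in _); case: (_ \in _); rewrite ?mulr1 ?mulr0 ?normr1 ?normr0.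
move=> nz; rewrite /strip !indicE; case: (boolP (z.1 - c * z.2 \in _)) => [|_]; last by rewrite mul0r.
case: (boolP (z.2 \in _)) => [|_]; last by rewrite mulr0.
rewrite !inE /= !in_itv /= -!ler_norml => zM zh; exfalso; apply: nz.
have zM' : `|z.2| <= `|M| by rewrite (le_trans zM)// ler_norm.
split; rewrite !le_max; last by rewrite zM' !orbT.
apply/orP; right; apply/orP; left.
rewrite -[z.1](subrK (c * z.2)) (le_trans (ler_normD _ _))// lerD//.
  by rewrite (le_trans zh)// ler_norm.
by rewrite normrM ler_wpM2l.
Qed.

Lemma nice_step (c h : R) : nice1 (fun x => \1_`[- h, h] (x - c) : R).
Proof.
split; first by apply: (measurableT_comp (measurable_indic _)) => //; exact: measurable_funB.
exists (Num.max 1 (`|h| + `|c|)); split => x.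
  by rewrite indicE le_max; case: (_ \in _); rewrite ?normr1 ?normr0 ?lexx ?ler01.
rewrite gt_max => /andP[_ xh]; rewrite indicE memNset//= in_itv /= -ler_norml => xc.
move: xh; rewrite ltNge -{1}[x](subrK c) (le_trans (ler_normD _ _))// lerD//.
by rewrite (le_trans xc)// ler_norm.
Qed.

Lemma integral_step (c h : R) : 0 <= h -> \int[leb]_x (\1_`[- h, h] (x - c) : R) = 2 * h.
Proof.
move=> h0; rewrite /Rintegral.
transitivity (fine (\int[leb]_(x in setT) (\1_`[c - h, c + h] x)%:E)%E).
  congr fine; apply: eq_integral => x _; congr EFin; rewrite !indicE.
  congr (nat_of_bool _)%:R; apply/idP/idP; rewrite !inE /= !in_itv /= => /andP[h1 h2]; apply/andP; split; lra.
rewrite integral_indic// setIT [X in fine X]lebesgue_measure_itv /= lte_fin.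
case: ifPn => [_|]; first by rewrite -EFinB /=; ring.
by rewrite -leNgt => h1; rewrite /=; lra.
Qed.

Lemma integral_strip (c h M : R) : 0 <= h -> 0 <= M ->
  \int[leb2]_z strip c h M z = 4 * h * M.
Proof.
move=> h0 M0; rewrite Rintegral_leb2_tx; last exact: nice_strip.
transitivity (\int[leb]_t (2 * h * (\1_`[- M, M] (t - 0) : R))).
  apply: eq_Rintegral => t _; rewrite subr0 -(integral_step (c * t) h0) mulrC.
  rewrite -integral_nice1Z; last exact: nice_step.
  by apply: eq_Rintegral => x _; rewrite /strip /= mulrC.
by rewrite integral_nice1Z ?integral_step//; [ring|exact: nice_step].
Qed.

(** On a square of side [2 * M] containing the support, [F] is at most [delta] off two strips around
    the rays [c1] and [c2], of area [4 * delta * M ^+ 2] each, and at most [K] on them; the bound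
    [M] of [phi] supplies the third power. [C] depends on [phi] and [K] alone, so that [F] and the
    rays [a] and [b], on which it may be arbitrary, can vary with [eps]. *)
Lemma strip_estimate (phi : R * R -> R) (K : R) : nice2 phi -> 0 <= K ->
  exists2 C, 0 <= C & forall (F : R * R -> R) (delta c1 c2 a b : R),
  bounded_mfun (F : plane -> R) -> 0 <= delta ->
  (forall z, 0 < z.2 -> z.1 != a * z.2 -> z.1 != b * z.2 -> `|F z| <= K) ->
  (forall z, 0 < z.2 -> delta * z.2 < `|z.1 - c1 * z.2| ->
     delta * z.2 < `|z.1 - c2 * z.2| -> `|F z| <= delta) ->
  `|\int[leb2]_z (hv z.2 * F z * phi z)| <= C * delta.
Proof.
move=> nphi K0; have [mphi [M [phiM phi0]]] := nphi.
have M0 : 0 <= M := le_trans (normr_ge0 _) (phiM point).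
exists (4 * M ^+ 3 * (1 + K + K)).
  by rewrite !mulr_ge0// ?exprn_ge0// !addr_ge0.
move=> F delta c1 c2 a b bF d0 FK Fd.
have mab : measurable (line a `|` line b : set plane).
  by apply: measurableU; exact: measurable_line.
(* Zeroing [F] on the two null rays makes the bound [K] valid everywhere for [t > 0]. *)
pose F' (z : R * R) := F z * \1_(~` (line a `|` line b)) z.
have bF' : bounded_mfun (F' : plane -> R).
  apply: bounded_mul => //; split; first by apply: measurable_indic; exact: measurableC.
  by exists 1 => z; rewrite indicE; case: (_ \in _); rewrite ?normr1 ?normr0.
have bhF (G : R * R -> R) : bounded_mfun (G : plane -> R) -> nice2 (fun z => hv z.2 * G z * phi z).
  by move=> bG; apply: nice2_mul => //; apply: bounded_mul => //; exact: bounded_time.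
have -> : \int[leb2]_z (hv z.2 * F z * phi z) = \int[leb2]_z (hv z.2 * F' z * phi z).
  apply: (@Rintegral_off_lines _ a b); [exact: (bhF _ bF).1|exact: (bhF _ bF').1|].
  move=> z _ /eqP za /eqP zb; rewrite /F' indicE mem_set ?mulr1//.
  by case.
have F'K z : 0 < z.2 -> `|F' z| <= K.
  move=> z0; rewrite /F' indicE; case: (boolP (_ \in _)) => [|_]; last by rewrite mulr0 normr0.
  rewrite inE /= => h; rewrite mulr1 FK//; apply/eqP => e; apply: h; by [left|right].
have F'd z : 0 < z.2 -> delta * z.2 < `|z.1 - c1 * z.2| ->
     delta * z.2 < `|z.1 - c2 * z.2| -> `|F' z| <= delta.
  move=> z0 h1 h2; rewrite /F' indicE; case: (_ \in _); last by rewrite mulr0 normr0.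
  by rewrite mulr1 Fd.
pose g z := M * delta * strip 0 M M z +
  (M * K * strip c1 (delta * M) M z + M * K * strip c2 (delta * M) M z).
have ns := nice_strip.
have n1 : nice2 (fun z => M * K * strip c1 (delta * M) M z + M * K * strip c2 (delta * M) M z).
  by apply: nice2_add; exact: nice2_scale.
have ng : nice2 g by apply: nice2_add => //; exact: nice2_scale.
have -> : 4 * M ^+ 3 * (1 + K + K) * delta = \int[leb2]_z g z.
  rewrite /g integral_nice2D//; last exact: nice2_scale.
  rewrite integral_nice2D//; [|exact: nice2_scale|exact: nice2_scale].
  by rewrite !integral_nice2Z// !integral_strip ?mulr_ge0//; ring.
apply: nice2_norm_le => //; first exact: bhF.
move=> z; have g0 : 0 <= g z by rewrite !addr_ge0// !mulr_ge0//; exact: strip_ge0.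
have [z0|z0] := lt_or_le 0 z.2; last by rewrite /heaviside (le_gtF z0) !mul0r normr0.
have [zM|zM] := pselect (square M z); last by rewrite phi0// mulr0 normr0.
have [zM1 zM2] := zM.
rewrite /heaviside z0 mul1r normrM.
have S0 : strip 0 M M z = 1 by apply: strip1; rewrite ?mul0r ?subr0.
have zd : delta * z.2 <= delta * M by rewrite ler_wpM2l// (le_trans (ler_norm _)).
have pos c h : 0 <= strip c h M z := strip_ge0 c h M z.
have [h1|h1] := lt_or_le (delta * z.2) `|z.1 - c1 * z.2|; last first.
  have S1 : strip c1 (delta * M) M z = 1 by apply: strip1 => //; exact: le_trans zd.
  rewrite /g S1 mulr1 (@le_trans _ _ (M * K))//; first by rewrite mulrC ler_pM// F'K.
  by rewrite addrCA lerDl addr_ge0// !mulr_ge0.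
have [h2|h2] := lt_or_le (delta * z.2) `|z.1 - c2 * z.2|; last first.
  have S1 : strip c2 (delta * M) M z = 1 by apply: strip1 => //; exact: le_trans zd.
  rewrite /g S1 mulr1 (@le_trans _ _ (M * K))//; first by rewrite mulrC ler_pM// F'K.
  by rewrite addrA lerDr addr_ge0// !mulr_ge0.
rewrite /g S0 mulr1 (@le_trans _ _ (M * delta))//; first by rewrite mulrC ler_pM// F'd.
by rewrite lerDl addr_ge0// !mulr_ge0.
Qed.

(** At time [t] the strip has width [(s2 - s1) * t], and on it [phi] differs from its value on the
    ray [s] by at most [delta * t] times the bound of [dx phi]. The error is proportional to the
    mass rate [m * (s2 - s1)] and not to the height [m], which is unbounded. *)
Lemma narrow_strip_estimate (phi : R * R -> R) (s : R) : C1_compact phi ->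
  exists2 C, 0 <= C & forall (delta s1 s2 m : R), 0 <= delta -> s1 <= s2 -> 0 <= m ->
  `|s1 - s| <= delta -> `|s2 - s| <= delta ->
  `|\int[leb2]_z (hv z.2 * (m * (hv (z.1 - s1 * z.2) * hl (z.1 - s2 * z.2))) * phi z) -
    m * (s2 - s1) * \int[leb]_t (hv t * t * phi (s * t, t))| <= C * (m * (s2 - s1)) * delta.
Proof.
move=> C; have [nphi [m1 [M1 [dM1 _]]] _] := C1_compact_nice2 C.
have [mphi [M [phiM phi0]]] := nphi.
have M0 : 0 <= M := le_trans (normr_ge0 _) (phiM point).
have M10 : 0 <= M1 := le_trans (normr_ge0 _) (dM1 point).
exists (4 * M ^+ 2 * (M1 * M)); first by rewrite !mulr_ge0// exprn_ge0.
move=> delta s1 s2 m d0 s12 m0 s1d s2d.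
(* The values of [phi] on the ray, extended constantly in [x], have no bounded support in [x];
   together with the strip this truncation in time restores it. *)
pose T (z : R * R) : R := \1_`[- M, M] z.2.
have bT : bounded_mfun (T : plane -> R).
  split; first by apply: (measurableT_comp _ (@measurable_snd1 R)); exact: measurable_indic.
  by exists 1 => z; rewrite /T indicE; case: (_ \in _); rewrite ?normr1 ?normr0.
have T1 z : `|z.2| <= M -> T z = 1.
  by move=> zM; rewrite /T indicE mem_set//= in_itv /= -ler_norml.
have T0 z : M < `|z.2| -> T z = 0.
  by move=> zM; rewrite /T indicE memNset//= in_itv /= -ler_norml leNgt zM.
pose B (z : R * R) := hv z.2 * (hv (z.1 - s1 * z.2) * hl (z.1 - s2 * z.2)).
have bB : bounded_mfun (B : plane -> R).
  apply: bounded_mul; first exact: bounded_time.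
  apply: bounded_mul; first by apply: measurable_heaviside; exact: measurable_speed.
  exact: (bounded_comp (@bounded_hl R) (measurable_speed s2)).
have B01 z : (B z = 0 \/ B z = 1 /\ [/\ 0 < z.2, s1 * z.2 < z.1 & z.1 < s2 * z.2]).
  rewrite /B hl01 /heaviside subr_lt0 subr_gt0.
  case: (boolP (0 < z.2)) => h0; last by left; rewrite mul0r.
  case: (boolP (s1 * z.2 < z.1)) => h1; last by left; rewrite mul0r mulr0.
  case: (boolP (z.1 < s2 * z.2)) => h2; last by left; rewrite !mulr0.
  by right; rewrite !mulr1.
pose S := strip s1 ((s2 - s1) * M) M.
have S0 z : 0 <= S z := strip_ge0 _ _ _ z.
have BTS z : B z * T z = B z * T z * S z.
  have [->|[Bz [z0 h1 h2]]] := B01 z; first by rewrite !mul0r.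
  have [zM|zM] := lt_or_le M `|z.2|; first by rewrite T0// mulr0 mul0r.
  rewrite /S strip1 ?mulr1// ger0_norm ?subr_ge0 ?(ltW h1)//.
  rewrite (@le_trans _ _ ((s2 - s1) * z.2))//; first by rewrite mulrBl lerD2r ltW.
  by rewrite ler_wpM2l ?subr_ge0// (le_trans (ler_norm _)).
have nBT : nice2 (fun z => B z * T z).
  have := nice2_mul (bounded_mul bB bT) (nice_strip s1 ((s2 - s1) * M) M).
  by congr nice2; apply/funext => z; rewrite -BTS.
have bphi : bounded_mfun (phi : plane -> R) by split => //; exists M.
have bray : bounded_mfun (fun z : plane => phi (s * z.2, z.2)).
  split; last by exists M => z; exact: phiM.
  apply: (measurableT_comp mphi); apply: measurable_fun_pair; last exact: measurable_snd1.
  by apply: measurable_funM => //; exact: measurable_snd1.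
have nA := nice2_mul bphi nBT; have nR := nice2_mul bray nBT.
have -> : \int[leb2]_z (hv z.2 * (m * (hv (z.1 - s1 * z.2) * hl (z.1 - s2 * z.2))) * phi z) =
    m * \int[leb2]_z (phi z * (B z * T z)).
  rewrite -integral_nice2Z//; apply: eq_Rintegral => z _; rewrite -/(B z).
  have [zM|zM] := lt_or_le M `|z.2|; last by rewrite T1// /B; ring.
  rewrite T0// phi0 ?mulr0 ?mul0r ?mulr0// => -[_]; rewrite leNgt zM //.
have -> : m * (s2 - s1) * \int[leb]_t (hv t * t * phi (s * t, t)) =
    m * \int[leb2]_z (phi (s * z.2, z.2) * (B z * T z)).
  rewrite -mulrA; congr (_ * _); rewrite Rintegral_leb2_tx// -integral_nice1Z; last first.
    by have := nice_ray s 1 nphi; congr nice1; apply/funext => t; rewrite mul1r.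
  apply: eq_Rintegral => t _ /=.
  have [tM|tM] := lt_or_le M `|t|.
    transitivity (\int[leb]_(x in setT) (0 : R)); last first.
      by apply: eq_Rintegral => x _; rewrite (T0 (x, t))// !mulr0.
    rewrite /Rintegral integral0 phi0 ?mulr0// => -[_ /=]; by rewrite leNgt tM.
  have [t0|t0] := lt_or_le 0 t; last first.
    transitivity (\int[leb]_(x in setT) (0 : R)); last first.
      by apply: eq_Rintegral => x _; rewrite /B /heaviside /= (le_gtF t0) !mul0r mulr0.
    by rewrite /Rintegral integral0 /heaviside (le_gtF t0) !mul0r mulr0.
  transitivity (\int[leb]_x (hv (x - s1 * t) * hv (s2 * t - x) * (phi (s * t, t) + x * 0))).
    rewrite integral_affine; last by rewrite ler_pM2r.
    by rewrite /heaviside t0; ring.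
  apply: eq_Rintegral => x _; rewrite /B T1//= /hl opprB.
  have -> : hv t = 1 by rewrite /heaviside t0.
  by ring.
rewrite -mulrBr.
have -> : \int[leb2]_z (phi z * (B z * T z)) - \int[leb2]_z (phi (s * z.2, z.2) * (B z * T z)) =
    \int[leb2]_z ((phi z - phi (s * z.2, z.2)) * (B z * T z)).
  rewrite -RintegralB//; [|exact: nice2_integrable|exact: nice2_integrable].
  by apply: eq_Rintegral => z _; rewrite mulrBl.
have nD := nice2_mul (bounded_sub bphi bray) nBT.
have E : 4 * M ^+ 2 * (M1 * M) * (m * (s2 - s1)) * delta =
    m * \int[leb2]_z (M1 * (delta * M) * S z).
  rewrite integral_nice2Z; last exact: nice_strip.
  by rewrite integral_strip ?mulr_ge0 ?subr_ge0//; ring.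
rewrite E normrM (ger0_norm m0) ler_wpM2l//.
apply: nice2_norm_le => //; first by apply: nice2_scale; exact: nice_strip.
move=> z; rewrite BTS; have [->|[Bz [z0 h1 h2]]] := B01 z.
  by rewrite !mul0r mulr0 normr0 !mulr_ge0.
have [zM|zM] := lt_or_le M `|z.2|; first by rewrite T0// mulr0 mul0r mulr0 normr0 !mulr_ge0.
rewrite Bz T1// !mul1r normrM (ger0_norm (S0 z)) ler_wpM2r//.
have [x _ E1] := @mvt_between R _ _ (s * z.2) z.1 (fun x => is_derive_dx x z.2 C).
have -> : phi z - phi (s * z.2, z.2) = dx phi (x, z.2) * (z.1 - s * z.2).
  by rewrite -E1; case: z {BTS Bz z0 h1 h2 zM E1}.
rewrite normrM ler_pM// (@le_trans _ _ (delta * z.2))//.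
  move: s1d s2d; rewrite !ler_norml => /andP[k1 _] /andP[_ k2].
  apply/andP; split.
    rewrite -mulNr lerBrDr -mulrDl (le_trans _ (ltW h1))// ler_wpM2r ?(ltW z0)//; lra.
  rewrite lerBlDr -mulrDl (le_trans (ltW h2))// ler_wpM2r ?(ltW z0)//; lra.
by rewrite ler_wpM2l// (le_trans (ler_norm _)).
Qed.

Lemma measurable_pieces (g : R -> R) (a1 b1 a2 b2 : R) :
  measurable_fun `]-oo, a1[ g -> measurable_fun `[a1, b1] g ->
  measurable_fun `]b1, a2[ g -> measurable_fun `[a2, b2] g ->
  measurable_fun `]b2, +oo[ g -> measurable_fun setT g.
Proof.
move=> m1 m2 m3 m4 m5.
have -> : [set: R] = `]-oo, a1[ `|` `[a1, b1] `|` `]b1, a2[ `|` `[a2, b2] `|` `]b2, +oo[.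
  apply/seteqP; split => // x _; rewrite /= !in_itv /= !andbT.
  have [h1|h1] := lt_or_le x a1; first by do 4 left.
  have [h2|h2] := lt_or_le b1 x; last by do 3 left; right; rewrite h1.
  have [h3|h3] := lt_or_le x a2; first by do 2 left; right; rewrite h2.
  have [h4|h4] := lt_or_le b2 x; first by right.
  by left; right; rewrite h3.
by do 4 (apply/measurable_funU; [by repeat apply: measurableU|by []|split => //]).
Qed.

Lemma measurable_wave (lam : R * R -> R) (X : R * R -> R * R) (sh : Prop)
    (a b : R) (V : R -> R * R) (l m : R * R) (p : R * R -> R) : continuous p ->
  rarefaction lam X a b V l m \/ (a = b /\ sh) -> measurable_fun `[a, b] (p \o V).
Proof.
move=> cp [[_ cV _ _ _]|[-> _]].
  have c : {within `[a, b], continuous (p \o V)}.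
    by apply: (@within_continuous_comp _ _ _ _ V p _ cV) => x _; exact: cp.
  exact: subspace_continuous_measurable_fun.
by rewrite set_itv1; exact: measurable_fun_set1.
Qed.

Lemma measurable_fan (f : R -> R) (eps : R) (l r : R * R) (V : R -> R * R) :
  two_wave_fan f eps l r V \/ vacuum_fan f eps l r V ->
  measurable_fun setT (fst \o V) /\ measurable_fun setT (snd \o V).
Proof.
have cst_piece (p : R * R -> R) (D : set R) v : measurable D ->
    (forall x, D x -> V x = v) -> measurable_fun D (p \o V).
  move=> mD h; apply: (eq_measurable_fun (cst (p v))); last exact: measurable_cst.
  by move=> x; rewrite inE => /h /= ->.
case=> [[a1 [b1 [a2 [b2 [m [_ [w1 w2] h1 h2 h3]]]]]]|
  [a1 [b1 [a2 [b2 [m1 [m2 [_ [w1 w2] h1 h2 h3]]]]]]]].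
  have M (p : R * R -> R) : continuous p -> measurable_fun setT (p \o V).
    move=> cp; apply: (@measurable_pieces _ a1 b1 a2 b2).
    - by apply: (cst_piece _ _ l) => // x; rewrite /= in_itv /= => /h1.
    - exact: (measurable_wave cp w1).
    - by apply: (cst_piece _ _ m) => // x; rewrite /= in_itv /= => /h2.
    - exact: (measurable_wave cp w2).
    - by apply: (cst_piece _ _ r) => // x; rewrite /= in_itv /= andbT => /h3.
  by split; apply: M => x; [exact: cvg_fst|exact: cvg_snd].
have M (p : R * R -> R) : continuous p -> measurable_fun `]b1, a2[ (p \o V) ->
    measurable_fun setT (p \o V).
  move=> cp mid; apply: (@measurable_pieces _ a1 b1 a2 b2) => //.
  - by apply: (cst_piece _ _ l) => // x; rewrite /= in_itv /= => /h1.
  - by apply: (@measurable_wave (lambda1 f eps) (X1 f eps) False _ _ _ l m1) => //; left.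
  - by apply: (@measurable_wave (lambda2 f eps) (X2 f eps) False _ _ _ m2 r) => //; left.
  - by apply: (cst_piece _ _ r) => // x; rewrite /= in_itv /= andbT => /h3.
split; apply: M => [x|]; [exact: cvg_fst| |exact: cvg_snd|].
  apply: (eq_measurable_fun id); last exact: measurable_id.
  by move=> x; rewrite inE /= in_itv /= => /h2 ->.
apply: (eq_measurable_fun (cst (0 : R))); last exact: measurable_cst.
by move=> x; rewrite inE /= in_itv /= => /h2 ->.
Qed.

Lemma bounded_profile (g : R -> R) (a b K : R) : measurable_fun setT g ->
  (forall xi, xi != a -> xi != b -> `|g xi| <= K) ->
  bounded_mfun (fun z : plane => g (z.1 / z.2)).
Proof.
move=> mg gK; split; first exact: (measurableT_comp mg (@measurable_ratio R)).
exists (Num.max K (Num.max `|g a| `|g b|)) => z.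
have [->|za] := eqVneq (z.1 / z.2) a; first by rewrite !le_max lexx orbT.
have [->|zb] := eqVneq (z.1 / z.2) b; first by rewrite !le_max lexx !orbT.
by rewrite le_max gK.
Qed.

Lemma distr_of_fun_profile (w g phi : R * R -> R) : nice2 phi ->
  (forall z, 0 < z.2 -> w z = g z) -> bounded_mfun (g : plane -> R) ->
  distr_of_fun w phi = (\int[leb2]_z (hv z.2 * g z * phi z))%:E.
Proof.
move=> nphi wg bg; rewrite /distr_of_fun integral_open_half_plane -integral_nice2.
  apply: eq_integral => z _; congr EFin; rewrite /heaviside.
  by case: ifP => [/wg ->|]; rewrite ?mul1r ?mul0r.
by apply: nice2_mul => //; apply: bounded_mul => //; exact: bounded_time.
Qed.

Lemma locally_integrable_profile (w g : R * R -> R) :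
  (forall z, 0 < z.2 -> w z = g z) -> bounded_mfun (g : plane -> R) ->
  locally_integrable2 w.
Proof.
move=> wg [mg [C gC]] K cK Ko.
have mK : measurable (K : set plane) by exact: compact_measurable2.
apply: (eq_integrable mK (EFin \o g)).
  by move=> z; rewrite inE => /Ko h /=; rewrite wg.
apply: measurable_bounded_integrable => //.
- exact: compact_lt_pinfty.
- exact: measurable_funTS.
- by exists C; split; [exact: num_real|move=> x /ltW Cx y _; exact: le_trans (gC y) Cx].
Qed.

Lemma cvg_of_linear_bound (g : R -> \bar R) (T C : R) :
  (forall delta, 0 < delta <= 1 -> \forall eps \near (0 : R)^'+,
     exists2 r : R, g eps = r%:E & `|r - T| <= C * delta) ->
  g eps @[eps --> (0 : R)^'+] --> T%:E.
Proof.
move=> H; apply/fine_cvgP; split.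
  have h1 : 0 < (1 : R) <= 1 by rewrite ltr01 lexx.
  by apply: filterS (H 1 h1) => eps [r -> _].
apply/cvgrPdist_le => e e0; pose d := Num.min 1 (e / (`|C| + 1)).
have C1 : 0 < `|C| + 1 by rewrite ltr_wpDl.
have d0 : 0 < d by rewrite lt_min ltr01 divr_gt0.
have hd : 0 < d <= 1 by rewrite d0 ge_min lexx.
apply: filterS (H d hd) => eps [r gr rT]; rewrite /= gr /= distrC (le_trans rT)//.
have dC : d * (`|C| + 1) <= e by rewrite -ler_pdivlMr// ge_min lexx orbT.
rewrite (le_trans _ dC)// mulrC ler_wpM2l ?(ltW d0)//.
by rewrite (le_trans (ler_norm C))// lerDl.
Qed.

Lemma distr_cvg_of_estimate (w_ : R -> R * R -> R) (T : (R * R -> R) -> \bar R) :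
  (\forall eps \near (0 : R)^'+, exists2 g : R * R -> R,
     forall z, 0 < z.2 -> w_ eps z = g z & bounded_mfun (g : plane -> R)) ->
  (forall phi, test_open phi -> exists T0 C : R, T phi = T0%:E /\
     forall delta, 0 < delta <= 1 -> \forall eps \near (0 : R)^'+,
       exists g : R * R -> R, [/\ forall z, 0 < z.2 -> w_ eps z = g z,
         bounded_mfun (g : plane -> R) &
         `|\int[leb2]_z (hv z.2 * g z * phi z) - T0| <= C * delta]) ->
  distr_cvg w_ T.
Proof.
move=> H1 H2; split.
  by apply: filterS H1 => eps [g]; exact: locally_integrable_profile.
move=> phi tphi; have [T0 [C [-> H]]] := H2 phi tphi.
have nphi : nice2 phi.
  by case: tphi => s c _; have [] := C1_compact_nice2 (test_C1_compact (conj s c)).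
apply: (cvg_of_linear_bound (C := C)) => delta d01.
apply: filterS (H delta d01) => eps [g [wg bg gT]].
by exists (\int[leb2]_z (hv z.2 * g z * phi z)) => //; exact: distr_of_fun_profile.
Qed.

(** [strip_estimate] for a difference, in the similarity variable [x / t], in which the fans are
    described. *)
Lemma strip_comparison (phi : R * R -> R) (K : R) : nice2 phi -> 0 <= K ->
  exists2 C, 0 <= C & forall (F G : R * R -> R) (delta c1 c2 a b : R),
  bounded_mfun (F : plane -> R) -> bounded_mfun (G : plane -> R) -> 0 <= delta ->
  (forall x t, 0 < t -> x / t != a -> x / t != b -> `|F (x, t) - G (x, t)| <= K) ->
  (forall x t, 0 < t -> delta < `|x / t - c1| ->
     delta < `|x / t - c2| -> `|F (x, t) - G (x, t)| <= delta) ->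
  `|\int[leb2]_z (hv z.2 * F z * phi z) - \int[leb2]_z (hv z.2 * G z * phi z)| <= C * delta.
Proof.
move=> nphi K0; have [C C0 H] := strip_estimate nphi K0; exists C => //.
move=> F G delta c1 c2 a b bF bG d0 FK Fd.
have n (A : R * R -> R) : bounded_mfun (A : plane -> R) -> nice2 (fun z => hv z.2 * A z * phi z).
  by move=> bA; apply: nice2_mul => //; apply: bounded_mul => //; exact: bounded_time.
rewrite -RintegralB//; [|exact/nice2_integrable/n|exact/nice2_integrable/n].
have -> : \int[leb2]_z (hv z.2 * F z * phi z - hv z.2 * G z * phi z) =
    \int[leb2]_z (hv z.2 * (F z - G z) * phi z).
  by apply: eq_Rintegral => z _; rewrite mulrBr mulrBl.
have ratio c (x t : R) : 0 < t -> `|x / t - c| * t = `|x - c * t|.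
  move=> t0; rewrite -{2}(gtr0_norm t0) -normrM mulrBl divfK// gt_eqF//.
apply: (H _ delta c1 c2 a b) => //.
- exact: bounded_sub.
- move=> [x t] /= t0 za zb; apply: FK => //.
    by apply: contra_neq za => <-; rewrite divfK// gt_eqF.
  by apply: contra_neq zb => <-; rewrite divfK// gt_eqF.
- by move=> [x t] /= t0; rewrite -!ratio// !ltr_pM2r//; exact: Fd.
Qed.

Lemma limit_u_ratio (a b ul ur x t : R) : 0 < t -> limit_u a b ul ur (x, t) =
  if x / t < a then ul else if b < x / t then ur else x / t.
Proof. by move=> t0; rewrite /limit_u /= ltr_pdivrMr// ltr_pdivlMr. Qed.

Lemma limit_density_ratio (a b rl rr x t : R) : 0 < t -> limit_density a b rl rr (x, t) =
  (if x / t < a then rl else 0) + (if x / t < b then 0 else rr).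
Proof.
move=> t0; rewrite /limit_density /heaviside !hl01 /= t0 mul1r !subr_lt0 !ltr_pdivrMr//.
by case: ifP => _; case: ifP => _; rewrite ?subrr ?subr0 ?mulr0 ?mulr1.
Qed.

Lemma limit_density_time a b rl rr (phi : R * R -> R) :
  \int[leb2]_z (hv z.2 * limit_density a b rl rr z * phi z) =
  \int[leb2]_z (limit_density a b rl rr z * phi z).
Proof.
apply: eq_Rintegral => z _; congr (_ * _); rewrite /limit_density /heaviside.
by case: ifP => _; rewrite ?mul1r ?mul0r.
Qed.

(** [C] is fixed before [delta], so the bounds express convergence; [V] is quantified after [eps],
    so they hold for whichever fan an admissible solution uses. *)
Definition fan_estimate (f : R -> R) (l r : R * R) (a b w : R) :=
  forall phi, C1_compact phi -> exists C, forall delta, 0 < delta <= 1 ->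
  \forall eps \near (0 : R)^'+, forall V,
  two_wave_fan f eps l r V \/ vacuum_fan f eps l r V ->
  [/\ bounded_mfun (fun z : plane => (V (z.1 / z.2)).1),
      bounded_mfun (fun z : plane => (V (z.1 / z.2)).2),
      `|\int[leb2]_z (hv z.2 * (V (z.1 / z.2)).1 * phi z) -
        \int[leb2]_z (hv z.2 * limit_u a b l.1 r.1 z * phi z)| <= C * delta &
      `|\int[leb2]_z (hv z.2 * (V (z.1 / z.2)).2 * phi z) -
        (\int[leb2]_z (limit_density a b l.2 r.2 z * phi z) +
         \int[leb]_t (w * (hv t * t) * phi (a * t, t)))| <= C * delta].

Lemma fan_estimate_nondecreasing (f : R -> R) (l r : R * R) (hf : C2_pos f)
    (hf' : forall r : R, 0 < r -> 0 < derive1 f r)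
    (hf'' : forall r : R, 0 < r -> 0 < derive1 (derive1 f) r) :
  0 < l.2 -> 0 < r.2 -> l.1 <= r.1 -> fan_estimate f l r l.1 r.1 0.
Proof.
move=> l0 r0 lr phi C; have [nphi _ _] := C1_compact_nice2 C.
have bU := @bounded_limit_u _ _ _ l.1 r.1 lr.
have bD := bounded_limit_density l.1 r.1 l.2 r.2.
have [_ [B1 hB1]] := bU; have [_ [B2 hB2]] := bD.
have B10 : 0 <= B1 := le_trans (normr_ge0 _) (hB1 point).
have B20 : 0 <= B2 := le_trans (normr_ge0 _) (hB2 point).
pose N := Num.max l.2 r.2; have N0 : 0 <= N by rewrite le_max (ltW l0).
pose K1 := `|l.1| + `|r.1| + 1.
have K10 : 0 <= K1 by rewrite !addr_ge0.
have [C1 C10 H1] := strip_comparison nphi (addr_ge0 K10 B10).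
have [C2 C20 H2] := strip_comparison nphi (addr_ge0 N0 B20).
exists (C1 + C2) => delta /andP[d0 _].
apply: filterS (fan_near_nondecreasing hf hf' hf'' l0 r0 d0 lr) => eps H V hV.
have [m1 m2] := measurable_fan hV.
have [hl' hr' hm [a [b box]]] := H V hV.
have V1 xi : xi != a -> xi != b -> `|(V xi).1| <= K1.
  move=> xa xb; have [/andP[h1 h2] _] := box xi xa xb; rewrite /K1 ler_norml.
  have := ler_norm (- l.1); have := ler_norm r.1; rewrite normrN.
  have := normr_ge0 l.1; have := normr_ge0 r.1 => k1 k2 k3 k4.
  by apply/andP; split; clear -h1 h2 k1 k2 k3 k4; lra.
have V2 xi : xi != a -> xi != b -> `|(V xi).2| <= N.
  by move=> xa xb; have [_ /andP[h1 h2]] := box xi xa xb; rewrite ger0_norm.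
have b1 := bounded_profile m1 V1; have b2 := bounded_profile m2 V2.
have cases xi : delta < `|xi - l.1| -> delta < `|xi - r.1| ->
    [\/ xi < l.1 - delta, r.1 + delta < xi | l.1 + delta < xi < r.1 - delta].
  rewrite !ltr_normr => /orP[h1|h1] /orP[h2|h2].
  - by constructor 2; clear -h2; lra.
  - by constructor 3; apply/andP; split; clear -h1 h2; lra.
  - by constructor 2; clear -h2; lra.
  - by constructor 1; clear -h1; lra.
split => //.
  apply: (@le_trans _ _ (C1 * delta)); last by rewrite ler_wpM2r ?(ltW d0)// lerDl.
  apply: (H1 _ _ delta l.1 r.1 a b) => //; first exact: ltW.
    by move=> x t t0 xa xb; rewrite (le_trans (ler_normB _ _))// lerD// V1.
  move=> x t t0 h1 h2; rewrite limit_u_ratio//=.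
  have [h|h|h] := cases _ h1 h2.
  - rewrite (hl' _ h) (_ : x / t < l.1) ?subrr ?normr0 ?(ltW d0)//.
    by clear -h d0; lra.
  - rewrite (hr' _ h) (_ : r.1 < x / t); last by clear -h d0; lra.
    by rewrite ltNge (_ : l.1 <= x / t) ?subrr ?normr0 ?(ltW d0)//; clear -h d0 lr; lra.
  have [k1 _] := hm _ h; case/andP: h => h h'.
  rewrite ltNge (_ : l.1 <= x / t); last by clear -h d0; lra.
  by rewrite ltNge (_ : x / t <= r.1)//; clear -h' d0; lra.
have -> : \int[leb]_t (0 * (hv t * t) * phi (l.1 * t, t)) = 0.
  transitivity (\int[leb]_(t in setT) (0 : R)); last by rewrite /Rintegral integral0.
  by apply: eq_Rintegral => t _; rewrite !mul0r.
rewrite addr0 -limit_density_time.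
apply: (@le_trans _ _ (C2 * delta)); last by rewrite ler_wpM2r ?(ltW d0)// lerDr.
apply: (H2 _ _ delta l.1 r.1 a b) => //; first exact: ltW.
  by move=> x t t0 xa xb; rewrite (le_trans (ler_normB _ _))// lerD// V2.
move=> x t t0 h1 h2; rewrite limit_density_ratio//=.
have [h|h|h] := cases _ h1 h2.
- rewrite (hl' _ h) (_ : x / t < l.1); last by clear -h d0; lra.
  by rewrite (_ : x / t < r.1) ?addr0 ?subrr ?normr0 ?(ltW d0)//; clear -h d0 lr; lra.
- rewrite (hr' _ h) ltNge (_ : l.1 <= x / t) /=; last by clear -h d0 lr; lra.
  by rewrite ltNge (_ : r.1 <= x / t) /= ?add0r ?subrr ?normr0 ?(ltW d0)//; clear -h d0; lra.
have [_ /andP[k1 k2]] := hm _ h; case/andP: h => h h'.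
rewrite ltNge (_ : l.1 <= x / t) /=; last by clear -h d0; lra.
rewrite (_ : x / t < r.1); last by clear -h' d0; lra.
by rewrite addr0 subr0 ger0_norm.
Qed.

Lemma fan_estimate_decreasing (f : R -> R) (l r : R * R) (hf : C2_pos f)
    (hf' : forall r : R, 0 < r -> 0 < derive1 f r)
    (hf'' : forall r : R, 0 < r -> 0 < derive1 (derive1 f) r) :
  0 < l.2 -> 0 < r.2 -> r.1 < l.1 ->
  fan_estimate f l r ((l.1 + r.1) / 2) ((l.1 + r.1) / 2) ((l.1 - r.1) / 2 * (l.2 + r.2)).
Proof.
move=> l0 r0 rl phi C; have [nphi _ _] := C1_compact_nice2 C.
set s := (l.1 + r.1) / 2; set w := (l.1 - r.1) / 2 * (l.2 + r.2).
have w0 : 0 <= w by rewrite mulr_ge0 ?divr_ge0 ?subr_ge0 ?(ltW rl)// addr_ge0// ltW.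
have bU := @bounded_limit_u _ _ _ l.1 r.1 (lexx s).
have bD := bounded_limit_density s s l.2 r.2.
have [_ [B1 hB1]] := bU; have [_ [B2 hB2]] := bD.
have B10 : 0 <= B1 := le_trans (normr_ge0 _) (hB1 point).
have B20 : 0 <= B2 := le_trans (normr_ge0 _) (hB2 point).
pose K1 := `|l.1| + `|r.1|; pose K2 := l.2 + r.2.
have K10 : 0 <= K1 by rewrite !addr_ge0.
have K20 : 0 <= K2 by rewrite addr_ge0// ltW.
have [C1 C10 H1] := strip_comparison nphi (addr_ge0 K10 B10).
have [C2 C20 H2] := strip_comparison nphi (addr_ge0 K20 B20).
have [C3 C30 H3] := narrow_strip_estimate s C.
set J := \int[leb]_t (hv t * t * phi (s * t, t)) in H3.
(* [w + 1] bounds the mass rate of the plateau, as [delta <= 1]; [J] is the factor by which an error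
   in that rate is multiplied. *)
exists (C1 + (C2 + (C3 * (w + 1) + `|J|))) => delta /andP[d0 d1].
apply: filterS (fan_near_decreasing hf hf' hf'' l0 r0 d0 rl) => eps H V hV.
have [m1 m2] := measurable_fan hV.
have [s1 [s2 [m [[hl' hm hr'] [s12 m20] /andP[mr ml] [s1d s2d] md]]]] := H V hV.
have cases xi : xi != s1 -> xi != s2 -> [\/ xi < s1, s1 < xi < s2 | s2 < xi].
  move=> x1 x2; have [h|h] := lt_or_le xi s1; first by constructor 1.
  have [h'|h'] := lt_or_le xi s2; first by constructor 2; rewrite lt_neqAle eq_sym x1 h.
  by constructor 3; rewrite lt_neqAle eq_sym x2.
have V1 xi : xi != s1 -> xi != s2 -> `|(V xi).1| <= K1.
  move=> x1 x2; have := ler_norm (- r.1); have := ler_norm l.1; rewrite normrN.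
  have := normr_ge0 l.1; have := normr_ge0 r.1 => k1 k2 k3 k4.
  have [h|h|h] := cases xi x1 x2; [rewrite (hl' _ h)|rewrite (hm _ h)|rewrite (hr' _ h)].
  - by rewrite lerDl.
  - by rewrite ler_norml; apply/andP; split; clear -mr ml k1 k2 k3 k4; rewrite /K1; lra.
  - by rewrite lerDr.
(* This bound blows up with [m.2]; it serves integrability at fixed [eps], while the estimate uses
   the uniform bound [K2] after removal of the plateau. *)
have V2 xi : xi != s1 -> xi != s2 -> `|(V xi).2| <= K2 + m.2.
  move=> x1 x2; have [h|h|h] := cases xi x1 x2;
    [rewrite (hl' _ h)|rewrite (hm _ h)|rewrite (hr' _ h)]; rewrite ger0_norm ?ltW//.
  - by rewrite /K2 -addrA ltrDl addr_gt0.
  - by rewrite ltrDr addr_gt0.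
  - by rewrite /K2 addrAC ltrDr addr_gt0.
have b1 := bounded_profile m1 V1; have b2 := bounded_profile m2 V2.
have far xi : delta < `|xi - s| -> (xi < s1 /\ xi < s) \/ (s2 < xi /\ s < xi).
  move: s1d s2d; rewrite -/s !ler_norml ltr_normr => /andP[h1 h2] /andP[h3 h4] /orP[h|h].
    by right; split; clear -h h4 d0; lra.
  by left; split; clear -h h1 d0; lra.
have wS : C3 * (w + 1) + `|J| >= 0 by rewrite addr_ge0// mulr_ge0// addr_ge0.
split => //.
  apply: (@le_trans _ _ (C1 * delta)).
    apply: (H1 _ _ delta s s s1 s2) => //; first exact: ltW.
      by move=> x t t0 xa xb; rewrite (le_trans (ler_normB _ _))// lerD// V1.
    move=> x t t0 h1 _; rewrite limit_u_ratio//=.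
    have [[h h']|[h h']] := far _ h1; first by rewrite (hl' _ h) h' subrr normr0 ltW.
    by rewrite (hr' _ h) h' (lt_gtF h') subrr normr0 ltW.
  by rewrite ler_wpM2r ?(ltW d0)// lerDl addr_ge0.
pose mid (z : R * R) := m.2 * (hv (z.1 - s1 * z.2) * hl (z.1 - s2 * z.2)).
have midE (x t : R) : 0 < t -> mid (x, t) = if s1 < x / t < s2 then m.2 else 0.
  move=> t0; rewrite /mid hl01 /heaviside /= subr_gt0 subr_lt0 ltr_pdivlMr// ltr_pdivrMr//.
  by case: (_ < _); case: (_ < _); rewrite ?mulr1 ?mulr0.
have bmid : bounded_mfun (mid : plane -> R).
  apply: bounded_mul; first exact: bounded_mfun_cst.
  apply: bounded_mul; first by apply: measurable_heaviside; exact: measurable_speed.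
  exact: (bounded_comp (@bounded_hl R) (measurable_speed s2)).
(* Off the two shocks [F] is [l.2], 0 or [r.2], so [strip_comparison] applies with constants
   independent of [eps]; the plateau [mid] is left to [narrow_strip_estimate]. *)
pose F (z : R * R) := (V (z.1 / z.2)).2 - mid z.
have bF : bounded_mfun (F : plane -> R) := bounded_sub b2 bmid.
have nice (A : R * R -> R) : bounded_mfun (A : plane -> R) -> nice2 (fun z => hv z.2 * A z * phi z).
  by move=> bA; apply: nice2_mul => //; apply: bounded_mul => //; exact: bounded_time.
have -> : \int[leb2]_z (hv z.2 * (V (z.1 / z.2)).2 * phi z) =
    \int[leb2]_z (hv z.2 * F z * phi z) + \int[leb2]_z (hv z.2 * mid z * phi z).
  rewrite -integral_nice2D//; [|exact: nice|exact: nice].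
  by apply: eq_Rintegral => z _; rewrite -mulrDl -mulrDr subrK.
have -> : \int[leb]_t (w * (hv t * t) * phi (s * t, t)) = w * J.
  rewrite -integral_nice1Z; last first.
    by have := nice_ray s 1 nphi; congr nice1; apply/funext => t; rewrite mul1r.
  by apply: eq_Rintegral => t _; rewrite -!mulrA.
have E2 : `|\int[leb2]_z (hv z.2 * F z * phi z) -
    \int[leb2]_z (limit_density s s l.2 r.2 z * phi z)| <= C2 * delta.
  rewrite -limit_density_time; apply: (H2 _ _ delta s s s1 s2) => //; first exact: ltW.
    move=> x t t0 xa xb; rewrite (le_trans (ler_normB _ _))// lerD//.
    rewrite /F midE//=; have [h|h|h] := cases _ xa xb.
    - by rewrite (hl' _ h) (lt_gtF h) /= subr0 ger0_norm ?(ltW l0)// lerDl ltW.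
    - by rewrite (hm _ h) h subrr normr0.
    - by rewrite (hr' _ h) (lt_gtF h) andbF subr0 ger0_norm ?(ltW r0)// lerDr ltW.
  move=> x t t0 h1 _; rewrite limit_density_ratio// /F midE//=.
  have [[h h']|[h h']] := far _ h1.
    by rewrite (hl' _ h) h' (lt_gtF h) /= subr0 addr0 subrr normr0 ltW.
  by rewrite (hr' _ h) (lt_gtF h') (lt_gtF h) andbF subr0 add0r subrr normr0 ltW.
have E3 := H3 delta s1 s2 m.2 (ltW d0) (ltW s12) (ltW m20) s1d s2d.
have md' : m.2 * (s2 - s1) <= w + 1.
  move: md; rewrite ler_norml => /andP[_ k]; clear -k d1; rewrite -/w in k; lra.
have E4 : `|m.2 * (s2 - s1) * J - w * J| <= `|J| * delta.
  by rewrite -mulrBl normrM mulrC ler_wpM2l.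
apply: (@le_trans _ _ (C2 * delta + (C3 * (m.2 * (s2 - s1)) * delta + `|J| * delta))).
  set I1 := \int[leb2]_z _ in E2 *; set I2 := \int[leb2]_z _ in E2 *.
  set I3 := \int[leb2]_z _ in E3 *.
  have -> : I1 + I3 - (I2 + w * J) =
    (I1 - I2) + ((I3 - m.2 * (s2 - s1) * J) + (m.2 * (s2 - s1) * J - w * J)) by ring.
  by rewrite (le_trans (ler_normD _ _))// lerD// (le_trans (ler_normD _ _))// lerD.
rewrite -!mulrDl ler_wpM2r ?(ltW d0)//.
apply: (@le_trans _ _ (C2 + (C3 * (w + 1) + `|J|))); last by rewrite lerDr.
by rewrite lerD2l lerD2r ler_wpM2l.
Qed.

End convergence.

(* The limit is [limit_u a b ul ur] with [a = ul], [b = ur], [w = 0] if [ul <= ur];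
   otherwise [a = b] is the speed and [w] the growth rate of the mass of the delta
   shock. *)
Lemma fan_limit (R : realType) (f : R -> R) (l r : R * R) (hf : C2_pos f)
    (hf' : forall r : R, 0 < r -> 0 < derive1 f r)
    (hf'' : forall r : R, 0 < r -> 0 < derive1 (derive1 f) r) :
  0 < l.2 -> 0 < r.2 -> exists a b w : R,
  [/\ a <= b, 0 <= w, fan_estimate f l r a b w &
      [/\ a = l.1, b = r.1 & w = 0] \/
      [/\ a = b, a = (l.1 + r.1) / 2 & w = (l.1 - r.1) / 2 * (l.2 + r.2)]].
Proof.
move=> l0 r0; have [lr|rl] := lt_or_le r.1 l.1; last first.
  exists l.1, r.1, 0; split => //; [exact: fan_estimate_nondecreasing|by left].
exists ((l.1 + r.1) / 2), ((l.1 + r.1) / 2), ((l.1 - r.1) / 2 * (l.2 + r.2)).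
split => //; [|exact: fan_estimate_decreasing|by right].
by rewrite mulr_ge0 ?divr_ge0 ?subr_ge0 ?(ltW lr)// addr_ge0// ltW.
Qed.

(** Testing [fan_estimate] with the zero function extracts the boundedness of the profiles, from
    which local integrability follows. *)
Lemma C1_compact0 (R : realType) : C1_compact (fun _ : R * R => 0 : R).
Proof.
have D0 (v : R * R) : (fun z : R * R => 'D_v (fun _ : R * R => 0 : R) z) = (fun _ => 0 : R).
  by apply/funext => z; exact: derive_cst.
have D1 : dx (fun _ : R * R => 0 : R) = (fun _ => 0 : R) by exact: D0.
have D2 : dt (fun _ : R * R => 0 : R) = (fun _ => 0 : R) by exact: D0.
split; rewrite ?D1 ?D2; [| | | |by exists 0].
- by move=> z; exact: cvg_cst.
- by move=> z; exact: cvg_cst.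
- by move=> z; exact: cvg_cst.
- by move=> z; split; exact: derivable_cst.
Qed.

Theorem theorem1p1 (R : realType) (f : R -> R) (ul ur rhol rhor : R)
    (hf : C2_pos f)
    (hf' : forall r : R, 0 < r -> 0 < derive1 f r)
    (hf'' : forall r : R, 0 < r -> 0 < derive1 (derive1 f) r)
    (hrhol : 0 < rhol) (hrhor : 0 < rhor) :
  (\forall eps \near (0 : R)^'+, exists u rho : R * R -> R,
     admissible_solution f eps (ul, rhol) (ur, rhor) u rho) /\
  exists (u : R * R -> R)
         (nu : {measure set (measurableTypeR R * measurableTypeR R) -> \bar R}),
    [/\ limit_solution (riemann_data ul ur) (riemann_data rhol rhor) u nu,
        locally_integrable2 u &
        forall u_ rho_ : R -> R * R -> R,
          (\forall eps \near (0 : R)^'+,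
             admissible_solution f eps (ul, rhol) (ur, rhor)
               (u_ eps) (rho_ eps)) ->
          distr_cvg u_ (distr_of_fun u) /\
          distr_cvg rho_ (distr_of_measure nu)].
Proof.
split.
  near=> eps; have eps0 : 0 < eps by near: eps; exact: nbhs_right_gt.
  have [V hV] := fan_exists hf hf' hf'' ul ur eps0 hrhol hrhor.
  exists (fun z => (V (z.1 / z.2)).1), (fun z => (V (z.1 / z.2)).2), V.
  by split; [left|].
have [a [b [w [ab w0 est cases]]]] :=
  @fan_limit R f (ul, rhol) (ur, rhor) hf hf' hf'' hrhol hrhor.
have [nu [sol nuE]] := limit_solution_exists (ltW hrhol) (ltW hrhor) w0 ab cases.
have bU := @bounded_limit_u R a b ul ur ab.
exists (limit_u a b ul ur), nu; split => //; first exact: locally_integrable_profile bU.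
move=> u_ rho_ adm.
have [C0 /(_ 1)] := est _ (C1_compact0 R); rewrite ltr01 lexx => /(_ isT) near0.
have profile (v : R * R -> R) (V : R -> R * R) (p : R * R -> R) :
    (forall x t, 0 < t -> v (x, t) = p (V (x / t))) ->
    forall z, 0 < z.2 -> v z = p (V (z.1 / z.2)).
  by move=> h [x t] /= t0; exact: h.
have C1 (phi : R * R -> R) : test_open phi -> C1_compact phi.
  by case=> s c _; exact: test_C1_compact.
split; (apply: distr_cvg_of_estimate; last move=> phi tphi).
- apply: filterS2 adm near0 => eps [V [hV uV]] H; have [b1 _ _ _] := H V hV.
  exists (fun z => (V (z.1 / z.2)).1) => //.
  exact: (profile (u_ eps) V fst (fun x t t0 => (uV x t t0).1)).
- have [C H] := est _ (C1 _ tphi); have [nphi _ _] := C1_compact_nice2 (C1 _ tphi).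
  exists (\int[leb2 (R:=R)]_z (heaviside z.2 * limit_u a b ul ur z * phi z)), C.
  split; first exact: distr_of_fun_profile.
  move=> delta d01; apply: filterS2 adm (H delta d01) => eps [V [hV uV]] {}H.
  have [b1 _ e1 _] := H V hV; exists (fun z => (V (z.1 / z.2)).1); split => //.
  exact: (profile (u_ eps) V fst (fun x t t0 => (uV x t t0).1)).
- apply: filterS2 adm near0 => eps [V [hV uV]] H; have [_ b2 _ _] := H V hV.
  exists (fun z => (V (z.1 / z.2)).2) => //.
  exact: (profile (rho_ eps) V snd (fun x t t0 => (uV x t t0).2)).
have [C H] := est _ (C1 _ tphi); eexists; exists C; split; first exact: nuE.
move=> delta d01; apply: filterS2 adm (H delta d01) => eps [V [hV uV]] {}H.
have [_ b2 _ e2] := H V hV; exists (fun z => (V (z.1 / z.2)).2); split => //.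
exact: (profile (rho_ eps) V snd (fun x t t0 => (uV x t t0).2)).
Unshelve. all: by end_near. Qed.
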